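(* Let $\theta>0$ and let $X_1,X_2$ be independent Ornstein–Uhlenbeck processes solving $dX_i(t)=-\theta X_i(t)dt+dW^i(t)$, $X_i(0)=0$, with independent standard Brownian motions $W^1,W^2$. Let $\Delta_n>0$ with $\Delta_n\to0$ and $T_n:=n\Delta_n\to\infty$, $t_k:=k\Delta_n$, $\tilde X_i(n):=\frac1n\sum_{k=0}^{n-1}X_i(t_k)$, $$\tilde Y_{ij}(n):=\Delta_n\sum_{k=0}^{n-1}X_i(t_k)X_j(t_k)-T_n\tilde X_i(n)\tilde X_j(n),\quad i,j\in\{1,2\},\qquad \tilde\rho(n):=\frac{\tilde Y_{12}(n)}{\sqrt{\tilde Y_{11}(n)\tilde Y_{22}(n)}}.$$ There exists a constant $c(\theta)$ such that for all sufficiently large $n$, $$d_{Kol}\big(\sqrt\theta\sqrt{T_n}\,\tilde\rho(n),\mathcal N(0,1)\big)\le c(\theta)\ln(n\Delta_n)\max\Big((n\Delta_n)^{-1/2},(n\Delta_n^2)^{1/3}\Big).$$ In particular, if $n\Delta_n^2\to0$, then $\sqrt{T_n}\,\tilde\rho(n)\to\mathcal N(0,\frac1\theta)$ in law as $n\to\infty$.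
   Context: $d_{Kol}(X,Y)=\sup_{z\in\mathbb R}|\mathbf P[X\le z]-\mathbf P[Y\le z]|$. *)

(* Defs.v *)
From HB Require Import structures.
From mathcomp Require Import all_boot all_order all_algebra.
From mathcomp Require Import all_classical all_reals all_analysis.
Set Implicit Arguments.
Unset Strict Implicit.
Unset Printing Implicit Defensive.
Import Order.TTheory GRing.Theory Num.Theory.
Import numFieldNormedType.Exports.
Local Open Scope classical_set_scope.
Local Open Scope ring_scope.

Section sample_stats.
Context {R : realType} {T : Type}.

Definition Xtilde (Delta : R) (n : nat) (X : R -> T -> R) (w : T) : R :=
  n%:R^-1 * \sum_(k < n) X (k%:R * Delta) w.

Definition Ytilde (Delta : R) (n : nat) (Xi Xj : R -> T -> R) (w : T) : R :=
  Delta * (\sum_(k < n) Xi (k%:R * Delta) w * Xj (k%:R * Delta) w)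
  - (n%:R * Delta) * Xtilde Delta n Xi w * Xtilde Delta n Xj w.

Definition rhotilde (Delta : R) (n : nat) (X1 X2 : R -> T -> R) (w : T) : R :=
  Ytilde Delta n X1 X2 w / Num.sqrt (Ytilde Delta n X1 X1 w * Ytilde Delta n X2 X2 w).

End sample_stats.

Section prob_defs.
Context {R : realType} {d : measure_display} {Omega : measurableType d}.
Variable P : probability Omega R.

(* CDF of N(0,1): Phi(z) = P[N(0,1) <= z]  (normal_prob m s: mean m, std. dev. s) *)
Definition std_normal_cdf (z : R) : \bar R := normal_prob 0 1 [set x : R | x <= z].

Definition dKol_std_normal (Z : Omega -> R) : \bar R :=
  ereal_sup [set `| P [set w | (Z w <= z)%R] - std_normal_cdf z |%E | z in [set: R]].

(* convergence in law of Z_n to N(m, s^2): convergence of the CDFs at every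
   point (every point is a continuity point of the Gaussian CDF when s > 0) *)
Definition cvg_in_law_normal (Z : nat -> Omega -> R) (m s : R) : Prop :=
  forall z : R,
    (fun n => P [set w | Z n w <= z]) @ \oo --> normal_prob m s [set x : R | x <= z].

(* standard Brownian motion on [0, +oo) (the process is indexed by R, only
   times t >= 0 are relevant) *)
Definition is_std_BM (W : R -> Omega -> R) : Prop :=
  [/\ (forall t, 0 <= t -> measurable_fun [set: Omega] (W t)),
      {ae P, forall w, W 0 w = 0},
      {ae P, forall w, {within [set t : R | 0 <= t], continuous (fun t => W t w)}},
      (forall s t : R, 0 <= s -> s < t -> forall B : set R, measurable B ->
         P ((fun w => W t w - W s w) @^-1` B) = normal_prob 0 (Num.sqrt (t - s)) B) &
      (forall (n : nat) (ts : nat -> R) (B : nat -> set R),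
         0 <= ts 0%N -> (forall i, (i < n)%N -> ts i <= ts i.+1) ->
         (forall i, measurable (B i)) ->
         P (\bigcap_(i in `I_n) ((fun w => W (ts i.+1) w - W (ts i) w) @^-1` B i))
         = (\prod_(i < n) P ((fun w => (W (ts i.+1) w - W (ts i) w)%R) @^-1` B i))%E)].

(* independence of two processes (on times >= 0): the sigma-algebras they
   generate are independent; stated on the generating pi-system of finite
   dimensional cylinder events *)
Definition indep_processes (U V : R -> Omega -> R) : Prop :=
  forall (n m : nat) (s t : nat -> R) (A B : nat -> set R),
    (forall i, 0 <= s i) -> (forall j, 0 <= t j) ->
    (forall i, measurable (A i)) -> (forall j, measurable (B j)) ->
    P (\bigcap_(i in `I_n) (U (s i) @^-1` A i) `&` \bigcap_(j in `I_m) (V (t j) @^-1` B j))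
    = (P (\bigcap_(i in `I_n) (U (s i) @^-1` A i))
       * P (\bigcap_(j in `I_m) (V (t j) @^-1` B j)))%E.

(* X solves dX(t) = -theta X(t) dt + dW(t), X(0) = 0 (strong, pathwise
   solution; since the diffusion coefficient is constant, the SDE in integral
   form X(t) = -theta int_0^t X(s) ds + W(t) involves no stochastic integral) *)
Definition OU_solution (theta : R) (W X : R -> Omega -> R) : Prop :=
  (forall t, 0 <= t -> measurable_fun [set: Omega] (X t)) /\
  {ae P, forall w,
     [/\ X 0 w = 0,
         {within [set t : R | 0 <= t], continuous (fun t => X t w)} &
         forall t, 0 <= t ->
           X t w = - theta * Rintegral lebesgue_measure [set s : R | 0 <= s <= t]
                                       (fun s => X s w) + W t w]}.

End prob_defs.

(* Main.v *)
(** On the grid, [x_k = X1 (k Delta)] and [y_k = X2 (k Delta)] are AR(1) sequences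
    [x_(k+1) = a x_k + xi_k], [a = exp (- theta Delta)], whose innovations are independent
    centred Gaussians of variance [(1 - a^2) / (2 theta)]; this is obtained from the pathwise
    limit of the Euler scheme, which is linear in the Brownian increments.

    Given the second process, the numerator [Ytilde_12] is a linear form in the [xi_k],
    hence a centred Gaussian. Its normalised conditional variance [V] is a constant close
    to 1 plus martingales plus boundary terms, so
    [E |V - 1| <= C (T^(-1/2) + Delta)] by second moments, and averaging
    [P (sqrt V Z <= z)] over the second process costs [C E |V - 1|].

    The denominators are handled on the event [|2 theta Ytilde_ii / T - 1| < 3 ln T / sqrt T].
    Its complement has probability [O (T^(-1/2))]: an exponential moment
    [E exp (l sum x_k^2 + b x_n^2)] with [b] of order [T^(-1/2)] and either sign is controlled
    by a Riccati recursion. Altogether the Kolmogorov distance is at most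
    [C (ln T / sqrt T + Delta)], and [Delta <= (n Delta^2)^(1/3)] once [Delta <= 1 <= T]. *)
Require Import Defs.
From HB Require Import structures.
From mathcomp Require Import all_boot all_order all_algebra.
From mathcomp Require Import all_classical all_reals all_analysis measurable_realfun.
From mathcomp Require Import ring lra.
Set Implicit Arguments.
Unset Strict Implicit.
Unset Printing Implicit Defensive.
Import Order.TTheory GRing.Theory Num.Theory.
Import numFieldNormedType.Exports.
Local Open Scope classical_set_scope.
Local Open Scope ring_scope.

(** * Gaussian measures on the line *)

(** Conditioning enters only through Fubini: [Om] is re-equipped with the sigma-algebra of a
    cylinder pi-system, the identity onto it is independent of the next innovation or of the other
    process, and the past is frozen while that variable is integrated out. No conditional
    expectation is formed. The Gaussian distribution function moves by at most [4 |s - 1|] under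
    scaling by [s], uniformly in its argument. Hence [|V - 1|] enters to the first power, and a
    relative error of the denominators costs a multiple of itself. The logarithm comes from there:
    with [b] of order [T^(-1/2)], the Chernoff bound reaches probability [O (T^(-1/2))] at a
    deviation of order [ln T / sqrt T]. For negative [b] the boundary term [b x_n^2] lowers the
    exponent, so the event [x_n^2 >= sqrt T] is removed by Markov's inequality, at the price of
    another [O (T^(-1/2))]. The increments of both Brownian motions are joined in one Gaussian
    sequence before the Euler limit is taken, so a single limit yields both laws and their
    independence. *)

Definition image_measure d d' (T1 : measurableType d) (T2 : measurableType d')
  (R : realType) (m : {measure set T1 -> \bar R}) (f : T1 -> T2)
  (mf : measurable_fun [set: T1] f) : {measure set T2 -> \bar R} :=
  measure_function_pushforward__canonical__measure_function_Measure m mf.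

Lemma ge0_integral_image_measure d d' (T1 : measurableType d)
    (T2 : measurableType d') (R : realType) (m : {measure set T1 -> \bar R})
    (f : T1 -> T2) (mf : measurable_fun [set: T1] f) (g : T2 -> \bar R) :
  measurable_fun [set: T2] g -> (forall y, (0 <= g y)%E) ->
  (\int[image_measure m mf]_y g y = \int[m]_x g (f x))%E.
Proof. by move=> mg g0; rewrite ge0_integral_pushforward. Qed.

Section affine.
Context {R : realType}.
Local Notation mu := (@lebesgue_measure R).
Local Open Scope ereal_scope.

Lemma measurable_affine (m s : R) :
  measurable_fun [set: R] (fun x : R => (m + s * x)%R).
Proof. by apply: measurable_funD => //; exact: measurable_funM. Qed.

(** The pushforward of [mu] by the affine map, multiplied by [s], has the right value on half-open
    intervals, and these determine Lebesgue measure. *)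
Lemma lebesgue_measure_affine (m s : R) (A : set R) : (0 < s)%R -> measurable A ->
  mu A = s%:E * mu ((fun x : R => (m + s * x)%R) @^-1` A).
Proof.
move=> s0 mA; have sge0 : (0 <= s)%R by exact: ltW.
have mf : measurable_fun [set: measurableTypeR R]
   ((fun x => (m + s * x)%R) : _ -> measurableTypeR R) by exact: measurable_affine.
pose nu := mscale (NngNum sge0) (image_measure mu mf).
suff -> : mu A = nu A by [].
apply: lebesgue_measure_unique => //= _ [[a b]] _ <-.
rewrite /nu /mscale /image_measure/= /pushforward/=.
have -> : (fun x : R => (m + s * x)%R) @^-1` `]a, b]%classic =
    `]((a - m) / s)%R, ((b - m) / s)%R]%classic :> set R.
  apply/seteqP; split => x /=; rewrite !in_itv/= ltr_pdivrMr// ler_pdivlMr//;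
  by rewrite ltrBlDl lerBrDl (mulrC x).
rewrite !lebesgue_measure_itv/= !lte_fin ltr_pM2r ?invr_gt0// ltrD2r.
case: ifPn => ab; last by rewrite mule0.
by rewrite -!EFinB -EFinM; congr EFin; field; lra.
Qed.

Lemma ge0_integral_affine (m s : R) (f : R -> \bar R) : (0 < s)%R ->
  measurable_fun [set: R] f -> (forall x, 0 <= f x) ->
  \int[mu]_x f x = s%:E * \int[mu]_x f (m + s * x)%R.
Proof.
move=> s0 mfun f0; have sge0 : (0 <= s)%R by exact: ltW.
have mf : measurable_fun [set: measurableTypeR R]
   ((fun x => (m + s * x)%R) : _ -> measurableTypeR R) by exact: measurable_affine.
pose nu := mscale (NngNum sge0) (image_measure mu mf).
transitivity (\int[nu]_x f x).
  apply: eq_measure_integral => A mA _.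
  have H := lebesgue_measure_affine m s0 mA.
  exact H.
transitivity (s%:E * \int[image_measure mu mf]_x f x).
  exact: (@ge0_integral_mscale _ _ R (image_measure mu mf) setT measurableT (NngNum sge0) f).
by rewrite ge0_integral_image_measure.
Qed.

Import HBNNSimple.

(** [normal_prob] is by definition the integral of its density over the set, which settles
    indicators; simple functions and monotone convergence do the rest. *)
Lemma ge0_integral_normal_prob (m s : R) (f : R -> \bar R) :
  measurable_fun [set: R] f -> (forall x, 0 <= f x) ->
  \int[normal_prob m s]_x f x = \int[mu]_x (f x * (normal_pdf m s x)%:E).
Proof.
move=> mf f0.
have mpdf : measurable_fun [set: R] (EFin \o normal_pdf m s).
  by apply/measurable_EFinP; exact: measurable_normal_pdf.
pose f_ := nnsfun_approx measurableT mf.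
have cvf x : (f_ n x)%:E @[n --> \oo] --> f x by exact: cvg_nnsfun_approx.
have f_nd x i j : (i <= j)%N -> (f_ i x <= f_ j x)%R.
  by move=> ij; exact/lefP/nd_nnsfun_approx.
transitivity (limn (fun n => \int[normal_prob m s]_x (f_ n x)%:E)).
  rewrite -monotone_convergence//=.
  - by apply: eq_integral => x _; apply/esym/cvg_lim => //; exact: cvf.
  - by move=> n; apply/measurable_EFinP; exact (measurable_funPT (f_ n)).
  - by move=> n x _; rewrite lee_fin.
  - by move=> x _ i j ij; rewrite lee_fin; exact: f_nd.
transitivity (limn (fun n => \int[mu]_x ((f_ n x)%:E * (normal_pdf m s x)%:E))); last first.
  rewrite -monotone_convergence//=.
  - apply: eq_integral => x _; apply/cvg_lim => //.
    by apply: (cvgeZr _ (cvf x)).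
  - move=> n; apply: emeasurable_funM => //.
    by apply/measurable_EFinP; exact (measurable_funPT (f_ n)).
  - by move=> n x _; rewrite -EFinM lee_fin mulr_ge0// normal_pdf_ge0.
  - move=> x _ i j ij; rewrite -!EFinM lee_fin ler_wpM2r// ?normal_pdf_ge0//.
    exact: f_nd.
apply/congr_lim/funext => n.
have fE x : (f_ n x)%:E = \sum_(y \in range (f_ n)) (y * \1_(f_ n @^-1` [set y]) x)%:E.
  by rewrite fsumEFin// -fimfunE.
under eq_integral do rewrite fE.
under [in RHS]eq_integral.
  move=> x _; rewrite fE ge0_mule_fsuml; last first.
    by move=> y; rewrite EFinM nnfun_muleindic_ge0.
  over.
have ge0 y x : 0 <= (y * \1_(f_ n @^-1` [set y]) x)%:E.
  by rewrite EFinM nnfun_muleindic_ge0.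
have mI y : measurable_fun [set: R] (fun x => (y * \1_(f_ n @^-1` [set y]) x)%:E).
  by apply/measurable_EFinP; apply: measurable_funM.
rewrite !ge0_integral_fsum//; first last.
- by move=> y x _; rewrite mule_ge0// lee_fin normal_pdf_ge0.
- by move=> y; apply: emeasurable_funM => //; exact (mI y).
apply: eq_fsbigr => y _.
have mfI : measurable (f_ n @^-1` [set y]) by [].
have mi : measurable_fun [set: R] (fun x => (\1_(f_ n @^-1` [set y]) x : R)%:E).
  exact/measurable_EFinP/measurable_indic.
have [y0|y0] := leP 0%R y; last first.
  rewrite !integral0_eq// => x _;
  by rewrite preimage_nnfun0// indic0 mulr0 ?mul0e.
under eq_integral do rewrite EFinM.
rewrite ge0_integralZl//; last first.
under [in RHS]eq_integral do rewrite EFinM -muleA.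
rewrite ge0_integralZl//; last 2 first.
- by apply: emeasurable_funM.
- by move=> x _; rewrite -EFinM lee_fin mulr_ge0// normal_pdf_ge0.
congr (_ * _).
rewrite integral_indic// setIT.
transitivity (\int[mu]_(x in f_ n @^-1` [set y]) (normal_pdf m s x)%:E).
  by [].
rewrite [LHS]integral_mkcond; apply: eq_integral => x _.
by rewrite patchE indicE; case: ifPn; rewrite ?mul1e ?mul0e.
Qed.

End affine.

(** * Algebra of Gaussian densities *)

Section normal_density.
Context {R : realType}.
Local Notation mu := (@lebesgue_measure R).

Lemma normal_pdf_gt0E (m s x : R) : 0 < s ->
  normal_pdf m s x =
  (s * Num.sqrt (pi * 2))^-1 * expR (- (x - m) ^+ 2 / (2 * s ^+ 2)).
Proof.
move=> s0; rewrite normal_pdfE ?gt_eqF// /normal_peak /normal_fun.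
rewrite -(mulr_natr (s ^+ 2 * pi)) -(mulr_natr (s ^+ 2)) (mulrC (s ^+ 2) 2).
by rewrite -mulrA sqrtrM ?sqr_ge0// sqrtr_sqr gtr0_norm.
Qed.

Lemma normal_pdf_affine (m s z : R) : 0 < s ->
  s * normal_pdf m s (m + s * z) = normal_pdf 0 1 z.
Proof.
move=> s0; rewrite !normal_pdf_gt0E// mul1r expr1n.
rewrite invfM mulrA mulrA divff ?gt_eqF// mul1r; congr (_ * expR _).
by field; rewrite gt_eqF.
Qed.

(** Completing the square: the tilted density is a multiple of the Gaussian density with variance
    [q^-1], so the prefactor on the right is the exponential moment. *)
Lemma normal_pdf_expR_sqr (b c s z : R) : 0 < 1 - 2 * b * s ^+ 2 ->
  let q := 1 - 2 * b * s ^+ 2 in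
  expR (b * (c + s * z) ^+ 2) * normal_pdf 0 1 z =
  (Num.sqrt q)^-1 * expR (b * c ^+ 2 / q)
    * normal_pdf (2 * b * c * s / q) (Num.sqrt q)^-1 z.
Proof.
move=> q0 q; have sq0 : 0 < Num.sqrt q by rewrite sqrtr_gt0.
have sqq : Num.sqrt q ^+ 2 = q by rewrite sqr_sqrtr// ltW.
rewrite !normal_pdf_gt0E ?invr_gt0// mul1r expr1n exprVn sqq.
rewrite [((Num.sqrt q)^-1 * _)^-1]invfM invrK.
set p := (Num.sqrt (pi * 2))^-1.
rewrite mulrCA -expRD [RHS]mulrACA -expRD (mulrA (Num.sqrt q)^-1).
rewrite mulVf ?gt_eqF// mul1r.
congr (_ * expR _).
clear sqq sq0; move: q0; rewrite /q {p q} => q0.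
by field; rewrite gt_eqF.
Qed.

(** Both sides are the joint density of [x = v * y + c * z] and [y], for independent standard [y]
    and [z]: on the left [x] is conditioned on [y], on the right [y] on [x]. *)
Lemma normal_pdf_conv (c v x y : R) : 0 < c -> 0 < v ->
  let w := Num.sqrt (v ^+ 2 + c ^+ 2) in
  normal_pdf (v * y) c x * normal_pdf 0 1 y =
  normal_pdf 0 w x * normal_pdf (v * x / w ^+ 2) (c / w) y.
Proof.
move=> c0 v0 w; have vc0 : 0 < v ^+ 2 + c ^+ 2 by rewrite addr_gt0// exprn_gt0.
have w0 : 0 < w by rewrite sqrtr_gt0.
have w2 : w ^+ 2 = v ^+ 2 + c ^+ 2 by rewrite sqr_sqrtr// ltW.
rewrite !normal_pdf_gt0E ?divr_gt0 ?mulr_gt0//.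
have p0 : Num.sqrt (pi * 2 : R) != 0 by rewrite gt_eqF// sqrtr_gt0 mulr_gt0// pi_gt0.
rewrite mulrACA [RHS]mulrACA -!expRD; congr (_ * expR _).
  move: (Num.sqrt _) p0 => p p0; move: w w0 {w2} => w w0.
  by field; rewrite p0 !gt_eqF.
rewrite !expr_div_n !w2; clear w w0 w2 p0; field.
by rewrite !gt_eqF ?exprn_gt0.
Qed.

End normal_density.

Section gaussian_integrals.
Context {R : realType}.
Local Notation mu := (@lebesgue_measure R).
Local Notation gam := (@normal_prob R 0 1).

Lemma ge0_integral_normal_affine (m s : R) (f : R -> \bar R) : 0 < s ->
  measurable_fun [set: R] f -> (forall x, (0 <= f x)%E) ->
  (\int[normal_prob m s]_x f x = \int[gam]_z f (m + s * z)%R)%E.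
Proof.
move=> s0 mf f0.
have mpdf m' s' : measurable_fun [set: R] (fun x => (normal_pdf m' s' x : R)%:E).
  by apply/measurable_EFinP; exact: measurable_normal_pdf.
have mfa : measurable_fun [set: R] (fun z : R => f (m + s * z)).
  by apply: measurableT_comp => //; exact: measurable_affine.
apply: (etrans (ge0_integral_normal_prob m s mf f0)).
apply: (etrans _ (esym (ge0_integral_normal_prob 0 1 mfa (fun z => f0 _)))).
rewrite (ge0_integral_affine m s0); last 2 first.
- exact: emeasurable_funM.
- by move=> x; rewrite mule_ge0// lee_fin normal_pdf_ge0.
rewrite -ge0_integralZl//=; last 3 first.
- apply: emeasurable_funM => //.
  by apply: (measurableT_comp (mpdf m s)); exact: measurable_affine.
- by move=> x _; rewrite mule_ge0// lee_fin normal_pdf_ge0.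
- by rewrite lee_fin ltW.
apply: eq_integral => z _.
by rewrite muleCA -EFinM normal_pdf_affine.
Qed.

Lemma normal_prob_affine (m s : R) (B : set R) : 0 < s -> measurable B ->
  normal_prob m s B = gam ((fun z => m + s * z) @^-1` B).
Proof.
move=> s0 mB.
have maf := @measurable_affine R m s.
have mpB : measurable ((fun z => m + s * z) @^-1` B).
  by rewrite -[X in measurable X]setTI; exact: maf.
have E1 m' s' (A : set R) : measurable A ->
    (\int[normal_prob m' s']_x (\1_A x)%:E)%E = normal_prob m' s' A.
  by move=> mA; rewrite integral_indic// setIT.
apply: (etrans (esym (E1 m s B mB))).
apply: (etrans _ (E1 0 1 _ mpB)).
apply: (@ge0_integral_normal_affine m s (fun x => (\1_B x)%:E) s0).
- by apply/measurable_EFinP/measurable_indic.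
- by move=> x; rewrite lee_fin.
Qed.

Lemma integral_gauss_expR_sqr (b c s : R) : 0 < 1 - 2 * b * s ^+ 2 ->
  let q := 1 - 2 * b * s ^+ 2 in
  (\int[gam]_z (expR (b * (c + s * z) ^+ 2))%:E =
   ((Num.sqrt q)^-1 * expR (b * c ^+ 2 / q))%:E)%E.
Proof.
move=> q0 q; have sq0 : 0 < Num.sqrt q by rewrite sqrtr_gt0.
have mexp : measurable_fun [set: R] (fun z => expR (b * (c + s * z) ^+ 2)).
  apply: measurableT_comp => //; apply: measurable_funM => //.
  by apply: measurable_funX; exact: measurable_affine.
apply: (etrans (ge0_integral_normal_prob 0 1 _ _)).
- exact/measurable_EFinP.
- by move=> z; rewrite lee_fin expR_ge0.
under eq_integral do rewrite -EFinM normal_pdf_expR_sqr// EFinM.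
rewrite ge0_integralZl//=.
- by rewrite integral_normal_pdf mule1.
- by apply/measurable_EFinP; exact: measurable_normal_pdf.
- by move=> x _; rewrite lee_fin normal_pdf_ge0.
Qed.

Lemma ge0_integral_gaussN (f : R -> \bar R) :
  measurable_fun [set: R] f -> (forall x, (0 <= f x)%E) ->
  (\int[gam]_z f z = \int[gam]_z f (- z)%R)%E.
Proof.
move=> mf f0.
have mpdf : measurable_fun [set: R] (fun x => (normal_pdf 0 1 x : R)%:E).
  by apply/measurable_EFinP; exact: measurable_normal_pdf.
have mN : measurable_fun [set: measurableTypeR R]
  ((-%R : R -> R) : _ -> measurableTypeR R) by exact: oppr_measurable.
have mfN : measurable_fun [set: R] (fun z => f (- z)).
  by apply: measurableT_comp => //; exact: mN.
apply: (etrans (ge0_integral_normal_prob 0 1 mf f0)).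
apply: (etrans _ (esym (ge0_integral_normal_prob 0 1 mfN (fun z => f0 _)))).
transitivity (\int[image_measure mu mN]_x (f x * (normal_pdf 0 1 x)%:E))%E.
  apply: eq_measure_integral => A mA _.
  have H := lebesgue_measureN mA.
  exact (esym H).
apply: (etrans (@ge0_integral_image_measure _ _ _ _ R mu _ mN
  (fun x => f x * (normal_pdf 0 1 x)%:E)%E _ _)).
- exact: emeasurable_funM.
- by move=> x; rewrite mule_ge0// lee_fin normal_pdf_ge0.
apply: eq_integral => z _; congr (_ * _%:E)%E.
by rewrite !normal_pdf_gt0E// !subr0 sqrrN.
Qed.


Let gam_id_measurable : measurable_fun [set: measurableTypeR R] (@idfun R : _ -> R).
Proof. by move=> _ A mA; rewrite setTI. Qed.

(** [normal_prob 0 1] lives on [measurableTypeR R]; it is transported along the identity to the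
    canonical measurable structure of [R]. The proof is opaque, so the two listed properties are all
    that is known of [gauss]. *)
Lemma std_gauss_exists : {g : probability R R |
  (forall A, measurable A -> g A = gam A) &
  (forall f : R -> \bar R, measurable_fun [set: R] f -> (forall x, (0 <= f x)%E) ->
    \int[g]_x f x = \int[gam]_x f x)%E}.
Proof.
pose g := image_measure gam gam_id_measurable.
have g1 : g [set: R] = 1%E by exact: probability_setT.
pose gp : probability R R := HB.pack (g : set R -> \bar R)
  (Measure.class g) (Measure_isProbability.Build _ _ _ g g1).
exists gp => // f mf f0.
exact: ge0_integral_image_measure.
Qed.

End gaussian_integrals.

Definition gauss (R : realType) : probability R R := s2val (@std_gauss_exists R).

Section gauss_theory.
Context {R : realType}.
Local Notation mu := (@lebesgue_measure R).
Local Notation gam := (@gauss R).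

Lemma gaussE (A : set R) : measurable A -> gam A = normal_prob 0 1 A.
Proof. exact: (s2valP (@std_gauss_exists R)). Qed.

Lemma ge0_integral_gaussE (f : R -> \bar R) :
  measurable_fun [set: R] f -> (forall x, (0 <= f x)%E) ->
  (\int[gam]_x f x = \int[normal_prob 0 1]_x f x)%E.
Proof. exact: (s2valP' (@std_gauss_exists R)). Qed.

Lemma ge0_integral_gauss (f : R -> \bar R) :
  measurable_fun [set: R] f -> (forall x, (0 <= f x)%E) ->
  (\int[gam]_x f x = \int[mu]_x (f x * (normal_pdf 0 1 x)%:E))%E.
Proof.
move=> mf f0; apply: (etrans (ge0_integral_gaussE mf f0)).
exact: ge0_integral_normal_prob.
Qed.

Lemma measurable_affine_preimage (m s : R) (B : set R) : measurable B ->
  measurable ((fun z => m + s * z) @^-1` B).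
Proof.
by move=> mB; rewrite -[X in measurable X]setTI; exact: measurable_affine.
Qed.

Lemma normal_prob_gauss (m s : R) (B : set R) : 0 < s -> measurable B ->
  normal_prob m s B = gam ((fun z => m + s * z) @^-1` B).
Proof.
move=> s0 mB; rewrite gaussE; last exact: measurable_affine_preimage.
exact: normal_prob_affine.
Qed.

Lemma integral_gauss_sqr (b c s : R) : 0 < 1 - 2 * b * s ^+ 2 ->
  (\int[gam]_z (expR (b * (c + s * z) ^+ 2))%:E =
   ((Num.sqrt (1 - 2 * b * s ^+ 2))^-1
     * expR (b * c ^+ 2 / (1 - 2 * b * s ^+ 2)))%:E)%E.
Proof.
move=> q0; apply: (etrans (ge0_integral_gaussE _ _)).
- apply/measurable_EFinP; apply: measurableT_comp => //; apply: measurable_funM => //.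
  by apply: measurable_funX; exact: measurable_affine.
- by move=> z; rewrite lee_fin expR_ge0.
- exact: integral_gauss_expR_sqr.
Qed.

Lemma ge0_integral_gauss_sym (f : R -> \bar R) :
  measurable_fun [set: R] f -> (forall x, (0 <= f x)%E) ->
  (\int[gam]_z f z = \int[gam]_z f (- z)%R)%E.
Proof.
move=> mf f0; apply: (etrans (ge0_integral_gaussE mf f0)).
apply: (etrans (ge0_integral_gaussN mf f0)).
apply/esym/ge0_integral_gaussE => //.
by apply: measurableT_comp => //; exact: oppr_measurable.
Qed.

Let normal_probE m s (B : set R) : measurable B ->
  normal_prob m s B = (\int[mu]_x (\1_B x * normal_pdf m s x)%:E)%E.
Proof.
move=> mB; transitivity (\int[mu]_(x in B) (normal_pdf m s x)%:E)%E; first by [].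
rewrite [LHS]integral_mkcond; apply: eq_integral => x _.
by rewrite patchE indicE; case: ifPn; rewrite ?mul1r ?mul0r.
Qed.

Let measurable_normal_pdf2 (c v : R) : 0 < c ->
  measurable_fun [set: R * R] (fun p : R * R => normal_pdf (v * p.2) c p.1).
Proof.
move=> c0; rewrite (_ : (fun p : R * R => _) = fun p => (c * Num.sqrt (pi * 2))^-1 *
    expR (- (p.1 - v * p.2) ^+ 2 * (2 * c ^+ 2)^-1)); last first.
  by apply/funext => p; rewrite normal_pdf_gt0E.
apply: measurable_funM => //; apply: measurableT_comp => //.
apply: measurable_funM => //; apply: measurable_funN.
apply: measurable_funX; apply: measurable_funB => //.
by apply: measurable_funM.
Qed.

(** Tonelli for the joint Lebesgue density, then [normal_pdf_conv]: the inner integral in [y]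
    becomes the total mass of a Gaussian density. *)
Let gauss_conv_gt0 (c v : R) (B : set R) : 0 < c -> 0 < v -> measurable B ->
  (\int[gam]_y gam ((fun z => v * y + c * z)%R @^-1` B) =
   gam ((fun z => 0 + Num.sqrt (v ^+ 2 + c ^+ 2) * z)%R @^-1` B))%E.
Proof.
move=> c0 v0 mB.
set w := Num.sqrt _; have w0 : 0 < w by rewrite sqrtr_gt0 addr_gt0// exprn_gt0.
pose h (p : R * R) : \bar R :=
  ((\1_B p.1 * normal_pdf (v * p.2) c p.1) * normal_pdf 0 1 p.2)%:E.
have m1B : measurable_fun [set: R] (\1_B : R -> R) by exact: measurable_indic.
have mh : measurable_fun [set: R * R] h.
  apply/measurable_EFinP; apply: measurable_funM; last first.
    by apply: (measurableT_comp (measurable_normal_pdf 0 1)); exact: measurable_snd.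
  apply: measurable_funM; last exact: measurable_normal_pdf2.
  by apply: (measurableT_comp m1B); exact: measurable_fst.
have h0 p : (0 <= h p)%E by rewrite lee_fin !mulr_ge0// normal_pdf_ge0.
pose k (p : R * R) : \bar R := (\1_B p.1 * normal_pdf (v * p.2) c p.1)%:E.
have mk : measurable_fun [set: R * R] k.
  apply/measurable_EFinP; apply: measurable_funM; last exact: measurable_normal_pdf2.
  by apply: (measurableT_comp m1B); exact: measurable_fst.
have k0 p : (0 <= k p)%E by rewrite lee_fin !mulr_ge0// normal_pdf_ge0.
pose G y := (\int[mu]_x k (x, y))%E.
have mG : measurable_fun [set: R] G.
  exact (@measurable_fun_fubini_tonelli_G _ _ (measurableTypeR R) R R mu k mk k0).
have G0 y : (0 <= G y)%E by exact: integral_ge0.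
transitivity (\int[gam]_y G y)%E.
  apply: eq_integral => y _.
  by rewrite -normal_prob_gauss// normal_probE.
apply: (etrans (ge0_integral_gauss mG G0)).
transitivity (\int[mu]_y \int[mu]_x h (x, y))%E.
  apply: eq_integral => y _; rewrite /G muleC.
  apply: (etrans (esym (@ge0_integralZl _ _ R mu setT measurableT
    (fun x => k (x, y)) _ _ _ _))) => //.
  - exact: (measurableT_comp mk (measurable_pair2 _)).
  - by rewrite lee_fin normal_pdf_ge0.
  - by apply: eq_integral => x _; rewrite /k /h muleC -EFinM.
refine (etrans (esym (@fubini_tonelli _ _ (measurableTypeR R) (measurableTypeR R) R mu mu h mh h0)) _).
rewrite -normal_prob_gauss// normal_probE//.
apply: eq_integral => x _.
transitivity (\int[mu]_y ((\1_B x * normal_pdf 0 w x)%:E *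
   (normal_pdf (v * x / w ^+ 2) (c / w) y)%:E))%E.
  by apply: eq_integral => y _; rewrite /h/= -mulrA normal_pdf_conv// mulrA EFinM.
apply: (etrans (@ge0_integralZl _ _ R mu setT measurableT
    (fun y => (normal_pdf (v * x / w ^+ 2) (c / w) y)%:E) _ _ _ _)).
- by apply/measurable_EFinP; exact: measurable_normal_pdf.
- by move=> y _; rewrite lee_fin normal_pdf_ge0.
- by rewrite lee_fin mulr_ge0// normal_pdf_ge0.
- by rewrite [X in (_ * X)%E](integral_normal_pdf (v * x / w ^+ 2) (c / w)) mule1.
Qed.

(** A zero coefficient gives a Dirac mass, which has no density, so these cases are treated apart
    from [gauss_conv_gt0]. *)
Lemma gauss_conv (c v : R) (B : set R) : 0 <= c -> 0 <= v -> measurable B ->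
  (\int[gam]_y gam ((fun z => v * y + c * z)%R @^-1` B) =
   gam ((fun z => Num.sqrt (v ^+ 2 + c ^+ 2) * z)%R @^-1` B))%E.
Proof.
move=> c0 v0 mB.
have [->|cn0] := eqVneq c 0.
  rewrite expr0n addr0 sqrtr_sqr ger0_norm//.
  have mpB : measurable ((fun z => v * z) @^-1` B).
    by rewrite -[X in measurable X]setTI; exact: (mulrl_measurable).
  transitivity (\int[gam]_y (\1_((fun z => v * z) @^-1` B) y)%:E)%E; last first.
    by rewrite integral_indic// setIT.
  apply: eq_integral => y _.
  rewrite (_ : _ @^-1` B = [set _ | B (v * y)]); last first.
    by apply/seteqP; split => z /=; rewrite mul0r addr0.
  rewrite indicE.
  have [Bv|Bv] := pselect (B (v * y)).
    rewrite (_ : [set _ | _] = setT); last by apply/seteqP; split.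
    by rewrite probability_setT mem_set.
  rewrite (_ : [set _ | _] = set0); last by apply/seteqP; split.
  by rewrite measure0 memNset.
have {cn0}c0 : 0 < c by rewrite lt_neqAle eq_sym cn0.
have [->|vn0] := eqVneq v 0.
  rewrite expr0n add0r sqrtr_sqr gtr0_norm//.
  transitivity (\int[gam]_y (cst (gam ((fun z : R => (c * z)%R) @^-1` B)) y))%E.
    by apply: eq_integral => y _; congr (gam _);
       apply/seteqP; split => z /=; rewrite mul0r add0r.
  rewrite integral_cst//.
  by rewrite [X in (_ * X)%E]probability_setT mule1.
have {vn0}v0 : 0 < v by rewrite lt_neqAle eq_sym vn0.
rewrite gauss_conv_gt0//; congr (gam _).
by apply/seteqP; split => z /=; rewrite add0r.
Qed.

End gauss_theory.

(** * Gaussian moments from exponential moments *)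

Section gauss_moments.
Context {R : realType}.
Local Notation gam := (@gauss R).

Lemma invr_sqrt_le (q t : R) : 0 < q -> 0 <= t -> 1 <= t ^+ 2 * q ->
  (Num.sqrt q)^-1 <= t.
Proof.
move=> q0 t0 tq; have -> : t = Num.sqrt (t ^+ 2) by rewrite sqrtr_sqr ger0_norm.
by rewrite -sqrtrV ?(ltW q0)// ler_sqrt ?sqr_ge0// -[q^-1]mul1r ler_pdivrMr.
Qed.

Let mexpR (b : R) : measurable_fun [set: R] (fun z => (expR (b * z ^+ 2))%:E).
Proof. by apply/measurable_EFinP; apply: measurableT_comp => //; apply: measurable_funM. Qed.

Let mX n : measurable_fun [set: R] (fun z : R => (z ^+ n)%:E).
Proof. exact/measurable_EFinP. Qed.

Let gauss_expR_sqr0 (b : R) : 0 < 1 - 2 * b ->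
  (\int[gam]_z (expR (b * z ^+ 2))%:E = ((Num.sqrt (1 - 2 * b))^-1)%:E)%E.
Proof.
move=> b0; have := @integral_gauss_sqr R b 0 1.
rewrite expr1n mulr1 expr0n/= mulr0 mul0r expR0 mulr1 => <- //.
by apply: eq_integral => z _; rewrite add0r mul1r.
Qed.

(** Squaring [z ^+ 2 / 8 <= expR (z ^+ 2 / 8)] gives [z ^+ 4 <= 64 * expR (z ^+ 2 / 4)], and the
    exponential moment at [4^-1] is [sqrt 2 <= 2]. *)
Lemma gauss_moment4_le : (\int[gam]_z (z ^+ 4)%:E <= 128%:E)%E.
Proof.
apply: (@le_trans _ _ (\int[gam]_z (64%:E * (expR (4^-1 * z ^+ 2))%:E))%E).
  apply: ge0_le_integral => //.
  - by move=> z _; rewrite lee_fin exprn_even_ge0.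
  - exact: (emeasurable_funM (measurable_cst _) (mexpR _)).
  move=> z _; rewrite -EFinM lee_fin.
  have -> : 4^-1 * z ^+ 2 = z ^+ 2 / 8 + z ^+ 2 / 8 by field.
  rewrite expRD; have := expR_ge1Dx (z ^+ 2 / 8); set e := expR _ => e1.
  have z2 := sqr_ge0 z.
  have : (z ^+ 2 / 8) * (z ^+ 2 / 8) <= e * e by apply: ler_pM; lra.
  by rewrite (_ : z ^+ 4 = z ^+ 2 * z ^+ 2); [lra|ring].
rewrite ge0_integralZl//.
rewrite gauss_expR_sqr0; last by lra.
rewrite -EFinM lee_fin.
suff : (Num.sqrt (1 - 2 * 4^-1))^-1 <= 2 :> R by lra.
by apply: invr_sqrt_le; lra.
Qed.

Let integrable_X4 : gam.-integrable [set: R] (fun z => (z ^+ 4)%:E).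
Proof.
apply/integrableP; split; first exact: mX.
apply: (le_lt_trans _ (ltry 128)); apply: le_trans gauss_moment4_le.
rewrite le_eqVlt; apply/orP; left; apply/eqP/eq_integral => z _.
by rewrite gee0_abs// lee_fin exprn_even_ge0.
Qed.

Let integrable_X2 : gam.-integrable [set: R] (fun z => (z ^+ 2)%:E).
Proof.
apply: (@le_integrable _ _ _ gam setT measurableT _ (fun z => (1 + z ^+ 4)%:E)).
- exact: mX.
- move=> z _; rewrite !abse_EFin lee_fin !ger0_norm ?addr_ge0 ?sqr_ge0 ?exprn_even_ge0//.
  have := sqr_ge0 (z ^+ 2 - 1).
  have -> : (z ^+ 2 - 1) ^+ 2 = z ^+ 4 - 2 * z ^+ 2 + 1 by ring.
  have := sqr_ge0 (z ^+ 2).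
  by rewrite (_ : (z ^+ 2) ^+ 2 = z ^+ 4); [lra|ring].
- under eq_fun do rewrite EFinD.
  apply: integrableD => //.
  exact: finite_measure_integrable_cst.
Qed.

(** The second moment [a] is squeezed between exponential moments at [b] and [- b], as [b] tends to
    0: [1 + b a <= (1 - 2 b)^(-1/2) <= 1 + b + 4 b^2] and [1 - b a <= (1 + 2 b)^(-1/2) <= 1 - b + 2
    b^2]. *)
Lemma gauss_moment2 : (\int[gam]_z (z ^+ 2)%:E = 1)%E.
Proof.
have fin2 := integrable_fin_num measurableT integrable_X2.
rewrite -(fineK fin2); set a := fine _; congr EFin.
have aE : (\int[gam]_z (z ^+ 2)%:E)%E = a%:E by rewrite fineK.
have a0 : 0 <= a by rewrite -lee_fin -aE integral_ge0// => z _; rewrite lee_fin sqr_ge0.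
have bz b : 0 <= b -> (\int[gam]_z (b * z ^+ 2)%:E)%E = (b * a)%:E.
  move=> b0; under eq_integral do rewrite EFinM.
  by rewrite ge0_integralZl// ?aE// => z _; rewrite lee_fin sqr_ge0.
have mb b : measurable_fun [set: R] (fun z => (b * z ^+ 2)%:E).
  by apply/measurable_EFinP; apply: measurable_funM.
have up b : 0 < b -> b <= 4^-1 -> a <= 1 + 4 * b.
  move=> b0 b4.
  have : (\int[gam]_z (1 + (b * z ^+ 2)%:E) <= \int[gam]_z (expR (b * z ^+ 2))%:E)%E.
    apply: ge0_le_integral => //.
    - by move=> z _; rewrite adde_ge0// lee_fin mulr_ge0 ?sqr_ge0// ltW.
    - exact: emeasurable_funD.
    - by move=> z _; rewrite -EFinD lee_fin expR_ge1Dx.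
  rewrite ge0_integralD//; last first.
    by move=> z _; rewrite lee_fin mulr_ge0 ?sqr_ge0// ltW.
  rewrite integral_cst// [X in (1 * X)%E]probability_setT mul1e bz ?(ltW b0)//.
  rewrite gauss_expR_sqr0; last by lra.
  rewrite -EFinD lee_fin => H.
  have : (Num.sqrt (1 - 2 * b))^-1 <= 1 + b + 4 * b ^+ 2.
    apply: invr_sqrt_le; first lra.
      by have := sqr_ge0 b; lra.
    rewrite -subr_ge0.
    have -> : (1 + b + 4 * b ^+ 2) ^+ 2 * (1 - 2 * b) - 1 =
       b ^+ 2 * (5 - 10 * b - 32 * b ^+ 3) by ring.
    apply: mulr_ge0; first exact: sqr_ge0.
    have : b ^+ 3 <= 4^-1 ^+ 3 by apply: lerXn2r; rewrite ?nnegrE; lra.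
    by lra.
  move=> H2; have : b * a <= b * (1 + 4 * b) by nra.
  by rewrite ler_pM2l.
have dn b : 0 < b -> b <= 4^-1 -> 1 - 4 * b <= a.
  move=> b0 b4.
  have : (\int[gam]_z (cst 1 z) <=
          \int[gam]_z ((b * z ^+ 2)%:E + (expR (- b * z ^+ 2))%:E))%E.
    apply: ge0_le_integral => //.
    - exact: emeasurable_funD.
    - by move=> z _; rewrite -EFinD lee_fin; have := expR_ge1Dx (- b * z ^+ 2); lra.
  rewrite integral_cst// [X in (1 * X)%E]probability_setT mul1e.
  rewrite ge0_integralD//; last first.
    by move=> z _; rewrite lee_fin mulr_ge0 ?sqr_ge0// ltW.
  rewrite bz ?(ltW b0)// gauss_expR_sqr0; last by lra.
  rewrite -EFinD lee_fin => H.
  have : (Num.sqrt (1 - 2 * - b))^-1 <= 1 - b + 2 * b ^+ 2.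
    apply: invr_sqrt_le; first lra.
      by have := sqr_ge0 b; lra.
    rewrite -subr_ge0.
    have -> : (1 - b + 2 * b ^+ 2) ^+ 2 * (1 - 2 * - b) - 1 =
       b ^+ 2 * (1 + 6 * b - 4 * b ^+ 2 + 8 * b ^+ 3) by ring.
    apply: mulr_ge0; first exact: sqr_ge0.
    have : 0 <= b ^+ 3 by rewrite exprn_ge0// ltW.
    by nra.
  move=> H2; have : b * (1 - 4 * b) <= b * a by nra.
  by rewrite ler_pM2l.
apply/eqP; rewrite eq_le; apply/andP; split; apply/ler_addgt0Pr => e e0.
- have [e4|e4] := leP e 1.
    have h1 : 0 < e / 4 by lra.
    have h2 : e / 4 <= 4^-1 by lra.
    by have := up _ h1 h2; lra.
  have h1 : (0 : R) < 4^-1 by lra.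
  by have := up _ h1 (lexx _); lra.
- have [e4|e4] := leP e 1.
    have h1 : 0 < e / 4 by lra.
    have h2 : e / 4 <= 4^-1 by lra.
    by have := dn _ h1 h2; lra.
  by lra.
Qed.

(** Averaging the integrand over [z] and [- z] removes the odd powers, so only the moments of order
    2 and 4 enter. This is the second moment of one martingale step, with the past frozen in [A],
    [B], [C]. *)
Lemma gauss_quadratic (A B C : R) :
  (\int[gam]_z ((A + B * z + C * (z ^+ 2 - 1)) ^+ 2)%:E <=
    (A ^+ 2 + B ^+ 2 + 128 * C ^+ 2)%:E)%E.
Proof.
pose g (z : R) := ((A + B * z + C * (z ^+ 2 - 1)) ^+ 2)%:E.
have mg : measurable_fun [set: R] g.
  apply/measurable_EFinP; apply: measurable_funX; apply: measurable_funD.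
    by apply: measurable_funD => //; apply: measurable_funM.
  by apply: measurable_funM => //; apply: measurable_funB.
have g0 z : (0 <= g z)%E by rewrite lee_fin sqr_ge0.
have gsym := ge0_integral_gauss_sym mg g0.
have mgN : measurable_fun [set: R] (fun z => g (- z)).
  by apply: measurableT_comp => //; exact: oppr_measurable.
have : (\int[gam]_z g z + \int[gam]_z g z <=
   (2 * (A ^+ 2 + B ^+ 2 + 128 * C ^+ 2))%:E)%E.
  rewrite {2}gsym -ge0_integralD//.
  pose p0 := 2 * (A - C) ^+ 2; pose p1 := 4 * C * (A - C) + 2 * B ^+ 2.
  pose p2 := 2 * C ^+ 2.
  have -> : (\int[gam]_z (g z + g (- z)%R) =
     \int[gam]_z ((p0%:E + p1%:E * (z ^+ 2)%:E) + p2%:E * (z ^+ 4)%:E))%E.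
    by apply: eq_integral => z _; rewrite /g/= -!EFinM -!EFinD; congr EFin;
      rewrite /p0 /p1 /p2; ring.
  have i0 : gam.-integrable [set: R] (fun=> p0%:E) by exact: finite_measure_integrable_cst.
  have i1 : gam.-integrable [set: R] (fun z => p1%:E * (z ^+ 2)%:E)%E by exact: integrableZl.
  have i2 : gam.-integrable [set: R] (fun z => p2%:E * (z ^+ 4)%:E)%E by exact: integrableZl.
  rewrite integralD//; last exact: integrableD.
  rewrite integralD// !integralZl// gauss_moment2 integral_cst//.
  rewrite [X in (_ * X)%E]probability_setT !mule1.
  have m4 := gauss_moment4_le.
  apply: (@le_trans _ _ (p0%:E + p1%:E + p2%:E * 128%:E)%E).
    by rewrite leeD2l// lee_wpmul2l// lee_fin mulr_ge0 ?sqr_ge0.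
  rewrite -!EFinM -!EFinD lee_fin /p0 /p1 /p2.
  by have := sqr_ge0 C; lra.
have : (0 <= \int[gam]_z g z)%E by exact: integral_ge0.
by case: (\int[gam]_z g z)%E => [r| |]//=; rewrite -EFinD !lee_fin; lra.
Qed.

End gauss_moments.

(** * The Gaussian distribution function under scaling *)

Section gauss_cdf.
Context {R : realType}.
Local Notation gam := (@gauss R).
Local Notation mu := (@lebesgue_measure R).

Definition Phi (z : R) : R := fine (gam [set x | x <= z]).

Lemma measurable_le_set (z : R) : measurable [set x : R | x <= z].
Proof. by rewrite -set_itvNyc; exact: measurable_itv. Qed.

Lemma PhiE z : gam [set x | x <= z] = (Phi z)%:E.
Proof.
by rewrite /Phi fineK// ge0_fin_numE// (le_lt_trans (probability_le1 _ _)) ?ltry//;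
  exact: measurable_le_set.
Qed.

Lemma Phi_ge0 z : 0 <= Phi z.
Proof. by rewrite -lee_fin -PhiE. Qed.

Lemma Phi_le1 z : Phi z <= 1.
Proof. by rewrite -lee_fin -PhiE probability_le1//; exact: measurable_le_set. Qed.

Lemma Phi_increment (a b M : R) : a <= b -> 0 <= M ->
  (forall x, a <= x <= b -> normal_pdf 0 1 x <= M) ->
  0 <= Phi b - Phi a <= (b - a) * M.
Proof.
move=> ab M0 pM.
have mab : measurable (`]a, b]%classic : set R) by exact: measurable_itv.
have E : (Phi b - Phi a)%:E = gam `]a, b]%classic.
  have : gam [set x | x <= b] =
      (gam [set x | x <= a]%R + gam `]a, b]%classic)%E.
    have -> : [set x | x <= b] = [set x | x <= a] `|` `]a, b]%classic.
      apply/seteqP; split => x /=; rewrite in_itv/=.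
        by move=> xb; have [xa|xa] := leP x a; [left|right; apply/andP].
      by move=> [|/andP[]//]; lra.
    apply: measureU => //; first exact: measurable_le_set.
    by apply/seteqP; split => x //= [xa]; rewrite in_itv/=; lra.
  rewrite !PhiE; case: (gam _) => [r| |]//= [->].
  by congr EFin; ring.
suff : (0 <= gam `]a, b]%classic <= ((b - a) * M)%:E)%E by rewrite -E !lee_fin.
rewrite measure_ge0/= gaussE//.
apply: (@le_trans _ _ (\int[mu]_(x in `]a, b]%classic) (cst M%:E x))%E).
  apply: (@ge0_le_integral _ _ R mu `]a, b]%classic mab
    (fun x => (normal_pdf 0 1 x)%:E)).
  - by move=> x _; rewrite lee_fin normal_pdf_ge0.
  - by apply: measurable_funTS; apply/measurable_EFinP; exact: measurable_normal_pdf.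
  - exact: measurable_cst.
  - by move=> x /=; rewrite in_itv/= lee_fin => xab; apply: pM; lra.
rewrite integral_cst//= lebesgue_measure_itv/= lte_fin.
case: ifPn => ab'; rewrite ?mule0 ?lee_fin ?mulr_ge0//; lra.
Qed.

Lemma normal_pdf01_le (x t : R) : t ^+ 2 <= x ^+ 2 ->
  normal_pdf 0 1 x <= expR (- t ^+ 2 / 2).
Proof.
move=> tx; rewrite normal_pdf_gt0E// mul1r subr0 expr1n mulr1.
have p1 : 1 <= Num.sqrt (pi * 2 : R).
  rewrite -[leLHS]sqrtr1 ler_sqrt; last by rewrite mulr_ge0// pi_ge0.
  by have := @pi_ge2 R; lra.
apply: (@le_trans _ _ (1 * expR (- x ^+ 2 / 2))).
  by rewrite ler_wpM2r ?expR_ge0// invf_le1// (lt_le_trans _ p1).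
by rewrite mul1r ler_expR; lra.
Qed.

(** For [s >= 1/2] every point between [s * z] and [z] has modulus at least [t = |z| / 2], so the
    density there is at most [expR (- t ^+ 2 / 2)]; the displacement [2 t |s - 1|] is absorbed by
    [t * expR (- t ^+ 2 / 2) <= 2], whence uniformity in [z]. For smaller [s] the right-hand side
    exceeds 1. *)
Lemma Phi_scale (s z : R) : 0 <= s -> `|Phi (s * z) - Phi z| <= 4 * `|s - 1|.
Proof.
move=> s0.
have [s2|s2] := ltP s 2^-1.
  have h0 := Phi_ge0; have h1 := Phi_le1.
  apply: (@le_trans _ _ 1).
    by rewrite ler_norml; have := h0 (s * z); have := h0 z;
       have := h1 (s * z); have := h1 z; lra.
  by rewrite ler0_norm; lra.
pose t := `|z| / 2.
have t0 : 0 <= t by rewrite divr_ge0.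
have t2 : t ^+ 2 = z ^+ 2 / 4.
  by rewrite /t expr_div_n -normrX ger0_norm ?sqr_ge0//; congr (_ / _); ring.
have tE : t * expR (- t ^+ 2 / 2) <= 2.
  have := expR_ge1Dx (t ^+ 2 / 2) => H.
  rewrite mulNr expRN ler_pdivrMr ?expR_gt0//.
  have := sqr_ge0 (t - 1); rewrite sqrrB; lra.
have zE : `|z| = 2 * t by rewrite /t; field.
pose M := expR (- t ^+ 2 / 2).
have M0 : 0 <= M by exact: expR_ge0.
have pM x : Num.min (s * z) z <= x <= Num.max (s * z) z -> normal_pdf 0 1 x <= M.
  move=> xz; apply: normal_pdf01_le; rewrite t2.
  suff : `|z| / 2 <= `|x|.
    move=> H; have := ler_pM t0 t0 H H.
    by rewrite -!expr2 -normrX ger0_norm ?sqr_ge0// t2.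
  move: xz; rewrite ge_min le_max.
  have [z0|z0] := leP 0 z.
    have : z / 2 <= s * z by nra.
    by move=> ? /andP[/orP[?|?] _]; rewrite (ger0_norm z0) (le_trans _ (ler_norm _))//; lra.
  have : s * z <= z / 2 by nra.
  by move=> ? /andP[_ /orP[?|?]]; rewrite (ltr0_norm z0) -normrN (le_trans _ (ler_norm _))//; lra.
have D : `|s * z - z| * M <= 4 * `|s - 1|.
  rewrite (_ : s * z - z = (s - 1) * z); last by ring.
  rewrite normrM zE (_ : _ * M = `|s - 1| * (2 * (t * M))); last by ring.
  by rewrite (mulrC 4) ler_wpM2l//; rewrite -/M in tE; lra.
have [sz|sz] := leP (s * z) z.
  have := @Phi_increment (s * z) z M sz M0.
  rewrite (min_l sz) (max_r sz) in pM => /(_ pM) H.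
  rewrite ler0_norm in D; last by lra.
  by rewrite ler0_norm; lra.
have := @Phi_increment z (s * z) M (ltW sz) M0.
rewrite (min_r (ltW sz)) (max_l (ltW sz)) in pM => /(_ pM) H.
rewrite ger0_norm in D; last by lra.
by rewrite ger0_norm; lra.
Qed.

Lemma gauss_scale_le (s z : R) : 0 < s ->
  gam ((fun x => s * x) @^-1` [set x | x <= z]) = (Phi (s^-1 * z))%:E.
Proof.
move=> s0; rewrite -PhiE; congr (gam _); apply/seteqP; split => x /=;
by rewrite (mulrC s^-1) ler_pdivlMr// (mulrC x).
Qed.

(** [Phi_scale] at [v^(-1/2)]; for [v >= 1/4] the scaling error is at most [2 |v - 1|], and for
    smaller [v] the bound exceeds 1. Linearity in [|v - 1|] is what lets a random variance be
    averaged. *)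
Lemma gauss_variance_le (v z : R) : 0 <= v ->
  (`|gam ((fun x => Num.sqrt v * x)%R @^-1` [set x | x <= z]%R) - (Phi z)%:E|
    <= (8 * `|v - 1|)%:E)%E.
Proof.
move=> v0.
have [v4|v4] := ltP v 4^-1.
  have mS : measurable ((fun x => Num.sqrt v * x) @^-1` [set x | x <= z]).
    by rewrite -[X in measurable X]setTI; apply: mulrl_measurable => //;
       exact: measurable_le_set.
  have g1 := probability_le1 gam mS; have g0 := measure_ge0 gam ((fun x => Num.sqrt v * x) @^-1` [set x | x <= z]).
  rewrite -[X in (X - _)%E]fineK ?fin_num_measure//.
  move: g0 g1; rewrite -[X in (0 <= X)%E]fineK ?fin_num_measure// -[X in (X <= 1)%E -> _]fineK ?fin_num_measure//.
  rewrite !lee_fin; move: (fine _) => r r0 r1.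
  apply: (@le_trans _ _ 1); last by rewrite ler0_norm; lra.
  by rewrite ler_norml; have := Phi_ge0 z; have := Phi_le1 z; lra.
have sv : 2^-1 <= Num.sqrt v.
  rewrite (_ : 2^-1 = Num.sqrt (4^-1)); first by rewrite ler_sqrt.
  rewrite (_ : 4^-1 = 2^-1 ^+ 2); last by field.
  by rewrite sqrtr_sqr ger0_norm// invr_ge0.
have sv0 : 0 < Num.sqrt v by lra.
rewrite gauss_scale_le// -EFinB abse_EFin lee_fin.
apply: le_trans (Phi_scale _ _) _; first by rewrite invr_ge0 ltW.
have vE : v = Num.sqrt v ^+ 2 by rewrite sqr_sqrtr.
move: (Num.sqrt v) sv sv0 vE => s sv sv0 ->.
rewrite (_ : s^-1 - 1 = - (s - 1) / s); last by field; lra.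
rewrite (_ : s ^+ 2 - 1 = (s - 1) * (s + 1)); last by ring.
rewrite !normrM normrN normfV (gtr0_norm sv0) (ger0_norm (_ : 0 <= s + 1)); last by lra.
rewrite mulrA ler_pdivrMr// -!mulrA mulrA (mulrC 8) -!mulrA [leLHS]mulrC.
rewrite ler_wpM2l//; nra.
Qed.

End gauss_cdf.

(** * Independence and Gaussian sequences *)

Section independence.
Context d (Om : measurableType d) (R : realType) (P : probability Om R).
Local Open Scope ereal_scope.

(** Independence on rectangles makes the law of [(U, V)] the product of the marginal laws, to which
    Tonelli applies. This replaces conditioning on [U] throughout. *)
Lemma indep_integral d1 d2 (S1 : measurableType d1) (S2 : measurableType d2)
    (U : Om -> S1) (V : Om -> S2) (g : S1 * S2 -> \bar R) :
  measurable_fun [set: Om] U -> measurable_fun [set: Om] V ->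
  (forall A B, measurable A -> measurable B ->
    P (U @^-1` A `&` V @^-1` B) = P (U @^-1` A) * P (V @^-1` B)) ->
  measurable_fun [set: S1 * S2] g -> (forall x, 0 <= g x) ->
  \int[P]_w g (U w, V w) = \int[P]_w \int[P]_w' g (U w, V w').
Proof.
move=> mU mV UV mg g0.
pose fU : {RV P >-> S1} := HB.pack U (isMeasurableFun.Build _ _ _ _ U mU).
pose fV : {RV P >-> S2} := HB.pack V (isMeasurableFun.Build _ _ _ _ V mV).
have mUV : measurable_fun [set: Om] (fun w => (U w, V w)).
  exact: measurable_fun_pair.
pose m1 := distribution P fU; pose m2 := distribution P fV.
rewrite -(ge0_integral_image_measure P mUV mg g0).
transitivity (\int[m1 \x m2]_x g x).
  apply: eq_measure_integral => A mA _.
  by apply/esym/product_measure_unique => // B C mB mC; exact: UV.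
rewrite fubini_tonelli1//.
have mF := measurable_fun_fubini_tonelli_F (m2 := m2) g mg g0.
have F0 x : 0 <= fubini_F m2 g x by exact: integral_ge0.
rewrite (ge0_integral_distribution fU mF F0).
apply: eq_integral => w _ /=; rewrite /fubini_F.
rewrite (ge0_integral_distribution fV)//.
exact: (measurableT_comp mg (measurable_pair1 _)).
Qed.

Lemma probability_integral d' (T : measurableType d') (Q : probability T R)
  (A : set T) : measurable A -> Q A = \int[Q]_w (\1_A w)%:E.
Proof. by move=> mA; rewrite integral_indic// setIT. Qed.

(** Uniqueness of finite measures on a pi-system, for [A] mapped to [P (A & B)] and to
    [P A * P B]. *)
Lemma indep_sigma_algebra (G : set (set Om)) (B : set Om) :
  setI_closed G -> G setT -> G `<=` measurable -> measurable B ->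
  (forall A, G A -> P (A `&` B) = P A * P B) ->
  forall A, <<s G >> A -> P (A `&` B) = P A * P B.
Proof.
move=> GI GT Gm mB GB A sA.
have PBfin : P B \is a fin_num by exact: fin_num_measure.
have PB0 : (0 <= fine (P B))%R by exact: fine_ge0.
have E C : P C * P B = mscale (NngNum PB0) P C.
  by rewrite /mscale/= fineK// muleC.
rewrite E.
apply: (@g_sigma_algebra_measure_unique _ R _ G Gm (fun=> setT) _ _
  (mrestr P mB) (mscale (NngNum PB0) P) GI) => //.
- by rewrite bigcup_const.
- by move=> C GC; apply: (etrans (GB C GC)); exact: E.
- by move=> _; rewrite (le_lt_trans (probability_le1 _ _)) ?ltry//; exact: measurableI.
Qed.

(** A pi-system generating the sigma-algebra of [X 0, ..., X (n - 1)].
    [g_sigma_algebraType (cyl n X)] is [Om] with that sigma-algebra, and measurability over it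
    expresses dependence on these variables only. *)
Definition cyl (n : nat) (X : nat -> Om -> R) : set (set Om) :=
  [set C | exists2 A : nat -> set R, (forall i, measurable (A i)) &
     C = \bigcap_(i in `I_n) (X i @^-1` A i)].

Lemma cyl_setI n X : setI_closed (cyl n X).
Proof.
move=> _ _ [A mA ->] [B mB ->]; exists (fun i => A i `&` B i).
  by move=> i; exact: measurableI.
by rewrite -bigcapI; apply: eq_bigcapr => i _; rewrite preimage_setI.
Qed.

Lemma cyl_setT n X : cyl n X setT.
Proof.
exists (fun=> setT) => //; apply/esym; rewrite -subTset => w _ i _.
by rewrite preimage_setT.
Qed.

Lemma cyl_measurable n X : (forall i, measurable_fun [set: Om] (X i)) ->
  cyl n X `<=` measurable.
Proof.
move=> mX _ [A mA ->]; rewrite bigcap_mkord; apply: bigsetI_measurable => i _.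
by rewrite -[_ @^-1` _]setTI; exact: mX.
Qed.

Lemma cyl_sigma_measurable n X : (forall i, measurable_fun [set: Om] (X i)) ->
  <<s cyl n X >> `<=` measurable.
Proof.
move=> mX; apply: smallest_sub; [exact: sigma_algebra_measurable|].
exact: cyl_measurable.
Qed.

Lemma cyl_comp_measurable n X i : (i < n)%N ->
  measurable_fun [set: g_sigma_algebraType (cyl n X)] (X i).
Proof.
move=> ilt _ B mB; rewrite setTI; apply: sub_sigma_algebra.
exists (fun j => if j == i then B else setT); first by move=> j; case: ifP.
apply/seteqP; split => [w Bw j _ /=|w /(_ i ilt)/=]; last by rewrite eqxx.
by case: eqP => [->|//].
Qed.

(* The law of [s * Z] for [Z] standard normal; [s = 0] gives the Dirac mass at [0]. *)
Definition glaw (s : R) (B : set R) : \bar R := @gauss R ((fun z => s * z)%R @^-1` B).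

Lemma glaw_integral (s : R) (V : Om -> R) (f : R -> \bar R) :
  measurable_fun [set: Om] V ->
  (forall B, measurable B -> P (V @^-1` B) = glaw s B) ->
  measurable_fun [set: R] f -> (forall x, 0 <= f x) ->
  \int[P]_w f (V w) = \int[@gauss R]_z f (s * z)%R.
Proof.
move=> mV VB mf f0.
have ms : measurable_fun [set: R] (fun z : R => (s * z)%R) by exact: mulrl_measurable.
rewrite -(ge0_integral_image_measure P mV mf f0).
rewrite -(ge0_integral_image_measure (@gauss R) ms mf f0).
by apply: eq_measure_integral => A mA _; exact: VB.
Qed.

(** [indep_integral] with [U] the identity from [Om] to its coarser copy [g_sigma_algebraType G]:
    the past is frozen in the first argument of [g] and only the Gaussian [V] is averaged. *)
Lemma cond_gauss_integral (G : set (set Om)) (V : Om -> R) (s : R)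
    (g : g_sigma_algebraType G * R -> \bar R) :
  setI_closed G -> G setT -> G `<=` measurable -> measurable_fun [set: Om] V ->
  (forall C B, G C -> measurable B -> P (C `&` V @^-1` B) = P C * glaw s B) ->
  measurable_fun [set: g_sigma_algebraType G * R] g -> (forall x, 0 <= g x) ->
  \int[P]_w g (w, V w) = \int[P]_w \int[@gauss R]_z g (w, (s * z)%R).
Proof.
move=> GI GT Gm mV CV mg g0.
have VB B : measurable B -> P (V @^-1` B) = glaw s B.
  by move=> mB; have := CV setT B GT mB; rewrite setTI probability_setT mul1e.
have mid : measurable_fun [set: Om] (id : Om -> g_sigma_algebraType G).
  move=> _ A sA; rewrite setTI; move: sA; apply: smallest_sub => //.
  exact: sigma_algebra_measurable.
rewrite (indep_integral mid mV _ mg g0); last first.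
  move=> A B sA mB; apply: (indep_sigma_algebra GI GT Gm _ _ sA).
    by rewrite -[_ @^-1` _]setTI; exact: mV.
  by move=> C GC; rewrite CV// VB.
apply: eq_integral => w _.
apply: (@glaw_integral s V (fun v => g (w, v)) mV VB) => //.
exact: (measurableT_comp mg (measurable_pair1 _)).
Qed.

(** Independent centred Gaussians of standard deviation [|s|]. The law constrains the first [n]
    terms, while measurability is required of all, which spares index conditions. *)
Definition gauss_seq (n : nat) (s : R) (X : nat -> Om -> R) :=
  (forall i, measurable_fun [set: Om] (X i)) /\
  forall A : nat -> set R, (forall i, measurable (A i)) ->
   P (\bigcap_(i in `I_n) (X i @^-1` A i)) = \prod_(i < n) glaw s (A i).

Lemma glaw_setT s : glaw s setT = 1.
Proof. exact: probability_setT. Qed.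

Lemma gauss_seq_widen m n s X : (m <= n)%N -> gauss_seq n s X -> gauss_seq m s X.
Proof.
move=> mn [mX XA]; split => // A mA.
pose A' i := if (i < m)%N then A i else setT.
have := XA A' _; rewrite (_ : \bigcap_(i in `I_n) _ = \bigcap_(i in `I_m) (X i @^-1` A i)).
  move=> ->; last by move=> i; rewrite /A'; case: ifP.
  rewrite -(big_mkord xpredT (fun i => glaw s (A' i))).
  rewrite -(big_mkord xpredT (fun i => glaw s (A i))).
  rewrite (big_cat_nat _ (n := m))//= [X in _ * X]big_nat_cond [X in _ * X]big1.
    rewrite mule1 big_nat_cond [RHS]big_nat_cond; apply: eq_bigr => i.
    by rewrite andbT /A' => /andP[_ ->].
  by move=> i; rewrite andbT /A' => /andP[mi _]; rewrite ltnNge mi glaw_setT.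
apply/seteqP; split => w H i /= im; have := H i.
  by rewrite /A' im; apply; rewrite /= (leq_trans im).
by rewrite /A'; case: ifPn => // im'; apply.
Qed.

Lemma gauss_seq_cyl n s X : gauss_seq n s X -> forall k, (k < n)%N ->
  forall C B, cyl k X C -> measurable B -> P (C `&` X k @^-1` B) = P C * glaw s B.
Proof.
move=> gX k kn _ B [A mA ->] mB.
have [_ Xk] := gauss_seq_widen (ltnW kn) gX.
have [_ XSk] := gauss_seq_widen kn gX.
pose A' i := if i == k then B else A i.
have := XSk A' _; rewrite (_ : \bigcap_(i in `I_k.+1) _ =
    \bigcap_(i in `I_k) (X i @^-1` A i) `&` X k @^-1` B).
  move=> ->; last by move=> i; rewrite /A'; case: ifP.
  rewrite big_ord_recr/= {2}/A' eqxx Xk//; congr (_ * _); apply: eq_bigr => i _.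
  by rewrite /A' ltn_eqF.
apply/seteqP; split => [w H|w [H Hk] i /= ik].
  split; last by have := H k (ltnSn k); rewrite /A'/= eqxx.
  by move=> i /= ik; have := H i (ltnW ik); rewrite /A' ltn_eqF.
rewrite /A'; case: eqP => [->//|/eqP ik']; apply: H => /=.
by rewrite ltn_neqAle ik' -ltnS.
Qed.

Lemma gauss_seq_integral n s X k (g : g_sigma_algebraType (cyl k X) * R -> \bar R) :
  gauss_seq n s X -> (k < n)%N ->
  measurable_fun [set: g_sigma_algebraType (cyl k X) * R] g -> (forall x, 0 <= g x) ->
  \int[P]_w g (w, X k w) = \int[P]_w \int[@gauss R]_z g (w, (s * z)%R).
Proof.
move=> gX kn mg g0; have [mX _] := gX.
apply: (cond_gauss_integral (@cyl_setI k X) (cyl_setT k X) (cyl_measurable mX)) => //.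
exact: gauss_seq_cyl gX _ kn.
Qed.

Lemma glawN s B : measurable B -> glaw (- s) B = glaw s B.
Proof.
move=> mB.
have ms : measurable ((fun z : R => s * z)%R @^-1` B).
  by rewrite -[_ @^-1` _]setTI; exact: mulrl_measurable.
have mNs : measurable ((fun z : R => - s * z)%R @^-1` B).
  by rewrite -[_ @^-1` _]setTI; exact: mulrl_measurable.
rewrite /glaw (probability_integral _ ms) (probability_integral _ mNs).
rewrite [RHS]ge0_integral_gauss_sym//; last exact/measurable_EFinP/measurable_indic.
apply: eq_integral => z _; rewrite !indicE; congr ((nat_of_bool _)%:R%:E).
by apply/idP/idP; rewrite !inE/= mulrN mulNr.
Qed.

(** Induction on [j]: the last variable is integrated out first, then the partial sum by the
    induction hypothesis, and [gauss_conv] merges the two. The event [C] of the first [k] variables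
    is carried along to give independence of the sum from that past. The empty sum has the Dirac law
    [glaw 0]. *)
Lemma gauss_seq_sum n s X (c : nat -> R) k j : gauss_seq n s X -> (k + j <= n)%N ->
  forall C B, cyl k X C -> measurable B ->
  P (C `&` (fun w => \sum_(i < j) c i * X (k + i)%N w)%R @^-1` B) =
  P C * glaw (`|s| * Num.sqrt (\sum_(i < j) c i ^+ 2)) B.
Proof.
move=> gX; have [mX _] := gX.
have mS j' d' (T : measurableType d') (Y : nat -> T -> R) :
    (forall i, (i < j')%N -> measurable_fun [set: T] (Y i)) ->
    measurable_fun [set: T] (fun w => \sum_(i < j') c i * Y i w)%R.
  move=> mY; under eq_fun do rewrite -(big_mkord xpredT (fun i => c i * Y i _)%R) big_nat_cond.
  under eq_fun do rewrite -big_nat_cond big_mkord.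
  apply: measurable_sum => i; apply: measurable_funM => //; exact: mY.
elim: j => [|j IH] kjn C B CC mB.
  rewrite big_ord0 sqrtr0 mulr0.
  have [B0|B0] := pselect (B 0%R).
    have -> : glaw 0 B = 1.
      by rewrite -(glaw_setT 0); congr (@gauss R _); apply/seteqP; split => z //= _; rewrite mul0r.
    rewrite mule1; congr (P _); apply/seteqP; split => [w []//|w Cw]; split => //=.
    by rewrite big_ord0.
  have -> : glaw 0 B = 0.
    rewrite -(measure0 (@gauss R)); congr (@gauss R _).
    by apply/seteqP; split => z //=; rewrite mul0r.
  rewrite mule0 -(measure0 P); congr (P _); apply/seteqP; split => w // [_]/=.
  by rewrite big_ord0.
have {}IH := IH (leq_trans (leq_add (leqnn k) (leqnSn j)) kjn).
have kjn' : (k + j < n)%N by rewrite -addnS.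
set Y := (fun w => \sum_(i < j) c i * X (k + i)%N w)%R in IH.
set t := (`|s| * Num.sqrt (\sum_(i < j) c i ^+ 2))%R in IH.
have t0 : (0 <= t)%R by rewrite mulr_ge0// sqrtr_ge0.
pose cs := (c j * s)%R.
have mY d' (T : measurableType d') (Z : nat -> T -> R) : (forall i, (i < k + j)%N -> measurable_fun [set: T] (Z i)) ->
  measurable_fun [set: T] (fun w => \sum_(i < j) c i * Z (k + i)%N w)%R.
  by move=> mZ; apply: (mS j d' T (fun i => Z (k + i)%N)) => i ij; apply: mZ; rewrite ltn_add2l.
have mYF : measurable_fun [set: g_sigma_algebraType (cyl (k + j) X)] Y.
  by apply: mY => i; exact: cyl_comp_measurable.
have mYO : measurable_fun [set: Om] Y by apply: mY => i _; exact: mX.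
have mSO : measurable_fun [set: Om] (fun w => \sum_(i < j.+1) c i * X (k + i)%N w)%R.
  by apply: (mS j.+1 _ _ (fun i => X (k + i)%N)) => i _; exact: mX.
have mC : measurable C by exact: cyl_measurable CC.
have mCF : measurable (C : set (g_sigma_algebraType (cyl (k + j) X))).
  apply: sub_sigma_algebra; case: CC => A mA ->.
  exists (fun i => if (i < k)%N then A i else setT); first by move=> i; case: ifP.
  apply/seteqP; split => w H i /=.
    by move=> _; case: ifP => // ik; exact: H.
  by move=> ik; have := H i; rewrite /= ik; apply; rewrite ltn_addr.
(* The probability that the full sum lies in [B], given that its first [j] terms add up to [y]. *)
pose h y := @gauss R ((fun z => y + cs * z)%R @^-1` B).
pose g (p : g_sigma_algebraType (cyl (k + j) X) * R) : \bar R :=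
  (\1_C p.1 * \1_B (Y p.1 + c j * p.2)%R)%:E.
have mg : measurable_fun [set: g_sigma_algebraType (cyl (k + j) X) * R] g.
  apply/measurable_EFinP; apply: measurable_funM.
    by apply: (measurableT_comp (measurable_indic mCF)); exact: measurable_fst.
  apply: (measurableT_comp (measurable_indic mB)); apply: measurable_funD.
    by apply: (measurableT_comp mYF); exact: measurable_fst.
  by apply: measurable_funM => //; exact: measurable_snd.
have g0 p : 0 <= g p by rewrite lee_fin mulr_ge0.
pose k2 (p : R * R) : \bar R := (\1_B (p.1 + cs * p.2)%R)%:E.
have mk2 : measurable_fun [set: R * R] k2.
  apply/measurable_EFinP; apply: (measurableT_comp (measurable_indic mB)).
  apply: measurable_funD; first exact: measurable_fst.
  by apply: measurable_funM => //; exact: measurable_snd.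
have hE y : h y = \int[@gauss R]_z k2 (y, z).
  by rewrite /h probability_integral//; exact: measurable_affine_preimage.
have mh : measurable_fun [set: R] h.
  rewrite (_ : h = fun y => \int[@gauss R]_z k2 (y, z)); last exact/funext/hE.
  by apply: (measurable_fun_fubini_tonelli_F k2 mk2) => p; rewrite lee_fin.
pose g' (p : g_sigma_algebraType (cyl k X) * R) : \bar R := (\1_C p.1)%:E * h p.2.
have mCF' : measurable (C : set (g_sigma_algebraType (cyl k X))).
  exact: sub_sigma_algebra.
have mg' : measurable_fun [set: g_sigma_algebraType (cyl k X) * R] g'.
  apply: emeasurable_funM.
    apply/measurable_EFinP.
    by apply: (measurableT_comp (measurable_indic mCF')); exact: measurable_fst.
  by apply: (measurableT_comp mh); exact: measurable_snd.
have g'0 p : 0 <= g' p by rewrite mule_ge0// lee_fin.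
transitivity (\int[P]_w g (w, X (k + j)%N w)).
  rewrite probability_integral; last first.
    by apply: measurableI => //; rewrite -[_ @^-1` _]setTI; exact: mSO.
  apply: eq_integral => w _; rewrite /g/= indicI/= !indicE.
  by congr ((_ * (nat_of_bool _)%:R)%:E); apply/idP/idP; rewrite !inE/= big_ord_recr.
rewrite (gauss_seq_integral gX kjn' mg g0).
transitivity (\int[P]_w g' (w, Y w)).
  apply: eq_integral => w _; rewrite /g' hE -ge0_integralZl//.
  - apply: eq_integral => z _; rewrite /g /k2/= -EFinM.
    by rewrite /cs -mulrA.
  - exact: (measurableT_comp mk2 (measurable_pair1 _)).
  - by move=> z _; rewrite lee_fin.
rewrite (@cond_gauss_integral _ Y t g' (@cyl_setI k X) (cyl_setT k X)
  (cyl_measurable mX) mYO IH mg' g'0).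
have mht : measurable_fun [set: R] (fun y => h (t * y)%R).
  by apply: measurableT_comp => //; exact: mulrl_measurable.
transitivity (\int[P]_w ((\1_C w)%:E * \int[@gauss R]_y h (t * y)%R)).
  apply: eq_integral => w _; rewrite /g'/= ge0_integralZl//.
rewrite ge0_integralZr//; first last.
- by apply: integral_ge0.
- exact/measurable_EFinP/measurable_indic.
rewrite integral_indic// setIT; congr (_ * _).
(* [gauss_conv] wants nonnegative coefficients; symmetry of the Gaussian law removes the sign of
   [cs]. *)
have habs y : h y = @gauss R ((fun z => y + `|cs| * z)%R @^-1` B).
  have mB' : measurable ((fun u => y + 1 * u)%R @^-1` B) by exact: measurable_affine_preimage.
  have E' u : @gauss R ((fun z => y + u * z)%R @^-1` B) = glaw u ((fun u => y + 1 * u)%R @^-1` B).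
    by rewrite /glaw; congr (@gauss R _); apply/seteqP; split => z /=; rewrite mul1r.
  rewrite /h !E'; have [?|?] := leP 0%R cs; first by rewrite ger0_norm.
  by rewrite ltr0_norm// glawN.
under eq_integral do rewrite habs.
rewrite gauss_conv// /glaw; congr (@gauss R _).
suff -> : Num.sqrt (t ^+ 2 + `|cs| ^+ 2) = (`|s| * Num.sqrt (\sum_(i < j.+1) c i ^+ 2))%R by [].
rewrite big_ord_recr/= /t /cs exprMn sqr_sqrtr ?sumr_ge0// => [|i _]; last exact: sqr_ge0.
rewrite -[in RHS]sqrtr_sqr -sqrtrM ?sqr_ge0//; congr Num.sqrt.
by rewrite !real_normK ?num_real//; ring.
Qed.

Lemma gauss_seq_lincomb n s X (c : nat -> R) B : gauss_seq n s X -> measurable B ->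
  P ((fun w => \sum_(i < n) c i * X i w)%R @^-1` B) =
  glaw (`|s| * Num.sqrt (\sum_(i < n) c i ^+ 2)) B.
Proof.
move=> gX mB; have := @gauss_seq_sum n s X c 0 n gX (leqnn _) setT B (cyl_setT _ _) mB.
by rewrite setTI probability_setT mul1e.
Qed.

Lemma indep_cyl n (X Y : nat -> Om -> R) :
  (forall i, measurable_fun [set: Om] (X i)) ->
  (forall i, measurable_fun [set: Om] (Y i)) ->
  (forall A B, cyl n X A -> cyl n Y B -> P (A `&` B) = P A * P B) ->
  forall A B, <<s cyl n X >> A -> <<s cyl n Y >> B -> P (A `&` B) = P A * P B.
Proof.
move=> mX mY XY A B sA sB.
have mB : measurable B by exact: cyl_sigma_measurable sB.
apply: (indep_sigma_algebra (@cyl_setI n X) (cyl_setT n X) (cyl_measurable mX) mB _ sA).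
move=> C CC; have mC : measurable C by exact: cyl_measurable CC.
rewrite setIC muleC.
apply: (indep_sigma_algebra (@cyl_setI n Y) (cyl_setT n Y) (cyl_measurable mY) mC _ sB).
by move=> D DD; rewrite setIC muleC XY.
Qed.

Lemma indep_cyl_integral n (X Y : nat -> Om -> R)
    (g : g_sigma_algebraType (cyl n X) * g_sigma_algebraType (cyl n Y) -> \bar R) :
  (forall i, measurable_fun [set: Om] (X i)) ->
  (forall i, measurable_fun [set: Om] (Y i)) ->
  (forall A B, cyl n X A -> cyl n Y B -> P (A `&` B) = P A * P B) ->
  measurable_fun setT g -> (forall x, 0 <= g x) ->
  \int[P]_w g (w, w) = \int[P]_w \int[P]_w' g (w, w').
Proof.
move=> mX mY XY mg g0.
have mid (Z : nat -> Om -> R) : (forall i, measurable_fun [set: Om] (Z i)) ->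
    measurable_fun [set: Om] (id : Om -> g_sigma_algebraType (cyl n Z)).
  by move=> mZ _ A sA; rewrite setTI; exact: cyl_sigma_measurable sA.
by apply: (indep_integral (mid _ mX) (mid _ mY)) => // A B; exact: indep_cyl.
Qed.

End independence.

(** * Autoregressive sequences *)

Section ar_algebra.
Context {R : realFieldType}.
Variable a : R.
Local Notation s := (1 - a ^+ 2).

Fixpoint ar (X : nat -> R) (k : nat) : R :=
  if k is k'.+1 then a * ar X k' + X k' else 0.

Definition ar_kernel (j k : nat) : R := if (j < k)%N then a ^+ (k - j.+1) else 0.

(** The transpose of the linear map from innovations to the autoregressive sequence. By
    [ar_bilinear] it gives the coefficient of each innovation in the numerator once the other
    process is fixed. *)
Definition ar_adjoint (n : nat) (u : nat -> R) (j : nat) : R :=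
  \sum_(k < n) ar_kernel j k * u k.

Lemma ar_kernelS j k : ar_kernel j k.+1 = a * ar_kernel j k + (j == k)%:R.
Proof.
rewrite /ar_kernel ltnS leq_eqVlt; have [->|jk] /= := eqVneq j k.
  by rewrite ltnn subnn expr0 mulr0 add0r.
by case: ifPn => ltjk; rewrite ?mulr0 addr0// subSn// exprS.
Qed.

Lemma ar_kernel_ge j k : (k <= j)%N -> ar_kernel j k = 0.
Proof. by rewrite /ar_kernel ltnNge => ->. Qed.

Lemma ar_sum n X k : (k <= n)%N -> ar X k = \sum_(j < n) ar_kernel j k * X j.
Proof.
elim: k => [|k IH] kn; first by rewrite big1// => j _; rewrite ar_kernel_ge// mul0r.
rewrite /= (IH (ltnW kn)) mulr_sumr.
have -> : X k = \sum_(j < n) ((j : nat) == k)%:R * X j.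
  rewrite (bigD1 (Ordinal kn))//= eqxx mul1r big1 ?addr0// => j jk.
  by rewrite (_ : _ == _ = false) ?mul0r//; apply/negbTE.
by rewrite -big_split; apply: eq_bigr => j _; rewrite ar_kernelS mulrDl mulrA.
Qed.

Lemma ar_bilinear n (X u : nat -> R) :
  \sum_(k < n) ar X k * u k = \sum_(j < n) ar_adjoint n u j * X j.
Proof.
under eq_bigr => k _ do rewrite (@ar_sum n X k (ltnW (ltn_ord k))) mulr_suml.
rewrite exchange_big; apply: eq_bigr => j _; rewrite /ar_adjoint mulr_suml.
by apply: eq_bigr => k _; ring.
Qed.

Lemma ar_telescope n X : (1 - a) * \sum_(k < n) ar X k = \sum_(k < n) X k - ar X n.
Proof.
elim: n => [|n IH]; first by rewrite !big_ord0 mulr0 subr0.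
by rewrite !big_ord_recr/= mulrDr IH; ring.
Qed.

Lemma ar_adjointS n u j :
  ar_adjoint n.+1 u j = ar_adjoint n u j + ar_kernel j n * u n.
Proof. by rewrite /ar_adjoint big_ord_recr. Qed.

Lemma ar_adjoint_ge n u j : (n <= j.+1)%N -> ar_adjoint n u j = 0.
Proof.
move=> nj; rewrite /ar_adjoint big1// => k _; rewrite ar_kernel_ge ?mul0r//.
by rewrite -ltnS (leq_trans _ nj).
Qed.

Lemma ar_adjointB n u c j :
  ar_adjoint n (fun k => u k - c) j = ar_adjoint n u j - c * ar_adjoint n (fun=> 1) j.
Proof.
rewrite /ar_adjoint mulr_sumr -sumrB; apply: eq_bigr => k _; ring.
Qed.

Lemma ar_adjoint1_bound n j : 0 <= a < 1 -> 0 <= ar_adjoint n (fun=> 1) j <= (1 - a)^-1.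
Proof.
move=> /andP[a0 a1]; have ge0 : 0 <= ar_adjoint n (fun=> 1) j.
  by apply: sumr_ge0 => k _; rewrite mulr1 /ar_kernel; case: ifP; rewrite ?exprn_ge0.
rewrite ge0/= -div1r ler_pdivlMr ?subr_gt0//.
have [nj|jn] := leqP n j.+1; first by rewrite ar_adjoint_ge// mul0r.
suff -> : ar_adjoint n (fun=> 1) j * (1 - a) = 1 - a ^+ (n - j.+1).
  by rewrite gerBl exprn_ge0.
elim: n jn {ge0} => // n IH; rewrite ltnS leq_eqVlt => /predU1P[<-|jn].
  by rewrite ar_adjointS ar_adjoint_ge// /ar_kernel ltnSn subSnn subnn expr0 expr1; ring.
rewrite ar_adjointS mulrDl IH// /ar_kernel (ltnW jn) mulr1 subSn; last exact: ltnW.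
by rewrite exprS; ring.
Qed.

Lemma ar_kernel_sqr n : s * \sum_(j < n) ar_kernel j n ^+ 2 = 1 - a ^+ (2 * n).
Proof.
elim: n => [|n IH]; first by rewrite big_ord0 mulr0 muln0 expr0 subrr.
rewrite big_ord_recr/= {2}/ar_kernel ltnSn subnn expr0.
under eq_bigr => j _ do rewrite ar_kernelS (ltn_eqF (ltn_ord j)) addr0 exprMn.
rewrite -mulr_sumr mulrDr mulrCA IH mulnS exprD; ring.
Qed.

Variable X : nat -> R.
Local Notation y := (ar X).

(** A second filter driven by [y]. Up to the factor [s ^+ 2] it is the cross term that appears when
    the squares of [ar_adjoint n y] are updated from [n] to [n.+1], see [ar_secondE]. The recursive
    form makes visible that it depends on the past only, and gives its second moment. *)
Fixpoint ar_second (k : nat) : R :=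
  if k is k'.+1 then a * ar_second k' + a * s * (1 - a ^+ (2 * k')) * y k' else 0.

Lemma ar_secondE n :
  s ^+ 2 * \sum_(j < n) ar_kernel j n * ar_adjoint n y j = ar_second n.
Proof.
elim: n => [|n IH]; first by rewrite big_ord0 mulr0.
rewrite big_ord_recr/= -IH (ar_adjoint_ge y (leqnn n.+1)) mulr0 addr0.
under eq_bigr => j _.
  rewrite ar_kernelS (ltn_eqF (ltn_ord j)) addr0 ar_adjointS.
  rewrite (_ : _ * _ = a * (ar_kernel j n * ar_adjoint n y j) +
     a * y n * ar_kernel j n ^+ 2); last by ring.
  over.
rewrite big_split/= -!mulr_sumr -ar_kernel_sqr; ring.
Qed.

Lemma ar_adjoint_sqrS n :
  s ^+ 2 * \sum_(j < n.+1) ar_adjoint n.+1 y j ^+ 2 =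
  s ^+ 2 * \sum_(j < n) ar_adjoint n y j ^+ 2 + 2 * y n * ar_second n
  + s * (1 - a ^+ (2 * n)) * y n ^+ 2.
Proof.
rewrite big_ord_recr/= (ar_adjoint_ge y (leqnn n.+1)) expr0n addr0.
under eq_bigr => j _.
  rewrite ar_adjointS (_ : _ ^+ 2 = ar_adjoint n y j ^+ 2 +
    (2 * y n * (ar_kernel j n * ar_adjoint n y j) +
     y n ^+ 2 * ar_kernel j n ^+ 2)); last by ring.
  over.
rewrite !big_split/= -!mulr_sumr -ar_kernel_sqr -ar_secondE; ring.
Qed.

(** A discrete Doob decomposition: a drift, increments whose coefficients depend on the past, and
    boundary terms. It is found by summing [ar_adjoint_sqrS], where [s * y k ^+ 2] is
    [X k ^+ 2 + 2 * a * y k * X k] minus the increment of [y ^+ 2], and [y k * ar_second k]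
    telescopes likewise. The factor [s ^+ 3] keeps the identity polynomial; [v] is free and becomes
    the innovation variance. *)
Lemma ar_energy (v : R) n :
  s ^+ 3 * \sum_(j < n) ar_adjoint n y j ^+ 2 =
  (1 + a ^+ 2) * n%:R * v
  + \sum_(k < n) ((2 * a * (1 + a ^+ 2) * y k + 2 * a * (ar_second k
        + s * (1 - a ^+ (2 * k)) * y k)) * X k + (1 + a ^+ 2) * (X k ^+ 2 - v))
  - (1 + a ^+ 2) * (y n ^+ 2 + s * \sum_(k < n) a ^+ (2 * k) * y k ^+ 2)
  - 2 * y n * ar_second n.
Proof.
elim: n => [|n IH]; first by rewrite !big_ord0/=; ring.
have arS : y n.+1 = a * y n + X n by [].
have secS : ar_second n.+1 = a * ar_second n + a * s * (1 - a ^+ (2 * n)) * y n by [].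
transitivity (s * (s ^+ 2 * \sum_(j < n.+1) ar_adjoint n.+1 y j ^+ 2)); first by ring.
rewrite ar_adjoint_sqrS.
transitivity (s ^+ 3 * (\sum_(j < n) ar_adjoint n y j ^+ 2)
  + s * (2 * y n * ar_second n) + s * (s * (1 - a ^+ (2 * n)) * y n ^+ 2)); first by ring.
rewrite IH arS secS !big_ord_recr -natr1 {IH arS secS} /=.
move: (\sum_(k < n) a ^+ (2 * _) * y _ ^+ 2) => S1.
move: (\sum_(k < n) (_ + _)) => S2.
move: (a ^+ (2 * n)) (y n) (ar_second n) (X n) => b yn r x.
ring.
Qed.

End ar_algebra.

(** * Bounds on expectations *)

Section expectation_bound.
Context d (Om : measurableType d) (R : realType) (P : probability Om R).

(** Measurability and nonnegativity travel with the bound, so that bounds add, scale and pass to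
    smaller functions without integrability side conditions. *)
Definition exp_le (f : Om -> R) (c : R) :=
  [/\ measurable_fun [set: Om] f, (forall w, 0 <= f w) &
      (\int[P]_w (f w)%:E <= c%:E)%E].

Lemma exp_le_trans f c c' : c <= c' -> exp_le f c -> exp_le f c'.
Proof. by move=> cc [mf f0 fc]; split=> //; rewrite (le_trans fc)// lee_fin. Qed.

Lemma exp_le_mono (f g : Om -> R) c : measurable_fun [set: Om] f -> (forall w, 0 <= f w <= g w) ->
  exp_le g c -> exp_le f c.
Proof.
move=> mf fg [mg g0 gc]; split => //; first by move=> w; case/andP: (fg w).
apply: le_trans gc; apply: ge0_le_integral => //.
- by move=> w _; rewrite lee_fin; case/andP: (fg w).
- exact/measurable_EFinP.
- exact/measurable_EFinP.
- by move=> w _; rewrite lee_fin; case/andP: (fg w).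
Qed.

Lemma exp_le_cst c : 0 <= c -> exp_le (fun=> c) c.
Proof.
move=> c0; split => //.
by rewrite (integral_cst P measurableT c%:E) [X in (_ * X)%E]probability_setT mule1.
Qed.

Lemma exp_leD f g c c' : exp_le f c -> exp_le g c' -> exp_le (fun w => f w + g w) (c + c').
Proof.
move=> [mf f0 fc] [mg g0 gc]; split.
- exact: measurable_funD.
- by move=> w; rewrite addr_ge0.
under eq_integral do rewrite EFinD.
rewrite ge0_integralD//; first by rewrite EFinD leeD.
- by move=> w _; rewrite lee_fin.
- exact/measurable_EFinP.
- by move=> w _; rewrite lee_fin.
- exact/measurable_EFinP.
Qed.

Lemma exp_leZ k f c : 0 <= k -> exp_le f c -> exp_le (fun w => k * f w) (k * c).
Proof.
move=> k0 [mf f0 fc]; split.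
- exact: measurable_funM.
- by move=> w; rewrite mulr_ge0.
under eq_integral do rewrite EFinM.
rewrite ge0_integralZl//; first by rewrite EFinM lee_wpmul2l.
- exact/measurable_EFinP.
- by move=> w _; rewrite lee_fin.
Qed.

Lemma exp_le_sum n (f : nat -> Om -> R) (c : nat -> R) :
  (forall k, (k < n)%N -> exp_le (f k) (c k)) ->
  exp_le (fun w => \sum_(k < n) f k w) (\sum_(k < n) c k).
Proof.
elim: n => [|n IH] H.
  under eq_fun do rewrite big_ord0; rewrite big_ord0; exact: exp_le_cst.
under eq_fun do rewrite big_ord_recr; rewrite big_ord_recr.
apply: exp_leD; last exact: H.
by apply: IH => k kn; apply: H; exact: ltnW.
Qed.

Lemma exp_le_prob (A : set Om) f c : measurable A -> (forall w, A w -> 1 <= f w) ->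
  exp_le f c -> (P A <= c%:E)%E.
Proof.
move=> mA Af [mf f0 fc]; rewrite probability_integral//; apply: le_trans fc.
apply: ge0_le_integral => //.
- exact/measurable_EFinP/measurable_indic.
- exact/measurable_EFinP.
- move=> w _; rewrite lee_fin indicE; case: (boolP (w \in A)) => //; first by rewrite inE => /Af.
Qed.

End expectation_bound.

(** * Second moments of autoregressive sequences *)

Section ar_moments.
Context d (Om : measurableType d) (R : realType) (P : probability Om R).

Lemma measurable_ar a d' (T : measurableType d') (X : nat -> T -> R) k :
  (forall i, (i < k)%N -> measurable_fun [set: T] (X i)) ->
  measurable_fun [set: T] (fun w => ar a (X ^~ w) k).
Proof.
elim: k => [|k IH] mX; first exact: measurable_cst.
apply: measurable_funD; last exact: mX.
by apply: measurable_funM => //; apply: IH => i ik; apply: mX; exact: ltnW.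
Qed.

Lemma measurable_ar_second a d' (T : measurableType d') (X : nat -> T -> R) k :
  (forall i, (i < k)%N -> measurable_fun [set: T] (X i)) ->
  measurable_fun [set: T] (fun w => ar_second a (X ^~ w) k).
Proof.
elim: k => [|k IH] mX; first exact: measurable_cst.
have mX' i : (i < k)%N -> measurable_fun [set: T] (X i) by move=> ik; apply: mX; exact: ltnW.
apply: measurable_funD; first by apply: measurable_funM => //; exact: IH.
by apply: measurable_funM => //; exact: measurable_ar.
Qed.

Lemma measurable_sum_ord d' (T : measurableType d') (f : nat -> T -> R) n :
  (forall k, (k < n)%N -> measurable_fun [set: T] (f k)) ->
  measurable_fun [set: T] (fun w => \sum_(k < n) f k w).
Proof. by move=> mf; apply: measurable_sum => k; exact: mf. Qed.

Variables (n : nat) (sig : R) (X : nat -> Om -> R).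
Hypothesis gX : gauss_seq P n sig X.

Let mX : forall i, measurable_fun [set: Om] (X i) := gX.1.

Lemma cyl_fun_measurable k d' (T : measurableType d') (f : Om -> T) :
  measurable_fun [set: g_sigma_algebraType (cyl k X)] f -> measurable_fun [set: Om] f.
Proof.
move=> mf _ B mB; rewrite setTI; have := mf measurableT B mB.
by rewrite setTI => sB; exact: (cyl_sigma_measurable mX sB).
Qed.

(** Orthogonality of martingale increments in one step: with [S], [B], [C] frozen, [gauss_quadratic]
    averages over [X k]. The number 128 bounds the variance of the square of a standard Gaussian. *)
Lemma exp_le_step k (S B C : Om -> R) c : (k < n)%N ->
  measurable_fun [set: g_sigma_algebraType (cyl k X)] S ->
  measurable_fun [set: g_sigma_algebraType (cyl k X)] B ->
  measurable_fun [set: g_sigma_algebraType (cyl k X)] C ->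
  exp_le P (fun w => S w ^+ 2 + sig ^+ 2 * B w ^+ 2 + 128 * sig ^+ 4 * C w ^+ 2) c ->
  exp_le P (fun w => (S w + (B w * X k w + C w * (X k w ^+ 2 - sig ^+ 2))) ^+ 2) c.
Proof.
move=> kn mS mB mC [_ _ Hc].
have mS' := cyl_fun_measurable mS; have mB' := cyl_fun_measurable mB.
have mC' := cyl_fun_measurable mC.
split.
- apply: measurable_funX; apply: measurable_funD => //; apply: measurable_funD.
    exact: measurable_funM.
  by apply: measurable_funM => //; apply: measurable_funB => //; exact: measurable_funX.
- by move=> w; exact: sqr_ge0.
pose g (p : g_sigma_algebraType (cyl k X) * R) : \bar R :=
  ((S p.1 + (B p.1 * p.2 + C p.1 * (p.2 ^+ 2 - sig ^+ 2))) ^+ 2)%:E.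
have mg : measurable_fun [set: g_sigma_algebraType (cyl k X) * R] g.
  have m1 (f : g_sigma_algebraType (cyl k X) -> R) :
    measurable_fun [set: g_sigma_algebraType (cyl k X)] f ->
    measurable_fun [set: g_sigma_algebraType (cyl k X) * R] (fun p => f p.1).
    by move=> mf; apply: (measurableT_comp mf); exact: measurable_fst.
  have m2 : measurable_fun [set: g_sigma_algebraType (cyl k X) * R]
    (fun p : g_sigma_algebraType (cyl k X) * R => p.2) by exact: measurable_snd.
  apply/measurable_EFinP; apply: measurable_funX; apply: measurable_funD; first exact: m1.
  apply: measurable_funD; apply: measurable_funM => //; try exact: m1.
  by apply: measurable_funB => //; exact: measurable_funX.
have g0 p : (0 <= g p)%E by rewrite lee_fin sqr_ge0.
rewrite (_ : (\int[P]_w _)%E = \int[P]_w g (w, X k w))%E//.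
rewrite (gauss_seq_integral gX kn mg g0); apply: le_trans Hc.
apply: ge0_le_integral => //.
- by move=> w _; apply: integral_ge0.
- apply: (@cyl_fun_measurable k _ _ (fun w => \int[@gauss R]_z g (w, (sig * z)%R))%E).
  apply: (measurable_fun_fubini_tonelli_F (fun p => g (p.1, sig * p.2))) => //.
  apply: (measurableT_comp mg); apply: measurable_fun_pair => //=.
  by apply: measurable_funM => //; exact: measurable_snd.
- apply/measurable_EFinP; apply: measurable_funD; last first.
    by apply: measurable_funM => //; exact: measurable_funX.
  apply: measurable_funD; first exact: measurable_funX.
  by apply: measurable_funM => //; exact: measurable_funX.
move=> w _; rewrite /g/=.
have := gauss_quadratic (S w) (B w * sig) (C w * sig ^+ 2).
rewrite (_ : _ + _ + _ = S w ^+ 2 + sig ^+ 2 * B w ^+ 2 + 128 * sig ^+ 4 * C w ^+ 2); last by ring.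
by congr (_ <= _)%E; apply: eq_integral => z _; congr (_%:E); ring.
Qed.

End ar_moments.

Section ar_second_moments.
Context d (Om : measurableType d) (R : realType) (P : probability Om R).
Variables (n : nat) (sig kap a : R) (X : nat -> Om -> R).
Hypothesis gX : gauss_seq P n sig X.
Hypotheses (a01 : 0 < a < 1) (kap0 : 0 < kap).
Local Notation s := (1 - a ^+ 2).
Hypothesis sigE : sig ^+ 2 = s * kap.
Local Notation x k := (fun w => ar a (X ^~ w) k).
Local Notation r k := (fun w => ar_second a (X ^~ w) k).

Let mX : forall i, measurable_fun [set: Om] (X i) := gX.1.
Let mXF k i : (i < k)%N ->
  measurable_fun [set: g_sigma_algebraType (cyl k X)] (X i).
Proof. exact: cyl_comp_measurable. Qed.
Let mxF k : measurable_fun [set: g_sigma_algebraType (cyl k X)] (x k).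
Proof. by apply: measurable_ar => i; exact: mXF. Qed.
Let mrF k : measurable_fun [set: g_sigma_algebraType (cyl k X)] (r k).
Proof. by apply: measurable_ar_second => i; exact: mXF. Qed.
Let mx k : measurable_fun [set: Om] (x k).
Proof. by apply: measurable_ar => i _; exact: mX. Qed.
Let mr k : measurable_fun [set: Om] (r k).
Proof. by apply: measurable_ar_second => i _; exact: mX. Qed.

Lemma exp_le_eq (f g : Om -> R) c c' : f =1 g -> c = c' -> exp_le P f c -> exp_le P g c'.
Proof. by move=> /funext -> ->. Qed.

Let s01 : 0 < s < 1. Proof. by move/andP: a01 => [? ?]; apply/andP; split; nra. Qed.
Let a2k k : 0 <= a ^+ (2 * k) <= 1.
Proof. by move/andP: a01 => [/ltW? /ltW?]; rewrite exprn_ge0//= exprn_ile1. Qed.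

(** [kap] is the stationary variance, the fixed point of [v = a ^+ 2 * v + sig ^+ 2], and the
    sequence starts from 0. *)
Lemma exp_le_ar k : (k <= n)%N -> exp_le P (fun w => x k w ^+ 2) kap.
Proof.
elim: k => [|k IH] kn.
  apply: (exp_le_trans (ltW kap0)).
  by apply: (exp_le_eq _ (erefl _) (exp_le_cst P (lexx 0))) => w /=; rewrite expr0n.
apply: (@exp_le_eq (fun w => (a * x k w + (cst 1 w * X k w + cst 0 w * (X k w ^+ 2 - sig ^+ 2))) ^+ 2) _ kap) => //.
  by move=> w /=; congr (_ ^+ 2); ring.
apply: (exp_le_step gX kn); try exact: measurable_cst.
  by apply: measurable_funM => //; exact: mxF.
apply: exp_le_eq (exp_leD (exp_leZ (sqr_ge0 a) (IH (ltnW kn))) (exp_le_cst P (sqr_ge0 sig))).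
  by move=> w /=; ring.
by rewrite sigE; ring.
Qed.

Lemma exp_le_noise_sum k : (k <= n)%N ->
  exp_le P (fun w => (\sum_(i < k) X i w) ^+ 2) (k%:R * sig ^+ 2).
Proof.
elim: k => [|k IH] kn.
  by apply: (exp_le_eq _ _ (exp_le_cst P (lexx 0))) => [w|]; rewrite ?big_ord0 ?expr0n ?mul0r.
apply: (@exp_le_eq (fun w => ((\sum_(i < k) X i w) + (cst 1 w * X k w + cst 0 w * (X k w ^+ 2 - sig ^+ 2))) ^+ 2) _ (k.+1%:R * sig ^+ 2)) => //.
  by move=> w /=; rewrite big_ord_recr; congr (_ ^+ 2); rewrite /=; ring.
apply: (exp_le_step gX kn); try exact: measurable_cst.
  by apply: measurable_sum_ord => i; exact: mXF.
apply: exp_le_eq (exp_leD (IH (ltnW kn)) (exp_le_cst P (sqr_ge0 sig))).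
  by move=> w /=; ring.
by rewrite -natr1; ring.
Qed.

(** By [ar_telescope] the sum is the noise sum minus the last term, divided by [1 - a]; no
    covariance has to be computed. *)
Lemma exp_le_ar_sum : exp_le P (fun w => (\sum_(k < n) x k w) ^+ 2)
  ((2 * n%:R * sig ^+ 2 + 2 * kap) / (1 - a) ^+ 2).
Proof.
have a1 : 0 < 1 - a by move/andP: a01 => [? ?]; lra.
have k0 : 0 <= 2 / (1 - a) ^+ 2 by rewrite divr_ge0// sqr_ge0.
have H := exp_leZ k0 (exp_leD (exp_le_noise_sum (leqnn n)) (exp_le_ar (leqnn n))).
apply: exp_le_mono (exp_le_eq (fun=> erefl) _ H); last by field; rewrite gt_eqF.
  apply: measurable_funX.
  by apply: (@measurable_sum_ord R _ Om (fun k => x k)) => k _; exact: mx.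
move=> w; rewrite sqr_ge0/=.
have E := ar_telescope a n (X ^~ w).
have -> : \sum_(k < n) ar a (X ^~ w) k = (\sum_(k < n) X k w - ar a (X ^~ w) n) / (1 - a).
  by rewrite -E mulrC mulKf// gt_eqF.
rewrite expr_div_n [leRHS]mulrAC ler_wpM2r ?invr_ge0 ?sqr_ge0//.
by have := sqr_ge0 (\sum_(k < n) X k w + ar a (X ^~ w) n); lra.
Qed.

(** Since [s = (1 - a) * (1 + a)], the recursion is a convex combination [a * r + (1 - a) * u] with
    [|u| <= 2 |y|]; convexity of the square preserves the bound. *)
Lemma exp_le_ar_second k : (k <= n)%N -> exp_le P (fun w => r k w ^+ 2) (4 * kap).
Proof.
elim: k => [|k IH] kn.
  apply: (@exp_le_trans _ _ _ _ _ 0); first by rewrite mulr_ge0// ltW.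
  by apply: (exp_le_eq _ (erefl _) (exp_le_cst P (lexx 0))) => w /=; rewrite expr0n.
have /andP[a0 a1] := a01.
have a4 : 0 <= 4 * (1 - a) by lra.
have H := exp_leD (exp_leZ (ltW a0) (IH (ltnW kn))) (exp_leZ a4 (exp_le_ar (ltnW kn))).
apply: exp_le_mono (exp_le_eq (fun=> erefl) _ H); last by ring.
  by apply: measurable_funX; exact: mr.
move=> w; rewrite sqr_ge0/=.
move: (ar_second a (X^~ w) k) (ar a (X ^~ w) k) (a ^+ (2 * k)) (a2k k) => rk y b /andP[b0 b1].
pose u := a * ((1 + a) * (1 - b) * y).
have -> : a * rk + a * s * (1 - b) * y = a * rk + (1 - a) * u by rewrite /u; ring.
have -> : (a * rk + (1 - a) * u) ^+ 2 =
  a * rk ^+ 2 + (1 - a) * u ^+ 2 - a * (1 - a) * (rk - u) ^+ 2 by ring.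
have H1 : 0 <= a * (1 - a) * (rk - u) ^+ 2.
  by rewrite mulr_ge0 ?sqr_ge0// mulr_ge0; lra.
suff H2 : u ^+ 2 <= 4 * y ^+ 2.
  have : (1 - a) * u ^+ 2 <= (1 - a) * (4 * y ^+ 2) by rewrite ler_wpM2l//; lra.
  by lra.
have -> : u ^+ 2 = (a * (1 + a) * (1 - b)) ^+ 2 * y ^+ 2 by rewrite /u; ring.
rewrite ler_wpM2r ?sqr_ge0//.
have c0 : 0 <= a * (1 + a) * (1 - b) by rewrite !mulr_ge0; lra.
have c2 : a * (1 + a) * (1 - b) <= 2.
  have h1 : a * (1 + a) <= 2 by nra.
  have h2 : 0 <= a * (1 + a) by nra.
  by nra.
by nra.
Qed.

Local Notation b k := (fun w => 2 * a * (1 + a ^+ 2) * x k w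
  + 2 * a * (r k w + s * (1 - a ^+ (2 * k)) * x k w)).
Local Notation M k := (fun w => \sum_(i < k) (b i w * X i w
  + (1 + a ^+ 2) * (X i w ^+ 2 - sig ^+ 2))).

Let mbF k : measurable_fun [set: g_sigma_algebraType (cyl k X)] (b k).
Proof.
apply: measurable_funD; first by apply: measurable_funM => //; exact: mxF.
apply: measurable_funM => //; apply: measurable_funD; first exact: mrF.
by apply: measurable_funM => //; exact: mxF.
Qed.

Let mM k d' (T : measurableType d') (Z : nat -> T -> R) :
  (forall i, (i < k)%N -> measurable_fun [set: T] (Z i)) ->
  measurable_fun [set: T] (fun w => \sum_(i < k) ((2 * a * (1 + a ^+ 2) * ar a (Z ^~ w) i
  + 2 * a * (ar_second a (Z ^~ w) i + s * (1 - a ^+ (2 * i)) * ar a (Z ^~ w) i)) * Z i w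
  + (1 + a ^+ 2) * (Z i w ^+ 2 - sig ^+ 2))).
Proof.
move=> mZ; apply: (@measurable_sum_ord R _ T (fun i w => (2 * a * (1 + a ^+ 2) * ar a (Z ^~ w) i
  + 2 * a * (ar_second a (Z ^~ w) i + s * (1 - a ^+ (2 * i)) * ar a (Z ^~ w) i)) * Z i w
  + (1 + a ^+ 2) * (Z i w ^+ 2 - sig ^+ 2))) => i ik.
have mZi j : (j < i)%N -> measurable_fun [set: T] (Z j).
  by move=> ji; apply: mZ; exact: ltn_trans ik.
have m1 : measurable_fun [set: T] (fun w => ar a (Z ^~ w) i) by exact: measurable_ar.
have m2 : measurable_fun [set: T] (fun w => ar_second a (Z ^~ w) i).
  exact: measurable_ar_second.
apply: measurable_funD.
  apply: measurable_funM; last exact: mZ.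
  apply: measurable_funD; first exact: measurable_funM.
  apply: measurable_funM => //; apply: measurable_funD => //.
  exact: measurable_funM.
apply: measurable_funM => //; apply: measurable_funB => //.
by apply: measurable_funX; exact: mZ.
Qed.

(** The coefficient [b k] has three terms, bounded by 4, 2 and 2 times [|x|], [|r|] and [|x|], so
    its square is at most [60 x^2 + 12 r^2], with mean at most [(60 + 48) kap]. The quadratic part
    contributes [128 * 2 ^ 2 = 512]. *)
Lemma exp_le_martingale k : (k <= n)%N ->
  exp_le P (fun w => M k w ^+ 2) (k%:R * (sig ^+ 2 * (108 * kap) + 512 * sig ^+ 4)).
Proof.
elim: k => [|k IH] kn.
  by apply: (exp_le_eq _ _ (exp_le_cst P (lexx 0))) => [w|]; rewrite ?big_ord0 ?expr0n ?mul0r.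
apply: (@exp_le_eq (fun w => (M k w + (b k w * X k w + cst (1 + a ^+ 2) w * (X k w ^+ 2 - sig ^+ 2))) ^+ 2) _
   (k.+1%:R * (sig ^+ 2 * (108 * kap) + 512 * sig ^+ 4))) => //.
  by move=> w /=; rewrite big_ord_recr.
apply: (exp_le_step gX kn); try exact: measurable_cst.
- by apply: mM => i; exact: mXF.
- exact: mbF.
have s2 : 0 <= sig ^+ 2 by exact: sqr_ge0.
have s4 : 0 <= 512 * sig ^+ 4.
  by apply: mulr_ge0; [exact: ler0n|exact: exprn_even_ge0].
have c60 : (0 : R) <= 60 by rewrite ler0n. have c12 : (0 : R) <= 12 by rewrite ler0n.
have Hb := exp_leZ s2 (exp_leD (exp_leZ c60 (exp_le_ar (ltnW kn))) (exp_leZ c12 (exp_le_ar_second (ltnW kn)))).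
have H := exp_leD (exp_leD (IH (ltnW kn)) Hb) (exp_le_cst P s4).
apply: exp_le_mono (exp_le_eq (fun=> erefl) _ H); last by rewrite -natr1; ring.
  apply: measurable_funD; last first.
    by apply: measurable_funM; [|apply: measurable_funX]; exact: measurable_cst.
  apply: measurable_funD.
    by apply: measurable_funX; apply: mM => i _; exact: mX.
  apply: measurable_funM => //; apply: measurable_funX.
  by apply: (cyl_fun_measurable gX); exact: mbF.
move=> w; have /andP[a0 a1] := a01.
apply/andP; split.
  apply: addr_ge0; last first.
    by apply: mulr_ge0; [apply: mulr_ge0; [exact: ler0n|exact: exprn_even_ge0]|exact: sqr_ge0].
  by apply: addr_ge0; [|apply: mulr_ge0]; exact: sqr_ge0.
rewrite /cst; apply: lerD; last first.
  have -> : 512 * sig ^+ 4 = 128 * sig ^+ 4 * 4 by ring.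
  have c128 : 0 <= 128 * sig ^+ 4.
    by apply: mulr_ge0; [exact: ler0n|exact: exprn_even_ge0].
  apply: (ler_wpM2l c128).
  have : 0 <= a ^+ 2 <= 1 by apply/andP; split; nra.
  move: (a ^+ 2) => a2 /andP[? ?] /=.
  have : 0 <= (1 - a2) * (3 + a2) by apply: mulr_ge0; lra.
  by lra.
rewrite lerD2l ler_wpM2l//.
move: (ar_second a (X^~ w) k) (ar a (X ^~ w) k) (a ^+ (2 * k)) (a2k k) => rk y c /andP[c0 c1].
have s01' := s01; move: s01' => /andP[s0 s1].
have H3 (u v t : R) : (u + v + t) ^+ 2 <= 3 * (u ^+ 2 + v ^+ 2 + t ^+ 2).
  by have := sqr_ge0 (u - v); have := sqr_ge0 (u - t); have := sqr_ge0 (v - t); lra.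
have Hm (t q m : R) : 0 <= t <= m -> (t * q) ^+ 2 <= m ^+ 2 * q ^+ 2.
  move=> /andP[t0 tm]; rewrite exprMn ler_wpM2r ?sqr_ge0//.
  by rewrite lerXn2r// nnegrE; lra.
have -> : 2 * a * (1 + a ^+ 2) * y + 2 * a * (rk + s * (1 - c) * y) =
  (2 * a * (1 + a ^+ 2)) * y + (2 * a) * rk + (2 * a * (s * (1 - c))) * y by ring.
apply: (le_trans (H3 _ _ _)).
have sc : 0 <= s * (1 - c) <= 1 by move: s s0 s1 => s' s0 s1; apply/andP; split; nra.
have a2 : 0 <= a ^+ 2 <= 1 by apply/andP; split; nra.
have h1 := Hm (2 * a * (1 + a ^+ 2)) y 4.
have h2 := Hm (2 * a) rk 2.
have h3 := Hm (2 * a * (s * (1 - c))) y 2.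
have {}h1 : (2 * a * (1 + a ^+ 2) * y) ^+ 2 <= 4 ^+ 2 * y ^+ 2.
  by apply: h1; move: (a ^+ 2) a2 => q /andP[? ?]; apply/andP; split; nra.
have {}h2 : (2 * a * rk) ^+ 2 <= 2 ^+ 2 * rk ^+ 2 by apply: h2; lra.
have {}h3 : (2 * a * (s * (1 - c)) * y) ^+ 2 <= 2 ^+ 2 * y ^+ 2.
  by apply: h3; move: (s * (1 - c)) sc => q /andP[? ?]; apply/andP; split; nra.
by lra.
Qed.

(** The weights [s * a ^+ (2 * k)] sum to at most 1, so this boundary term stays bounded as [n]
    grows. *)
Lemma exp_le_weighted :
  exp_le P (fun w => s * \sum_(k < n) a ^+ (2 * k) * x k w ^+ 2) kap.
Proof.
have /andP[s0 _] := s01.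
have H : exp_le P (fun w => \sum_(k < n) a ^+ (2 * k) * x k w ^+ 2)
   (\sum_(k < n) a ^+ (2 * k) * kap).
  apply: (@exp_le_sum _ _ _ P n (fun k w => a ^+ (2 * k) * x k w ^+ 2)
    (fun k => a ^+ (2 * k) * kap)) => k kn.
  by apply: exp_leZ; [case/andP: (a2k k)|exact: exp_le_ar (ltnW kn)].
apply: exp_le_trans (exp_leZ (ltW s0) H).
rewrite -mulr_suml mulrA -[leRHS]mul1r ler_wpM2r ?(ltW kap0)//.
have -> : s * \sum_(k < n) a ^+ (2 * k) = 1 - a ^+ (2 * n).
  elim: (n) => [|m IH]; first by rewrite big_ord0 mulr0 muln0 expr0 subrr.
  by rewrite big_ord_recr/= mulrDr IH mulnS exprD; ring.
by have := a2k n; lra.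
Qed.

End ar_second_moments.

(** * Deterministic estimates for the conditional variance *)

Section variance_real.
Context {R : realType}.
Variables (theta Delta a T q nr : R).
Hypotheses (theta0 : 0 < theta) (Delta0 : 0 < Delta) (a01 : 0 < a < 1).
Local Notation s := (1 - a ^+ 2).
Hypotheses (sl : theta * Delta <= s) (su : s <= 2 * theta * Delta)
  (sd : 2 * theta * Delta - s <= 2 * theta ^+ 2 * Delta ^+ 2).
Hypotheses (TE : T = nr * Delta) (q1 : 1 <= q) (qT : q ^+ 2 = T).
Local Notation kap := ((2 * theta)^-1).
(** The innovation variance [s / (2 * theta)] times the square of
    [2 * theta * sqrt theta * Delta / q], the normalisation of the numerator. Thus [c0] times the
    sum of squared coefficients is the conditional variance. *)
Local Notation c0 := (2 * theta ^+ 2 * s * Delta ^+ 2 / T).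

Let q0 : 0 < q. Proof. exact: lt_le_trans q1. Qed.
Let T0 : 0 < T. Proof. by rewrite -qT exprn_gt0. Qed.
Let nr0 : 0 < nr. Proof. by rewrite -(pmulr_lgt0 _ Delta0) -TE. Qed.
Let tD0 : 0 < theta * Delta. Proof. exact: mulr_gt0. Qed.
Let s0 : 0 < s. Proof. exact: lt_le_trans sl. Qed.
Let s1 : s < 1. Proof. by move/andP: a01 => [? ?]; rewrite gtrBl exprn_gt0. Qed.

(** With [t = theta * Delta] the numerator of the difference is [2 t - s - t s], of order [t ^+ 2],
    against a denominator [s >= t]. This discretisation bias is where [Delta] enters the rate. *)
Lemma normalized_mean_bound : `|theta * Delta * (1 + a ^+ 2) / s - 1| <= 4 * theta * Delta.
Proof.
move: (a ^+ 2) sl su sd s0 s1 => b; set t := theta * Delta => sl' su' sd' s0' s1'.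
have {}sd' : 2 * t - (1 - b) <= 2 * t ^+ 2 by rewrite /t exprMn; lra.
have {}su' : 1 - b <= 2 * t by rewrite /t; lra.
have t0 : 0 < t := tD0.
rewrite (_ : _ - 1 = (2 * t - (1 - b) - t * (1 - b)) / (1 - b)); last by field; lra.
rewrite normrM (gtr0_norm (_ : 0 < (1 - b)^-1)) ?invr_gt0// ler_pdivrMr//.
have h : t * t <= t * (1 - b) by rewrite ler_pM2l.
by rewrite ler_norml -mulrA -/t; apply/andP; split; nra.
Qed.

(** After division the fluctuations carry the factor [d0 <= 2 / T]. The martingale [M] has size
    [q = sqrt T], so [|M| <= (q + M ^+ 2 / q) / 2] passes to second moments without losing the
    order. *)
Lemma energy_pathwise (sig2 W S M y r : R) : sig2 = s / (2 * theta) -> 0 <= S ->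
  s ^+ 3 * W = (1 + a ^+ 2) * nr * sig2 + M - (1 + a ^+ 2) * (y ^+ 2 + S) - 2 * y * r ->
  `|c0 * W - 1| <= (4 * theta * Delta + q^-1) + ((T * q)^-1 * M ^+ 2
    + 2 / T * (3 * y ^+ 2 + 2 * S + r ^+ 2)).
Proof.
move=> sigE S0 E.
pose d0 := 2 * theta ^+ 2 * Delta ^+ 2 / (T * s ^+ 2).
pose B := M - (1 + a ^+ 2) * (y ^+ 2 + S) - 2 * y * r.
have sn : s != 0 by rewrite gt_eqF.
have -> : c0 * W - 1 = (theta * Delta * (1 + a ^+ 2) / s - 1) + d0 * B.
  have -> : c0 * W = d0 * (s ^+ 3 * W).
    by rewrite /d0; move: s sn => s' sn; field; rewrite ?sn ?gt_eqF.
  rewrite E sigE /B /d0 TE.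
  by move: (a ^+ 2) s0 => a2 s0'; field; rewrite !gt_eqF.
apply: le_trans (ler_normD _ _) _.
have -> : 4 * theta * Delta + q^-1 + ((T * q)^-1 * M ^+ 2
    + 2 / T * (3 * y ^+ 2 + 2 * S + r ^+ 2)) =
   4 * theta * Delta + (2 / T) * ((q + M ^+ 2 / q) / 2 + (3 * y ^+ 2 + 2 * S + r ^+ 2)).
  by rewrite -qT; field; rewrite gt_eqF.
apply: lerD; first exact: normalized_mean_bound.
have d00 : 0 <= d0 by rewrite !mulr_ge0 ?invr_ge0 ?mulr_ge0 ?sqr_ge0// ltW.
have dT : d0 <= 2 / T.
  rewrite /d0 -mulrA -mulrA ler_wpM2l// invfM mulrCA [leRHS](_ : _ = T^-1 * 1); last by rewrite mulr1.
  rewrite mulrA [leLHS]mulrCA ler_wpM2l ?invr_ge0 ?(ltW T0)//.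
  rewrite ler_pdivrMr ?exprn_gt0// mul1r -exprMn (mulrC Delta).
  by apply: lerXn2r => //; rewrite nnegrE ltW.
rewrite normrM (ger0_norm d00); apply: ler_pM => //.
have hM : `|M| <= (q + M ^+ 2 / q) / 2.
  have := sqr_ge0 (q - `|M|); rewrite sqrrB -(real_normK (num_real M)) => H.
  rewrite -subr_ge0; have -> : (q + `|M| ^+ 2 / q) / 2 - `|M| =
    (q ^+ 2 - q * `|M| *+ 2 + `|M| ^+ 2) / (2 * q) by field; rewrite gt_eqF.
  by rewrite divr_ge0// mulr_ge0// ltW.
rewrite /B -addrA -opprD; apply: le_trans (ler_normB _ _) _; apply: lerD => //.
have a2 : 0 <= a ^+ 2 <= 1 by apply/andP; split; move: s0 s1; lra.
have y2 := sqr_ge0 y.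
have h1 : (1 + a ^+ 2) * (y ^+ 2 + S) <= 2 * (y ^+ 2 + S).
  by rewrite ler_wpM2r ?addr_ge0//; lra.
have h2 : 0 <= (1 + a ^+ 2) * (y ^+ 2 + S) by rewrite mulr_ge0 ?addr_ge0//; lra.
have h3 := sqr_ge0 (y - r); have h4 := sqr_ge0 (y + r).
by rewrite ler_norml; apply/andP; split; lra.
Qed.

(** Subtracting the empirical mean shifts the coefficients by [c / nr * w j]. Young's inequality
    with weight [q] turns the cross term into [q^-1] times the main sum plus [q] times the squared
    shift; the former costs at most [q^-1 + |c0 W - 1|]. *)
Lemma centering_pathwise n (p0 w : nat -> R) (c : R) :
  (forall j, 0 <= w j <= (1 - a)^-1) -> nr = n%:R ->
  `|c0 * \sum_(j < n) (p0 j - c / nr * w j) ^+ 2 - 1| <=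
   q^-1 + 2 * `|c0 * \sum_(j < n) p0 j ^+ 2 - 1|
   + c0 * (1 + q) / (nr * (1 - a) ^+ 2) * c ^+ 2.
Proof.
move=> w01 nE; have h0 : 0 < 1 - a by move/andP: a01 => [? ?]; lra.
have c00 : 0 <= c0 by rewrite !mulr_ge0 ?invr_ge0 ?sqr_ge0// ltW.
set W := \sum_(j < n) p0 j ^+ 2.
have W0 : 0 <= W by apply: sumr_ge0 => j _; exact: sqr_ge0.
set W' := \sum_(j < n) _.
pose e := (c / nr) ^+ 2 / (1 - a) ^+ 2.
have D : `|W' - W| <= q^-1 * W + (1 + q) * (nr * e).
  have -> : q^-1 * W + (1 + q) * (nr * e) = \sum_(j < n) (q^-1 * p0 j ^+ 2 + (1 + q) * e).
    by rewrite big_split/= -mulr_sumr sumr_const card_ord nE -[((1 + q) * e) *+ n]mulr_natr -/W; ring.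
  rewrite /W' /W -sumrB; apply: le_trans (ler_norm_sum _ _ _) _; apply: ler_sum => j _.
  have wj := w01 j; set cn := c / _; set wj' := w j in wj *.
  have h1 : (cn * wj') ^+ 2 <= e.
    rewrite exprMn /e ler_wpM2l ?sqr_ge0// -exprVn lerXn2r// ?nnegrE ?invr_ge0 ?(ltW h0)//; lra.
  have e0 : 0 <= e by rewrite /e divr_ge0 ?sqr_ge0.
  set p := p0 j; set z := cn * wj' in h1 *.
  have hz : 2 * `|p * z| <= q^-1 * p ^+ 2 + q * z ^+ 2.
    rewrite normrM -(real_normK (num_real p)) -(real_normK (num_real z)).
    move: (`|p|) (`|z|) => p' z'; rewrite -subr_ge0.
    have -> : q^-1 * p' ^+ 2 + q * z' ^+ 2 - 2 * (p' * z') = q^-1 * (p' - q * z') ^+ 2.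
      by field; rewrite gt_eqF.
    by rewrite mulr_ge0 ?sqr_ge0 ?invr_ge0 ?(ltW q0).
  have hq : q * z ^+ 2 <= q * e by rewrite ler_pM2l.
  have -> : (p - z) ^+ 2 - p ^+ 2 = z ^+ 2 - 2 * (p * z) by ring.
  have := ler_norm (p * z); have := ler_norm (- (p * z)); rewrite normrN => n1 n2.
  have z0 := sqr_ge0 z.
  by rewrite ler_norml; apply/andP; split; lra.
have -> : c0 * (1 + q) / (nr * (1 - a) ^+ 2) * c ^+ 2 = c0 * ((1 + q) * (nr * e)).
  by move: (c0) => u; rewrite /e; field; rewrite ?gt_eqF//.
have H1 : `|c0 * W' - c0 * W| <= c0 * (q^-1 * W) + c0 * ((1 + q) * (nr * e)).
  by rewrite -mulrBr normrM (ger0_norm c00) -mulrDr ler_wpM2l.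
have H2 : c0 * (q^-1 * W) <= q^-1 + `|c0 * W - 1|.
  have : c0 * W <= 1 + `|c0 * W - 1| by have := ler_norm (c0 * W - 1); lra.
  have qi1 : q^-1 <= 1 by rewrite invf_le1.
  have qi0 : 0 < q^-1 by rewrite invr_gt0.
  have N0 := normr_ge0 (c0 * W - 1).
  have -> : c0 * (q^-1 * W) = q^-1 * (c0 * W) by ring.
  move: (c0 * W) (`|c0 * W - 1|) N0 (q^-1) qi0 qi1 => u v v0 t t0 t1 uv.
  have h : t * u <= t * (1 + v) by rewrite ler_pM2l.
  have h' : t * v <= 1 * v by rewrite ler_wpM2r.
  by lra.
have -> : c0 * W' - 1 = (c0 * W' - c0 * W) + (c0 * W - 1) by ring.
by apply: le_trans (ler_normD _ _) _; lra.
Qed.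

(** Orders of magnitude: [c0] is [O (Delta^3 / T)], the second moment of the sum is
    [O (T / Delta^2)] and [1 - a >= theta * Delta / 2]. The powers of [Delta] combine with [nr] into
    [q / T = q^-1]. *)
Lemma centering_constant :
  c0 * (1 + q) / (nr * (1 - a) ^+ 2) *
    ((2 * nr * (s / (2 * theta)) + 2 * kap) / (1 - a) ^+ 2)
  <= 256 * (1 + kap) / theta / q.
Proof.
have h0 : 0 < 1 - a by move/andP: a01 => [? ?]; lra.
have hs : theta * Delta / 2 <= 1 - a.
  by have := sqr_ge0 (1 - a); move: sl; lra.
have k0 : 0 < kap by rewrite invr_gt0 mulr_gt0.
have T1 : 1 <= T by rewrite -qT exprn_ege1.
have e1 : c0 <= 4 * theta ^+ 3 * Delta ^+ 3 / T.
  rewrite ler_pM2r ?invr_gt0//.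
  have -> : 4 * theta ^+ 3 * Delta ^+ 3 = 2 * theta ^+ 2 * (2 * theta * Delta) * Delta ^+ 2 by ring.
  by rewrite ler_pM2r ?exprn_gt0// ler_pM2l ?mulr_gt0 ?exprn_gt0.
have c00 : 0 <= c0 by rewrite !mulr_ge0 ?invr_ge0 ?sqr_ge0// ltW.
have e2 : 2 * nr * (s / (2 * theta)) + 2 * kap <= 2 * T * (1 + kap).
  have : nr * (s / (2 * theta)) <= T.
    rewrite mulrA ler_pdivrMr ?mulr_gt0// [in leRHS]TE -[leRHS]mulrA ler_pM2l//.
    by rewrite mulrC.
  have : kap <= T * kap by rewrite ler_peMl// ltW.
  by lra.
have e20 : 0 <= 2 * nr * (s / (2 * theta)) + 2 * kap.
  by rewrite addr_ge0// ?mulr_ge0// ?divr_ge0// ?mulr_ge0// ltW.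
have e3 : ((1 - a) ^+ 4)^-1 <= 16 / (theta * Delta) ^+ 4.
  have -> : 16 / (theta * Delta) ^+ 4 = ((theta * Delta / 2) ^+ 4)^-1.
    by field; rewrite !gt_eqF.
  rewrite lef_pV2 ?posrE ?exprn_gt0 ?divr_gt0//.
  by rewrite lerXn2r// nnegrE ltW// divr_gt0.
have -> : c0 * (1 + q) / (nr * (1 - a) ^+ 2) *
    ((2 * nr * (s / (2 * theta)) + 2 * kap) / (1 - a) ^+ 2) =
  (c0 * (1 + q)) * ((2 * nr * (s / (2 * theta)) + 2 * kap) * ((1 - a) ^+ 4)^-1) / nr.
  move: c0 (2 * nr * _ + _) => u v; field; rewrite !gt_eqF//.
have -> : 256 * (1 + kap) / theta / q =
  ((4 * theta ^+ 3 * Delta ^+ 3 / T) * (2 * q)) *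
  ((2 * T * (1 + kap)) * (16 / (theta * Delta) ^+ 4)) / nr.
  move: kap => k; rewrite -[in RHS](divfK (lt0r_neq0 Delta0) nr) -?TE.
  have -> : nr = T / Delta by rewrite TE mulfK// gt_eqF.
  by rewrite -qT; field; rewrite !gt_eqF.
have q10 : 0 <= 1 + q by rewrite addr_ge0// ltW.
have q12 : 1 + q <= 2 * q by rewrite mulr_natl mulr2n lerD2r.
have ia0 : 0 <= ((1 - a) ^+ 4)^-1 by rewrite invr_ge0 exprn_ge0// ltW.
rewrite ler_pM2r ?invr_gt0//.
apply: ler_pM; [exact: mulr_ge0|exact: mulr_ge0|exact: ler_pM|exact: ler_pM].
Qed.

End variance_real.

(** * The conditional variance in mean, and exponential moments *)

Section ar_concentration.
Context d (Om : measurableType d) (R : realType) (P : probability Om R).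
Variables (n : nat) (theta Delta a T q sig : R) (X : nat -> Om -> R).
Hypothesis gX : gauss_seq P n sig X.
Hypotheses (theta0 : 0 < theta) (Delta0 : 0 < Delta) (a01 : 0 < a < 1).
Local Notation s := (1 - a ^+ 2).
Hypotheses (sl : theta * Delta <= s) (su : s <= 2 * theta * Delta)
  (sd : 2 * theta * Delta - s <= 2 * theta ^+ 2 * Delta ^+ 2).
Hypotheses (TE : T = n%:R * Delta) (q1 : 1 <= q) (qT : q ^+ 2 = T).
Hypothesis sigE : sig ^+ 2 = s / (2 * theta).
Local Notation kap := ((2 * theta)^-1).
Local Notation c0 := (2 * theta ^+ 2 * s * Delta ^+ 2 / T).
Local Notation x k := (fun w => ar a (X ^~ w) k).
Local Notation r k := (fun w => ar_second a (X ^~ w) k).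

Let mX : forall i, measurable_fun [set: Om] (X i) := gX.1.
Let mx k : measurable_fun [set: Om] (x k).
Proof. by apply: measurable_ar => i _; exact: mX. Qed.
Let q0 : 0 < q. Proof. exact: lt_le_trans q1. Qed.
Let T0 : 0 < T. Proof. by rewrite -qT exprn_gt0. Qed.
Let nr0 : 0 < n%:R :> R. Proof. by rewrite -(pmulr_lgt0 _ Delta0) -TE. Qed.
Let tD0 : 0 < theta * Delta. Proof. exact: mulr_gt0. Qed.
Let s0 : 0 < s. Proof. exact: lt_le_trans sl. Qed.
Let s1 : s < 1. Proof. by move/andP: a01 => [? ?]; rewrite gtrBl exprn_gt0. Qed.
Let kap0 : 0 < kap. Proof. by rewrite invr_gt0 mulr_gt0. Qed.
Let sigK : sig ^+ 2 = s * kap. Proof. exact: sigE. Qed.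
Let T1 : 1 <= T. Proof. by rewrite -qT exprn_ege1. Qed.
Let nsT : n%:R * sig ^+ 2 <= T.
Proof.
rewrite sigE mulrA ler_pdivrMr ?mulr_gt0// [in leRHS]TE -[leRHS]mulrA ler_pM2l//.
by rewrite mulrC.
Qed.

Let qiT : T^-1 <= q^-1.
Proof. by rewrite -qT lef_pV2 ?posrE ?exprn_gt0// expr2 ler_peMr// ltW. Qed.

Lemma measurable_ar_adjoint d' (S : measurableType d') m (u : nat -> S -> R) j :
  (forall i, (i < m)%N -> measurable_fun [set: S] (u i)) ->
  measurable_fun [set: S] (fun w => ar_adjoint a m (u ^~ w) j).
Proof.
move=> mu; apply: (@measurable_sum_ord R _ S (fun k w => ar_kernel a j k * u k w)) => k km.
by apply: measurable_funM => //; exact: mu.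
Qed.

Lemma exp_le_energy :
  exp_le P (fun w => `|c0 * \sum_(j < n) ar_adjoint a n (ar a (X ^~ w)) j ^+ 2 - 1|)
    (4 * theta * Delta + (1 + 638 * kap) / q).
Proof.
have a4 : 0 <= 4 * theta * Delta + q^-1.
  by rewrite addr_ge0 ?invr_ge0 ?mulr_ge0// ltW.
have tq : 0 <= (T * q)^-1 by rewrite invr_ge0 mulr_ge0// ltW.
have t2 : 0 <= 2 / T by rewrite divr_ge0// ltW.
have c3 : (0 : R) <= 3 by []. have c2 : (0 : R) <= 2 by [].
have HM := exp_leZ tq (exp_le_martingale gX a01 kap0 sigK (leqnn n)).
have Hy := exp_le_ar gX kap0 sigK (leqnn n).
have Hr := exp_le_ar_second gX a01 kap0 sigK (leqnn n).
have HS := exp_le_weighted gX a01 kap0 sigK.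
have H := exp_leD (exp_le_cst P a4) (exp_leD HM
  (exp_leZ t2 (exp_leD (exp_leD (exp_leZ c3 Hy) (exp_leZ c2 HS)) Hr))).
apply: exp_le_trans (exp_le_mono _ _ H).
(* The martingale gives [108 + 512 = 620], since [sig ^+ 2 <= kap] and [n * sig ^+ 2 <= T]; the
   boundary terms give [2 * (3 + 2 + 4) = 18]. *)
- have h1 : (T * q)^-1 * (n%:R * (sig ^+ 2 * (108 * kap) + 512 * sig ^+ 4)) <= 620 * kap / q.
    have -> : (T * q)^-1 * (n%:R * (sig ^+ 2 * (108 * kap) + 512 * sig ^+ 4)) =
      (n%:R * sig ^+ 2 * T^-1) * (108 * kap + 512 * sig ^+ 2) / q.
      by field; rewrite !gt_eqF.
    rewrite ler_pM2r ?invr_gt0//.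
    have u1 : n%:R * sig ^+ 2 * T^-1 <= 1 by rewrite ler_pdivrMr// mul1r.
    have u0 : 0 <= n%:R * sig ^+ 2 * T^-1.
      by apply: mulr_ge0; [apply: mulr_ge0; [exact: ler0n|exact: sqr_ge0]|rewrite invr_ge0 ltW].
    have v1 : 108 * kap + 512 * sig ^+ 2 <= 620 * kap.
      have : sig ^+ 2 <= kap by rewrite sigK ler_piMl// ltW.
      by move: kap => ?; lra.
    have v0 : 0 <= 108 * kap + 512 * sig ^+ 2.
      by apply: addr_ge0; apply: mulr_ge0; rewrite ?ler0n ?sqr_ge0// ltW.
    by have := ler_pM u0 v0 u1 v1; rewrite mul1r.
  have h2 : 2 / T * (3 * kap + 2 * kap + 4 * kap) <= 18 * kap / q.
    have -> : 2 / T * (3 * kap + 2 * kap + 4 * kap) = 18 * kap * T^-1.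
      by move: kap => k; field; rewrite gt_eqF.
    by rewrite ler_wpM2l// mulr_ge0 ?ler0n// ltW.
  by rewrite mulrDl mul1r; move: h1 h2; move: kap (q^-1) => k qi; lra.
- apply: measurableT_comp => //; apply: measurable_funB => //; apply: measurable_funM => //.
  apply: (@measurable_sum_ord R _ Om (fun j w => ar_adjoint a n (ar a (X ^~ w)) j ^+ 2)) => j _.
  by apply: measurable_funX; apply: (@measurable_ar_adjoint _ Om n (fun k => x k)) => k _; exact: mx.
- move=> w; rewrite normr_ge0/=.
  apply: (energy_pathwise theta0 Delta0 a01 sl su sd TE q1 qT sigE _ (ar_energy a (X ^~ w) (sig ^+ 2) n)).
  apply: mulr_ge0; first exact: ltW.
  apply: sumr_ge0 => k _; rewrite mulr_ge0 ?sqr_ge0// exprn_ge0//.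
  by case/andP: a01 => /ltW.
Qed.

(** Twice the constants of [exp_le_energy], one more [q^-1] from the centering, and the constant of
    [centering_constant]. *)
Definition variance_constant : R :=
  8 * theta + 3 + 1276 * kap + 256 * (1 + kap) / theta.

Lemma exp_le_variance :
  exp_le P (fun w => `|c0 * \sum_(j < n)
      ar_adjoint a n (fun k => x k w - (\sum_(i < n) x i w) / n%:R) j ^+ 2 - 1|)
    (variance_constant * (Delta + q^-1)).
Proof.
have h0 : 0 < 1 - a by case/andP: a01 => ? ?; rewrite subr_gt0.
have c00 : 0 <= c0 by rewrite !mulr_ge0 ?invr_ge0 ?sqr_ge0// ltW.
have qi0 : 0 <= q^-1 by rewrite invr_ge0 ltW.
have K0 : 0 <= c0 * (1 + q) / (n%:R * (1 - a) ^+ 2).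
  apply: divr_ge0; first by rewrite mulr_ge0// addr_ge0// ltW.
  by rewrite mulr_ge0 ?sqr_ge0// ltW.
have c2 : (0 : R) <= 2 by [].
have H := exp_leD (exp_leD (exp_le_cst P qi0) (exp_leZ c2 exp_le_energy))
  (exp_leZ K0 (exp_le_ar_sum gX a01 kap0 sigK)).
apply: exp_le_trans (exp_le_mono _ _ H).
- have := centering_constant theta0 Delta0 a01 sl su TE q1 qT.
  rewrite sigE => hc.
  apply: (@le_trans _ _ (q^-1 + 2 * (4 * theta * Delta + (1 + 638 * kap) / q) + 256 * (1 + kap) / theta / q)).
    by rewrite lerD2l.
  have k256 : 0 <= 256 * (1 + kap) / theta.
    apply: divr_ge0; last exact: ltW.
    by apply: mulr_ge0; [exact: ler0n|apply: addr_ge0; [exact: ler01|exact: ltW]].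
  rewrite /variance_constant.
  have : 0 <= (3 + 1276 * kap + 256 * (1 + kap) / theta) * Delta.
    apply: mulr_ge0; last exact: ltW.
    apply: addr_ge0; last exact: k256.
    by apply: addr_ge0; [exact: ler0n|apply: mulr_ge0; [exact: ler0n|exact: ltW]].
  have : 0 <= 8 * theta * q^-1 by rewrite !mulr_ge0// ltW.
  by move: (256 * (1 + kap) / theta) kap (q^-1) => K k qi; lra.
- apply: measurableT_comp => //; apply: measurable_funB => //; apply: measurable_funM => //.
  pose u k w := x k w - (\sum_(i < n) x i w) / n%:R.
  apply: (@measurable_sum_ord R _ Om (fun j w => ar_adjoint a n (u ^~ w) j ^+ 2)) => j _.
  apply: measurable_funX; apply: (@measurable_ar_adjoint _ Om n u) => k _.
  apply: measurable_funB; first exact: mx.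
  apply: measurable_funM => //.
  by apply: (@measurable_sum_ord R _ Om (fun k => x k)) => i _; exact: mx.
- move=> w; rewrite normr_ge0/=.
  have := @centering_pathwise R theta Delta a T q n%:R theta0 Delta0 a01 sl TE q1 qT n
    (ar_adjoint a n (ar a (X ^~ w))) (ar_adjoint a n (fun=> 1)) (\sum_(i < n) x i w).
  under [in X in _ -> _ -> X]eq_bigr do rewrite -ar_adjointB.
  apply => // j; apply: ar_adjoint1_bound.
  by case/andP: a01 => /ltW ->.
Qed.

Section riccati.
Variable b : R.
Local Notation p := (1 - 2 * b * sig ^+ 2).
Local Notation l := (b * s * (1 - 2 * b * kap) / p).
Local Notation eta := (2 * b ^+ 2 * kap ^+ 2 * s / p).
Hypothesis p0 : 0 < p.

Let mexponent k d' (S : measurableType d') (Z : nat -> S -> R) :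
  (forall i, (i < k)%N -> measurable_fun [set: S] (Z i)) ->
  measurable_fun [set: S] (fun w => l * \sum_(i < k) (ar a (Z ^~ w) i ^+ 2 - kap)).
Proof.
move=> mZ; apply: measurable_funM => //.
apply: (@measurable_sum_ord R _ S (fun i w => ar a (Z ^~ w) i ^+ 2 - kap)) => i ik.
apply: measurable_funB => //; apply: measurable_funX; apply: measurable_ar => j ji.
by apply: mZ; exact: ltn_trans ik.
Qed.

(** From [p^-1 <= expR (p^-1 - 1)]. The centering by [kap] cancels the first order in [b], so the
    cost [eta] of one step is of order [b ^+ 2 * s]; over [n] steps it stays bounded when [b] has
    size [T^(-1/2)]. *)
Lemma riccati_factor : expR (- (l * kap)) * (Num.sqrt p)^-1 <= expR eta.
Proof.
have -> : eta = - (l * kap) + (p^-1 - 1) / 2.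
  by rewrite sigK; move: p0; rewrite sigK; move: kap s => k t h; field; rewrite gt_eqF.
rewrite expRD ler_pM2l ?expR_gt0//.
have -> : expR ((p^-1 - 1) / 2) = Num.sqrt (expR (p^-1 - 1)).
  have -> : p^-1 - 1 = (p^-1 - 1) / 2 + (p^-1 - 1) / 2 by field; rewrite gt_eqF.
  rewrite expRD -expr2 sqrtr_sqr ger0_norm ?expR_ge0//.
  by congr expR; field; rewrite gt_eqF.
rewrite -sqrtrV ?(ltW p0)// ler_sqrt ?expR_ge0//.
by have := expR_ge1Dx (p^-1 - 1); rewrite addrC subrK.
Qed.

(* The coefficient [l] is chosen so that integrating out one innovation maps
   [l (x_k^2 - kap) + b x_(k+1)^2] to [b x_k^2] plus a constant. *)
Lemma exp_le_riccati k : (k <= n)%N ->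
  exp_le P (fun w => expR (l * \sum_(i < k) (x i w ^+ 2 - kap) + b * x k w ^+ 2))
    (expR (k%:R * eta)).
Proof.
elim: k => [|k IH] kn.
  rewrite mul0r expR0; apply: (exp_le_eq _ (erefl _) (exp_le_cst P ler01)) => w /=.
  by rewrite big_ord0 expr0n !mulr0 addr0 expR0.
have H := exp_leZ (expR_ge0 eta) (IH (ltnW kn)).
have [mH _ Hle] := H.
split.
- apply: measurableT_comp => //; apply: measurable_funD.
    by apply: mexponent => i _; exact: mX.
  by apply: measurable_funM => //; apply: measurable_funX; exact: mx.
- by move=> w; exact: expR_ge0.
pose F := g_sigma_algebraType (cyl k X).
have mXF i : (i < k)%N -> measurable_fun [set: F] (X i) by exact: cyl_comp_measurable.
have mxF i : (i <= k)%N -> measurable_fun [set: F] (x i).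
  by move=> ik; apply: measurable_ar => j ji; apply: mXF; exact: leq_trans ik.
have mkF : measurable_fun [set: F] (fun w => l * \sum_(i < k.+1) (x i w ^+ 2 - kap)).
  apply: measurable_funM => //.
  apply: (@measurable_sum_ord R _ F (fun i w => x i w ^+ 2 - kap)) => i ik.
  by apply: measurable_funB => //; apply: measurable_funX; exact: mxF.
pose g (y : F * R) : \bar R :=
  (expR (l * \sum_(i < k.+1) (x i y.1 ^+ 2 - kap) + b * (a * x k y.1 + y.2) ^+ 2))%:E.
have mg : measurable_fun [set: F * R] g.
  apply/measurable_EFinP; apply: measurableT_comp => //; apply: measurable_funD.
    by apply: (measurableT_comp mkF); exact: measurable_fst.
  apply: measurable_funM => //; apply: measurable_funX; apply: measurable_funD.
    apply: measurable_funM => //.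
    by apply: (measurableT_comp (mxF k (leqnn k))); exact: measurable_fst.
  exact: measurable_snd.
have g0 y : (0 <= g y)%E by rewrite lee_fin expR_ge0.
rewrite (_ : (\int[P]_w _)%E = \int[P]_w g (w, X k w))%E//.
rewrite (gauss_seq_integral gX kn mg g0).
rewrite -natr1 mulrDl mul1r expRD mulrC; apply: le_trans Hle.
apply: ge0_le_integral => //.
- by move=> w _; apply: integral_ge0.
- apply: (@cyl_fun_measurable _ _ R P n sig X gX k _ _ (fun w => \int[@gauss R]_z g (w, (sig * z)%R))%E).
  apply: (measurable_fun_fubini_tonelli_F (fun y => g (y.1, sig * y.2))) => //.
  apply: (measurableT_comp mg); apply: measurable_fun_pair => //=.
  by apply: measurable_funM => //; exact: measurable_snd.
- exact/measurable_EFinP.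
move=> w _; rewrite /g/=.
under eq_integral do rewrite expRD EFinM.
rewrite ge0_integralZl//; last first.
  apply/measurable_EFinP; apply: measurableT_comp => //; apply: measurable_funM => //.
  by apply: measurable_funX; exact: measurable_affine.
rewrite integral_gauss_sqr// -EFinM lee_fin big_ord_recr/=.
set S := \sum_(i < k) _; set y := ar a _ k.
have E : b * y ^+ 2 = l * y ^+ 2 + b * (a * y) ^+ 2 / p.
  by move: (p0); rewrite sigK; move: kap => k0 h; field; rewrite gt_eqF.
rewrite E.
have -> : expR (l * (S + (y ^+ 2 - kap))) * ((Num.sqrt p)^-1 * expR (b * (a * y) ^+ 2 / p)) =
  (expR (- (l * kap)) * (Num.sqrt p)^-1) * expR (l * S + (l * y ^+ 2 + b * (a * y) ^+ 2 / p)).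
  have -> : l * (S + (y ^+ 2 - kap)) = - (l * kap) + (l * S + l * y ^+ 2) by ring.
  by rewrite [in RHS]addrA !expRD; ring.
by rewrite ler_wpM2r ?expR_ge0// riccati_factor.
Qed.

End riccati.

End ar_concentration.

(** * Tails of the energy *)

Section ar_tail.
Context d (Om : measurableType d) (R : realType) (P : probability Om R).
Variables (n : nat) (theta Delta a T q sig : R) (X : nat -> Om -> R).
Hypothesis gX : gauss_seq P n sig X.
Hypotheses (theta0 : 0 < theta) (Delta0 : 0 < Delta) (a01 : 0 < a < 1).
Local Notation s := (1 - a ^+ 2).
Hypotheses (sl : theta * Delta <= s) (su : s <= 2 * theta * Delta).
Hypotheses (TE : T = n%:R * Delta) (q1 : 1 <= q) (qT : q ^+ 2 = T).
Hypothesis sigE : sig ^+ 2 = s / (2 * theta).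
Hypothesis qtheta : 4 / theta <= q.
Local Notation kap := ((2 * theta)^-1).
Local Notation x k := (fun w => ar a (X ^~ w) k).

Let mX : forall i, measurable_fun [set: Om] (X i) := gX.1.
Let mx k : measurable_fun [set: Om] (x k).
Proof. by apply: measurable_ar => i _; exact: mX. Qed.
Let q0 : 0 < q. Proof. exact: lt_le_trans q1. Qed.
Let T0 : 0 < T. Proof. by rewrite -qT exprn_gt0. Qed.
Let nr0 : 0 < n%:R :> R. Proof. by rewrite -(pmulr_lgt0 _ Delta0) -TE. Qed.
Let tD0 : 0 < theta * Delta. Proof. exact: mulr_gt0. Qed.
Let s0 : 0 < s. Proof. exact: lt_le_trans sl. Qed.
Let s1 : s < 1. Proof. by move/andP: a01 => [? ?]; rewrite gtrBl exprn_gt0. Qed.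
Let kap0 : 0 < kap. Proof. by rewrite invr_gt0 mulr_gt0. Qed.
Let sigK : sig ^+ 2 = s * kap. Proof. exact: sigE. Qed.
Let T1 : 1 <= T. Proof. by rewrite -qT exprn_ege1. Qed.

Local Notation p b := (1 - 2 * b * sig ^+ 2).
Local Notation l b := (b * s * (1 - 2 * b * kap) / p b).
Local Notation eta b := (2 * b ^+ 2 * kap ^+ 2 * s / p b).

(** Here [2 * b * kap] is [e * v] with [v = (theta * q)^-1 <= 1/4], which keeps [p b] between 3/4
    and 5/4. The accumulated cost is bounded because [n * Delta * b ^+ 2 = 1]. *)
Lemma riccati_parameters (e : R) : `|e| = 1 -> let b := e / q in
  [/\ 0 < p b, n%:R * eta b <= 2 / theta & theta * Delta / (2 * q) <= e * l b].
Proof.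
move=> e1 b; pose v := (theta * q)^-1.
have v0 : 0 < v by rewrite invr_gt0 mulr_gt0.
have v4 : v <= 4^-1.
  by rewrite lef_pV2 ?posrE ?mulr_gt0//; move: qtheta; rewrite ler_pdivrMr// mulrC.
have bE : 2 * b * kap = e * v by rewrite /b /v; field; rewrite !gt_eqF.
have pE : p b = 1 - e * v * s by rewrite sigK -bE; ring.
have e2 : e ^+ 2 = 1 by rewrite -(real_normK (num_real e)) e1 expr1n.
have ev : - 4^-1 <= e * v <= 4^-1.
  by rewrite -ler_norml normrM e1 mul1r gtr0_norm.
have evs : - 4^-1 <= e * v * s <= 4^-1.
  rewrite -ler_norml !normrM e1 mul1r !gtr0_norm//.
  by rewrite -[leRHS]mulr1 ler_pM// ltW.
have p34 : 3 / 4 <= p b by rewrite pE; lra.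
have p54 : p b <= 5 / 4 by rewrite pE; lra.
have p0 : 0 < p b by lra.
split => //.
- rewrite mulrA ler_pdivrMr//.
  have -> : n%:R * (2 * b ^+ 2 * kap ^+ 2 * s) = (s * n%:R) / (2 * theta ^+ 2 * T).
    by rewrite /b -qT expr_div_n e2; field; rewrite !gt_eqF.
  have h1 : s * n%:R / (2 * theta ^+ 2 * T) <= theta^-1.
    rewrite ler_pdivrMr ?mulr_gt0 ?exprn_gt0//.
    have -> : theta^-1 * (2 * theta ^+ 2 * T) = (2 * theta * Delta) * n%:R.
      by rewrite TE; field; rewrite gt_eqF.
    by rewrite ler_pM2r.
  apply: (le_trans h1); have ti : 0 < theta^-1 by rewrite invr_gt0.
  have : theta^-1 * (3 / 4) <= theta^-1 * p b by rewrite ler_pM2l.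
  by move: (theta^-1) (p b) ti => ti pb ti0; lra.
- have -> : e * l b = q^-1 * s * (1 - e * v) / p b.
    rewrite bE {1}/b; transitivity (e ^+ 2 * (q^-1 * s * (1 - e * v) / p b)).
      by move: (p b) p0 => pb pb0; field; rewrite !gt_eqF.
    by rewrite e2 mul1r.
  rewrite ler_pdivlMr//.
  have qi : 0 < q^-1 by rewrite invr_gt0.
  have -> : theta * Delta / (2 * q) * p b = q^-1 * (theta * Delta / 2 * p b).
    by field; rewrite gt_eqF.
  rewrite -[leRHS]mulrA ler_pM2l//.
  have h1 : theta * Delta / 2 * p b <= theta * Delta / 2 * (5 / 4).
    by rewrite ler_pM2l// divr_gt0.
  have h2 : s * (3 / 4) <= s * (1 - e * v) by rewrite ler_pM2l//; lra.
  by move: sl tD0 h1 h2; move: (theta * Delta) => t; lra.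
Qed.

Definition tail_constant : R := kap + 2 * expR (1 + 2 / theta).

Lemma expR_half_ln : expR (ln T / 2) = q.
Proof.
apply/eqP; rewrite -(@eqrXn2 _ 2)// ?expR_ge0 ?(ltW q0)//; apply/eqP.
rewrite qT -expRM_natl -[RHS](lnK T0); congr expR.
by field.
Qed.

(** Chernoff with [b = 1 / q] and [b = - 1 / q]: the rate [l] is at least [theta * Delta / (2 * q)]
    in modulus, and at the threshold the exponent becomes [ln T / 2], that is, a factor [q^-1]. The
    indicator is dominated by two exponentials and a Markov term for the last value. *)
Lemma ar_energy_tail :
  (P [set w | q * ln T / theta <= `|Delta * \sum_(i < n) (x i w ^+ 2 - kap)| ]%R
    <= (tail_constant / q)%:E)%E.
Proof.
have n1 : `|1 : R| = 1 by rewrite normr1.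
have nN1 : `| - 1 : R| = 1 by rewrite normrN normr1.
have [pp ep lp] := riccati_parameters n1.
have [pn en ln_] := riccati_parameters nN1.
set bp := 1 / q in pp ep lp; set bn := - 1 / q in pn en ln_.
have Hp := exp_le_riccati gX sigE pp (leqnn n).
have Hn := exp_le_riccati gX sigE pn (leqnn n).
set D := fun w => \sum_(i < n) (x i w ^+ 2 - kap).
set r := q * ln T / theta.
have lT0 : 0 <= ln T by exact: ln_ge0.
have r0 : 0 <= r.
  by apply: divr_ge0; [apply: mulr_ge0 => //|]; exact: ltW.
set lbp := l bp in lp Hp; set lbn := l bn in ln_ Hn.
rewrite mul1r in lp; rewrite mulN1r in ln_.
have tq0 : 0 < theta * Delta / (2 * q) by rewrite divr_gt0 ?mulr_gt0.
have rD : (theta * Delta / (2 * q)) * (r / Delta) = ln T / 2.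
  by rewrite /r; field; rewrite !gt_eqF.
have rD0 : 0 <= r / Delta by rewrite divr_ge0// ltW.
have e1 : expR (- (lbp * (r / Delta))) <= q^-1.
  rewrite -expR_half_ln -expRN ler_expR lerN2 -rD ler_wpM2r//.
have e2 : expR (1 + lbn * (r / Delta)) <= expR 1 / q.
  rewrite expRD ler_pM2l ?expR_gt0// -expR_half_ln -expRN ler_expR lerNr -rD -mulNr.
  by rewrite ler_wpM2r.
have qi0 : 0 <= q^-1 by rewrite invr_ge0 ltW.
have H := exp_leD (exp_leZ (expR_ge0 (- (lbp * (r / Delta)))) Hp)
  (exp_leD (exp_leZ qi0 (exp_le_ar gX kap0 sigK (leqnn n)))
   (exp_leZ (expR_ge0 (1 + lbn * (r / Delta))) Hn)).
apply: exp_le_prob (exp_le_trans _ H).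
- rewrite -[X in measurable X]setTI.
  apply: (@measurable_fun_ler _ _ R setT (cst r) (fun w => `|Delta * D w|)) => //.
  apply: measurableT_comp => //; apply: measurable_funM => //.
  apply: (@measurable_sum_ord R _ Om (fun i w => x i w ^+ 2 - kap)) => i _.
  by apply: measurable_funB => //; apply: measurable_funX; exact: mx.
- move=> w /= rD'; have x2 := sqr_ge0 (x n w).
  have t1 := mulr_ge0 (expR_ge0 (- (lbp * (r / Delta))))
    (expR_ge0 (lbp * D w + bp * x n w ^+ 2)).
  have t2 := mulr_ge0 qi0 x2.
  have t3 := mulr_ge0 (expR_ge0 (1 + lbn * (r / Delta)))
    (expR_ge0 (lbn * D w + bn * x n w ^+ 2)).
  have bpE : bp = q^-1 by rewrite /bp mul1r.
  have bnE : bn = - q^-1 by rewrite /bn mulN1r.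
  rewrite /D in t1 t3; rewrite -/(D w) in t1 t3 rD' *.
  have [D0|D0] := leP 0 (D w).
    apply: (@le_trans _ _ (expR (- (lbp * (r / Delta))) * expR (lbp * D w + bp * x n w ^+ 2))); last by lra.
    rewrite -expRD -[leLHS]expR0 ler_expR.
    have hD : r / Delta <= D w.
      by rewrite ler_pdivrMr// mulrC; move: rD'; rewrite ger0_norm// mulr_ge0// ltW.
    have : lbp * (r / Delta) <= lbp * D w by rewrite ler_wpM2l// (le_trans (ltW tq0)).
    by rewrite bpE; lra.
  (* Lower tail: either the Markov term alone reaches 1, or the negative boundary term is above
     [- 1], which the extra factor [expR 1] compensates. *)
  have [x1|x1] := leP 1 (q^-1 * x n w ^+ 2); first by lra.
  apply: (@le_trans _ _ (expR (1 + lbn * (r / Delta)) * expR (lbn * D w + bn * x n w ^+ 2))); last by lra.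
  rewrite -expRD -[leLHS]expR0 ler_expR.
  have hD : r / Delta <= - D w.
    rewrite ler_pdivrMr// mulrC mulrN; move: rD'; rewrite ltr0_norm//.
    by rewrite pmulr_rlt0.
  have : - lbn * (r / Delta) <= - lbn * - D w by rewrite ler_wpM2l// (le_trans (ltW tq0)).
  by rewrite bnE; lra.
- rewrite /tail_constant.
  have h1 : expR (- (lbp * (r / Delta))) * expR (n%:R * eta bp) <= q^-1 * expR (1 + 2 / theta).
    apply: ler_pM => //; rewrite ?expR_ge0//.
    by rewrite ler_expR (le_trans ep)// lerDr.
  have h2 : expR (1 + lbn * (r / Delta)) * expR (n%:R * eta bn) <= q^-1 * expR (1 + 2 / theta).
    have -> : q^-1 * expR (1 + 2 / theta) = (expR 1 / q) * expR (2 / theta).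
      by rewrite expRD; ring.
    by apply: ler_pM => //; rewrite ?expR_ge0// ler_expR.
  by move: h1 h2; move: (expR (1 + 2 / theta)) (q^-1) kap => E qi k; lra.
Qed.

End ar_tail.

(** * The sample correlation of autoregressive sequences *)

Section covariance.
Context {R : realType}.
Variables (Delta : R) (n : nat).

(** [Ytilde] as a function of two real sequences, of the same shape, so that [Ytilde] of sampled
    processes is convertible to it. *)
Definition scov (u v : nat -> R) : R :=
  Delta * (\sum_(k < n) u k * v k)
  - (n%:R * Delta) * (n%:R^-1 * \sum_(k < n) u k) * (n%:R^-1 * \sum_(k < n) v k).

(** Centering one factor is enough. Only [v] is centred, so the expression stays linear in [u] with
    coefficients depending on [v]. *)
Lemma scov_center u v : (n%:R : R) != 0 ->
  scov u v = Delta * \sum_(k < n) u k * (v k - (\sum_(i < n) v i) / n%:R).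
Proof.
move=> n0; under eq_bigr do rewrite mulrBr.
rewrite sumrB -mulr_suml /scov.
by move: (\sum_(k < n) u k * v k) (\sum_(k < n) u k) (\sum_(i < n) v i) => A B C; field.
Qed.

Lemma scov_diag u kap : (n%:R : R) != 0 ->
  scov u u = Delta * \sum_(k < n) (u k ^+ 2 - kap) + n%:R * Delta * kap
    - n%:R * Delta * ((\sum_(k < n) u k) / n%:R) ^+ 2.
Proof.
move=> n0; rewrite sumrB sumr_const card_ord -[kap *+ n]mulr_natr /scov.
under eq_bigr do rewrite -expr2.
by move: (\sum_(k < n) u k ^+ 2) (\sum_(k < n) u k) => A B; field.
Qed.

Lemma measurable_scov d (S : measurableType d) (u v : nat -> S -> R) :
  (forall k, measurable_fun [set: S] (u k)) -> (forall k, measurable_fun [set: S] (v k)) ->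
  measurable_fun [set: S] (fun w => scov (u ^~ w) (v ^~ w)).
Proof.
move=> mu mv; apply: measurable_funB.
  apply: measurable_funM => //.
  by apply: (@measurable_sum_ord R _ S (fun k w => u k w * v k w)) => k _; exact: measurable_funM.
apply: measurable_funM; last first.
  by apply: measurable_funM => //; apply: (@measurable_sum_ord R _ S v) => k _; exact: mv.
apply: measurable_funM => //.
by apply: measurable_funM => //; apply: (@measurable_sum_ord R _ S u) => k _; exact: mu.
Qed.

Lemma measurable_div_sqrt d (S : measurableType d) (f g : S -> R) :
  measurable_fun [set: S] f -> measurable_fun [set: S] g ->
  measurable_fun [set: S] (fun w => f w / Num.sqrt (g w)).
Proof.
(* On nonnegative reals [powR] with exponent [-1] is the inverse, also at 0, and it is
   measurable. *)
move=> mf mg; rewrite (_ : (fun w => _) = fun w => f w * powR (Num.sqrt (g w)) (-1)).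
  apply: measurable_funM => //.
  have ms : measurable_fun [set: S] (fun w => Num.sqrt (g w)).
    apply: (measurableT_comp _ mg); apply: continuous_measurable_fun.
    exact: sqrt_continuous.
  have mp : measurable_fun [set: R] (fun x : R => powR x (-1)) by exact: measurable_powR.
  exact: (measurableT_comp mp ms).
by apply/funext => w; rewrite powR_inv1 ?sqrtr_ge0.
Qed.

Lemma sqrt_prod_bounds (e d1 d2 : R) : 0 < e <= 2^-1 -> `|d1 - 1| < e -> `|d2 - 1| < e ->
  1 - e <= Num.sqrt (d1 * d2) <= 1 + e.
Proof.
move=> /andP[e0 e2]; rewrite !ltr_norml => /andP[l1 u1] /andP[l2 u2].
have h1 : 0 <= 1 - e by lra.
have h2 : 0 <= 1 + e by lra.
have -> : 1 - e = Num.sqrt ((1 - e) * (1 - e)) by rewrite -expr2 sqrtr_sqr ger0_norm.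
have -> : 1 + e = Num.sqrt ((1 + e) * (1 + e)) by rewrite -expr2 sqrtr_sqr ger0_norm.
have p1 : 0 <= d1 by lra. have p2 : 0 <= d2 by lra.
rewrite !ler_sqrt ?mulr_ge0//; apply/andP; split; apply: ler_pM => //; lra.
Qed.

End covariance.

Lemma measurable_integral_comp d d1 d2 (Om : measurableType d) (S1 : measurableType d1)
    (S2 : measurableType d2) (R : realType) (P : probability Om R) (V : Om -> S2)
    (g : S1 * S2 -> \bar R) :
  measurable_fun [set: Om] V -> measurable_fun [set: S1 * S2] g ->
  (forall x, 0 <= g x)%E -> measurable_fun [set: S1] (fun u => \int[P]_w g (u, V w))%E.
Proof.
move=> mV mg g0.
pose fV : {RV P >-> S2} := HB.pack V (isMeasurableFun.Build _ _ _ _ V mV).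
have := measurable_fun_fubini_tonelli_F (m2 := distribution P fV) g mg g0.
congr (measurable_fun _ _); apply/funext => u; rewrite /fubini_F.
rewrite (ge0_integral_distribution fV)//.
exact: (measurableT_comp mg (measurable_pair1 _)).
Qed.

(** * Gaussian approximation of the numerator *)

Section discrete_bound.
Context d (Om : measurableType d) (R : realType) (P : probability Om R).
Variables (n : nat) (theta Delta a T q sig : R) (X Y : nat -> Om -> R).
Hypotheses (gX : gauss_seq P n sig X) (gY : gauss_seq P n sig Y).
Hypothesis YX : forall A B, cyl n Y A -> cyl n X B -> (P (A `&` B) = P A * P B)%E.
Hypotheses (theta0 : 0 < theta) (Delta0 : 0 < Delta) (a01 : 0 < a < 1).
Local Notation s := (1 - a ^+ 2).
Hypotheses (sl : theta * Delta <= s) (su : s <= 2 * theta * Delta)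
  (sd : 2 * theta * Delta - s <= 2 * theta ^+ 2 * Delta ^+ 2).
Hypotheses (TE : T = n%:R * Delta) (q1 : 1 <= q) (qT : q ^+ 2 = T).
Hypothesis sigE : sig ^+ 2 = s / (2 * theta).
Hypotheses (qtheta : 4 / theta <= q) (lT1 : 1 <= ln T) (eps2 : 3 * ln T / q <= 2^-1).
Local Notation kap := ((2 * theta)^-1).
Local Notation c0 := (2 * theta ^+ 2 * s * Delta ^+ 2 / T).
Local Notation x k := (fun w => ar a (X ^~ w) k).
Local Notation y k := (fun w => ar a (Y ^~ w) k).
Local Notation xs w := (ar a (X ^~ w)).
Local Notation ys w := (ar a (Y ^~ w)).

Let mX : forall i, measurable_fun [set: Om] (X i) := gX.1.
Let mY : forall i, measurable_fun [set: Om] (Y i) := gY.1.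
Let mx k : measurable_fun [set: Om] (x k).
Proof. by apply: measurable_ar => i _; exact: mX. Qed.
Let my k : measurable_fun [set: Om] (y k).
Proof. by apply: measurable_ar => i _; exact: mY. Qed.
Let q0 : 0 < q. Proof. exact: lt_le_trans q1. Qed.
Let T0 : 0 < T. Proof. by rewrite -qT exprn_gt0. Qed.
Let nr0 : 0 < n%:R :> R. Proof. by rewrite -(pmulr_lgt0 _ Delta0) -TE. Qed.
Let s0 : 0 < s. Proof. by apply: lt_le_trans sl; exact: mulr_gt0. Qed.

Local Notation F w := (2 * theta * Num.sqrt theta / q * scov Delta n (xs w) (ys w)).
Local Notation delta := (8 * (variance_constant theta * (Delta + q^-1))).

Let cf j w := 2 * theta * Num.sqrt theta / q * Delta *
  ar_adjoint a n (fun k => y k w - (\sum_(i < n) y i w) / n%:R) j.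
Let V w := c0 * \sum_(j < n)
  ar_adjoint a n (fun k => y k w - (\sum_(i < n) y i w) / n%:R) j ^+ 2.

Let FE w : F w = \sum_(j < n) cf j w * X j w.
Proof.
rewrite scov_center ?gt_eqF//.
rewrite (ar_bilinear a n (X ^~ w) (fun k => y k w - (\sum_(i < n) y i w) / n%:R)).
rewrite mulrA mulr_sumr.
by apply: eq_bigr => j _; rewrite mulrA.
Qed.

Let cfV w : `|sig| * Num.sqrt (\sum_(j < n) cf j w ^+ 2) = Num.sqrt (V w).
Proof.
rewrite -sqrtr_sqr -sqrtrM ?sqr_ge0//; congr Num.sqrt.
rewrite /cf; under eq_bigr do rewrite exprMn.
rewrite -mulr_sumr /V mulrA; congr (_ * _).
rewrite sigE 2!exprMn exprVn !exprMn sqr_sqrtr ?(ltW theta0)// qT.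
by move: s => s'; field; rewrite !gt_eqF.
Qed.

(** With the second process frozen, [F] is a linear form in the innovations of the first, of law
    [glaw (Num.sqrt (V w))]. [gauss_variance_le] compares it with [Phi], which is the origin of the
    factor 8, and [exp_le_variance] averages the error. *)
Lemma cond_cdf z :
  (P [set w | F w <= z]%R <= (Phi z + delta)%:E)%E /\
  ((Phi z - delta)%:E <= P [set w | F w <= z]%R)%E.
Proof.
pose B : set R := [set t | t <= z].
have mB : measurable B by exact: measurable_le_set.
pose FY := g_sigma_algebraType (cyl n Y); pose FX := g_sigma_algebraType (cyl n X).
have mycf j : measurable_fun [set: FY] (cf j).
  apply: measurable_funM => //.
  have myF k : (k <= n)%N -> measurable_fun [set: FY] (y k).
    move=> kn; apply: measurable_ar => i ik; apply: cyl_comp_measurable.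
    exact: leq_trans kn.
  pose u k w := y k w - (\sum_(i < n) y i w) / n%:R.
  apply: (@measurable_ar_adjoint R a _ FY n u) => k kn.
  apply: measurable_funB; first exact: (myF k (ltnW kn)).
  apply: measurable_funM => //.
  by apply: (@measurable_sum_ord R _ FY (fun k => y k)) => i ik; exact: (myF i (ltnW ik)).
pose g (p : FY * FX) : \bar R := (\1_B (\sum_(j < n) cf j p.1 * X j p.2))%:E.
have mg : measurable_fun [set: FY * FX] g.
  apply/measurable_EFinP; apply: (measurableT_comp (measurable_indic mB)).
  apply: (@measurable_sum_ord R _ (FY * FX)%type (fun j p => cf j p.1 * X j p.2)) => j jn.
  apply: measurable_funM.
    by apply: (measurableT_comp (mycf j)); exact: measurable_fst.
  have mXj : measurable_fun [set: FX] (X j) by exact: cyl_comp_measurable.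
  by apply: (measurableT_comp mXj); exact: measurable_snd.
have g0 p : (0 <= g p)%E by rewrite lee_fin.
have mF : measurable_fun [set: Om] (fun w => F w).
  by apply: measurable_funM => //; apply: (@measurable_scov R Delta n _ Om (fun k => x k) (fun k => y k)).
have mFz : measurable [set w | F w <= z].
  by rewrite -[X in measurable X]setTI; exact: (mF measurableT B mB).
pose G w := gauss R ((fun t => Num.sqrt (V w) * t) @^-1` B).
have mpre w : measurable ((fun w' => \sum_(j < n) cf j w * X j w') @^-1` B).
  have mS : measurable_fun [set: Om] (fun w' => \sum_(j < n) cf j w * X j w').
    apply: (@measurable_sum_ord R _ Om (fun j w' => cf j w * X j w')) => j _.
    exact: measurable_funM.
  by rewrite -[X in measurable X]setTI; exact: (mS measurableT B mB).
have PG : P [set w | F w <= z] = (\int[P]_w G w)%E.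
  rewrite probability_integral//.
  transitivity (\int[P]_w g (w, w))%E.
    apply: eq_integral => w _; rewrite /g/= -FE !indicE.
    have -> // : (w \in [set w | F w <= z]) = (F w \in B).
    by apply/idP/idP; rewrite !inE.
  rewrite (indep_cyl_integral mY mX YX mg g0).
  apply: eq_integral => w _; rewrite /G -cfV -/(glaw _ B).
  by rewrite -(gauss_seq_lincomb (fun j => cf j w) gX mB) (probability_integral _ (mpre w)).
(* [G] is measurable by Tonelli, after it is written back as an integral over the first process. *)
have mG : measurable_fun [set: Om] G.
  have -> : G = fun w => (\int[P]_w' g (w, w'))%E.
    apply/funext => w; rewrite /G -cfV -/(glaw _ B).
    by rewrite -(gauss_seq_lincomb (fun j => cf j w) gX mB) (probability_integral _ (mpre w)).
  have mid : measurable_fun [set: Om] (id : Om -> FX).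
    by move=> _ A sA; rewrite setTI; exact: (cyl_sigma_measurable mX sA).
  apply: (@cyl_fun_measurable _ _ R P n sig Y gY n _ _ (fun w => \int[P]_w' g (w, w'))%E).
  exact: measurable_integral_comp mid mg g0.
have V0 w : 0 <= V w.
  rewrite mulr_ge0//; last by apply: sumr_ge0 => j _; exact: sqr_ge0.
  by rewrite !mulr_ge0 ?invr_ge0 ?sqr_ge0// ltW.
have [mV _ HV] := exp_leZ (ler0n R 8) (exp_le_variance gY theta0 Delta0 a01 sl su sd TE q1 qT sigE).
have G0 w : (0 <= G w)%E by exact: measure_ge0.
have Gfin w : G w \is a fin_num.
  apply: fin_num_measure; rewrite -[X in measurable X]setTI; exact: mulrl_measurable.
have GV w : `|fine (G w) - Phi z| <= 8 * `|V w - 1|.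
  rewrite -lee_fin -abse_EFin EFinB fineK//; exact: gauss_variance_le z (V0 w).
have e0 w : 0 <= 8 * `|V w - 1| by rewrite mulr_ge0.
have mVE : measurable_fun [set: Om] (fun w => (8 * `|V w - 1|)%:E) by exact/measurable_EFinP.
have intc (c : R) : (\int[P]_w c%:E = c%:E)%E.
  by rewrite (integral_cst P measurableT c%:E) [X in (_ * X)%E]probability_setT mule1.
rewrite PG; split.
- apply: (@le_trans _ _ (\int[P]_w ((Phi z)%:E + (8 * `|V w - 1|)%:E))%E).
    apply: ge0_le_integral => //.
      by apply: emeasurable_funD.
    move=> w _; have := GV w; rewrite -(fineK (Gfin w)) -EFinD !lee_fin.
    by move: (ler_norm (fine (G w) - Phi z)); lra.
  rewrite ge0_integralD//; last by move=> w _; rewrite lee_fin Phi_ge0.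
  by rewrite intc EFinD leeD2l.
- have H : ((Phi z)%:E <= \int[P]_w (G w + (8 * `|V w - 1|)%:E))%E.
    rewrite -[leLHS]intc; apply: ge0_le_integral => //.
    - by move=> w _; rewrite lee_fin Phi_ge0.
    - by apply: emeasurable_funD.
    move=> w _; have := GV w; rewrite -(fineK (Gfin w)) -EFinD !lee_fin -normrN opprB.
    by move: (ler_norm (Phi z - fine (G w))); lra.
  rewrite ge0_integralD// in H.
  rewrite EFinB leeBlDr//; apply: (le_trans H); exact: leeD2l.
Qed.

End discrete_bound.

(** * Tails of the sample variances *)

Section scov_tail.
Context d (Om : measurableType d) (R : realType) (P : probability Om R).
Variables (n : nat) (theta Delta a T q sig : R) (X : nat -> Om -> R).
Hypotheses (gX : gauss_seq P n sig X).
Hypotheses (theta0 : 0 < theta) (Delta0 : 0 < Delta) (a01 : 0 < a < 1).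
Local Notation s := (1 - a ^+ 2).
Hypotheses (sl : theta * Delta <= s) (su : s <= 2 * theta * Delta).
Hypotheses (TE : T = n%:R * Delta) (q1 : 1 <= q) (qT : q ^+ 2 = T).
Hypothesis sigE : sig ^+ 2 = s / (2 * theta).
Hypotheses (qtheta : 4 / theta <= q) (lT1 : 1 <= ln T).
Local Notation kap := ((2 * theta)^-1).
Local Notation x k := (fun w => ar a (X ^~ w) k).
Local Notation xs w := (ar a (X ^~ w)).

Let mX : forall i, measurable_fun [set: Om] (X i) := gX.1.
Let mx k : measurable_fun [set: Om] (x k).
Proof. by apply: measurable_ar => i _; exact: mX. Qed.
Let q0 : 0 < q. Proof. exact: lt_le_trans q1. Qed.
Let T0 : 0 < T. Proof. by rewrite -qT exprn_gt0. Qed.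
Let nr0 : 0 < n%:R :> R. Proof. by rewrite -(pmulr_lgt0 _ Delta0) -TE. Qed.
Let s0 : 0 < s. Proof. by apply: lt_le_trans sl; exact: mulr_gt0. Qed.
Let kap0 : 0 < kap. Proof. by rewrite invr_gt0 mulr_gt0. Qed.
Let T1 : 1 <= T. Proof. by rewrite -qT exprn_ege1. Qed.

Definition scov_tail_constant : R := tail_constant theta + 16 * (1 + kap) / theta.

(** Since [1 - a >= theta * Delta / 2], the second moment of the sum is [O (T / Delta^2)]; the
    factor [q / n^2] turns it into [q / T = q^-1]. *)
Lemma mean_sqr_constant :
  2 * theta * q / n%:R ^+ 2 * ((2 * n%:R * sig ^+ 2 + 2 * kap) / (1 - a) ^+ 2)
  <= 16 * (1 + kap) / theta / q.
Proof.
have h0 : 0 < 1 - a by case/andP: a01 => ? ?; rewrite subr_gt0.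
have hs : theta * Delta / 2 <= 1 - a.
  by have := sqr_ge0 (1 - a); move: sl; lra.
have e2 : 2 * n%:R * sig ^+ 2 + 2 * kap <= 2 * T * (1 + kap).
  have : n%:R * sig ^+ 2 <= T.
    rewrite sigE mulrA ler_pdivrMr ?mulr_gt0// [in leRHS]TE -[leRHS]mulrA ler_pM2l//.
    by rewrite mulrC.
  have : kap <= T * kap by rewrite ler_peMl// ltW.
  by move: kap => k; lra.
have e20 : 0 <= 2 * n%:R * sig ^+ 2 + 2 * kap.
  by apply: addr_ge0; apply: mulr_ge0; rewrite ?sqr_ge0 ?mulr_ge0 ?ler0n// ltW.
have e3 : ((1 - a) ^+ 2)^-1 <= 4 / (theta * Delta) ^+ 2.
  have -> : 4 / (theta * Delta) ^+ 2 = ((theta * Delta / 2) ^+ 2)^-1.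
    by field; rewrite !gt_eqF.
  rewrite lef_pV2 ?posrE ?exprn_gt0 ?divr_gt0 ?mulr_gt0//.
  by apply: lerXn2r => //; rewrite nnegrE ltW// divr_gt0// mulr_gt0.
have -> : 16 * (1 + kap) / theta / q =
  2 * theta * q / n%:R ^+ 2 * ((2 * T * (1 + kap)) * (4 / (theta * Delta) ^+ 2)).
  have -> : Delta = T / n%:R by rewrite TE mulrAC mulfV ?mul1r// gt_eqF.
  by move: kap => k; rewrite -qT; field; rewrite !gt_eqF.
have c0 : 0 <= 2 * theta * q / n%:R ^+ 2.
  by apply: divr_ge0; [rewrite !mulr_ge0// ltW|exact: sqr_ge0].
apply: (ler_wpM2l c0); apply: ler_pM => //.
by rewrite invr_ge0 sqr_ge0.
Qed.

(** The threshold [3 ln T / q] is shared: [2 ln T / q] for the energy, by [ar_energy_tail], and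
    [ln T / q] for the squared mean, by Markov's inequality and [1 <= ln T]. *)
Lemma scov_tail :
  (P [set w | 3 * ln T / q <= `|2 * theta / T * scov Delta n (xs w) (xs w) - 1| ]%R
    <= (scov_tail_constant / q)%:E)%E.
Proof.
pose D w := Delta * \sum_(i < n) (x i w ^+ 2 - kap).
pose m w := \sum_(i < n) x i w.
have mm : measurable_fun [set: Om] m.
  by apply: (@measurable_sum_ord R _ Om (fun k => x k)) => i _; exact: mx.
have mD : measurable_fun [set: Om] D.
  apply: measurable_funM => //.
  apply: (@measurable_sum_ord R _ Om (fun i w => x i w ^+ 2 - kap)) => i _.
  by apply: measurable_funB => //; apply: measurable_funX; exact: mx.
have mge (f : Om -> R) (c : R) : measurable_fun [set: Om] f -> measurable [set w | c <= f w].
  by move=> mf; rewrite -[X in measurable X]setTI;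
     apply: (@measurable_fun_ler _ _ R setT (cst c) f).
pose A1 := [set w | q * ln T / theta <= `|D w|].
pose A2 := [set w | ln T / q <= 2 * theta * (m w / n%:R) ^+ 2].
have mA1 : measurable A1 by apply: mge; exact: measurableT_comp.
have mA2 : measurable A2.
  apply: mge; apply: measurable_funM => //; apply: measurable_funX.
  exact: measurable_funM.
have PA1 : (P A1 <= (tail_constant theta / q)%:E)%E.
  exact: (ar_energy_tail gX theta0 Delta0 a01 sl su TE q1 qT sigE qtheta).
have PA2 : (P A2 <= (16 * (1 + kap) / theta / q)%:E)%E.
  have c0 : 0 <= 2 * theta * q / n%:R ^+ 2.
    by apply: divr_ge0; [rewrite !mulr_ge0// ltW|exact: sqr_ge0].
  apply: exp_le_prob mA2 _ (exp_le_trans mean_sqr_constant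
     (exp_leZ c0 (exp_le_ar_sum gX a01 kap0 sigE))).
  move=> w; rewrite /A2/= ler_pdivrMr// => H; apply: (le_trans lT1).
  apply: (le_trans H); rewrite le_eqVlt; apply/orP; left; apply/eqP.
  by rewrite /m; field; rewrite gt_eqF.
apply: (@le_trans _ _ (P (A1 `|` A2))); last first.
  apply: (le_trans (measureU2 _ mA1 mA2)).
  by rewrite /scov_tail_constant mulrDl EFinD; exact: leeD.
apply: le_measure; rewrite ?inE.
- apply: mge; apply: measurableT_comp => //; apply: measurable_funB => //.
  apply: measurable_funM => //.
  by apply: (@measurable_scov R Delta n _ Om (fun k => x k) (fun k => x k)).
- exact: measurableU.
move=> w /= H; apply: contrapT => /not_orP[]; rewrite /A1 /A2/= => /negP h1 /negP h2.
move: h1 h2; rewrite -!ltNge => h1 h2.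
move: H; apply/negP; rewrite -ltNge (scov_diag Delta (xs w) kap) ?gt_eqF//.
have -> : 2 * theta / T * (Delta * \sum_(k < n) (ar a (X^~ w) k ^+ 2 - kap) +
    n%:R * Delta * kap - n%:R * Delta * ((\sum_(k < n) ar a (X^~ w) k) / n%:R) ^+ 2) - 1 =
  2 * theta / T * D w - 2 * theta * (m w / n%:R) ^+ 2.
  rewrite -/(D w) -/(m w) -TE; move: (D w) (m w / n%:R) => u v.
  by field; rewrite !gt_eqF.
apply: (le_lt_trans (ler_normB _ _)).
have -> : 3 * ln T / q = 2 * theta / T * (q * ln T / theta) + ln T / q.
  by rewrite -qT; field; rewrite !gt_eqF.
have c0 : 0 < 2 * theta / T by rewrite divr_gt0// mulr_gt0.
apply: ltrD; first by rewrite normrM gtr0_norm// ltr_pM2l.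
rewrite ger0_norm//; apply: mulr_ge0 (sqr_ge0 _).
by apply: mulr_ge0 => //; exact: ltW.
Qed.

End scov_tail.

(** * Distribution function of the sample correlation *)

Section discrete_bound.
Context d (Om : measurableType d) (R : realType) (P : probability Om R).
Variables (n : nat) (theta Delta a T q sig : R) (X Y : nat -> Om -> R).
Hypotheses (gX : gauss_seq P n sig X) (gY : gauss_seq P n sig Y).
Hypothesis YX : forall A B, cyl n Y A -> cyl n X B -> (P (A `&` B) = P A * P B)%E.
Hypotheses (theta0 : 0 < theta) (Delta0 : 0 < Delta) (a01 : 0 < a < 1).
Local Notation s := (1 - a ^+ 2).
Hypotheses (sl : theta * Delta <= s) (su : s <= 2 * theta * Delta)
  (sd : 2 * theta * Delta - s <= 2 * theta ^+ 2 * Delta ^+ 2).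
Hypotheses (TE : T = n%:R * Delta) (q1 : 1 <= q) (qT : q ^+ 2 = T).
Hypothesis sigE : sig ^+ 2 = s / (2 * theta).
Hypotheses (qtheta : 4 / theta <= q) (lT1 : 1 <= ln T) (eps2 : 3 * ln T / q <= 2^-1).
Local Notation kap := ((2 * theta)^-1).
Local Notation xs w := (ar a (X ^~ w)).
Local Notation ys w := (ar a (Y ^~ w)).
Local Notation F w := (2 * theta * Num.sqrt theta / q * scov Delta n (xs w) (ys w)).
Local Notation S w := (Num.sqrt theta * q * (scov Delta n (xs w) (ys w) /
   Num.sqrt (scov Delta n (xs w) (xs w) * scov Delta n (ys w) (ys w)))).
Local Notation delta := (8 * (variance_constant theta * (Delta + q^-1))).
Local Notation eps := (3 * ln T / q).
Local Notation err := (delta + 4 * eps + 2 * (scov_tail_constant theta / q)).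

Let q0 : 0 < q. Proof. exact: lt_le_trans q1. Qed.
Let T0 : 0 < T. Proof. by rewrite -qT exprn_gt0. Qed.
Let eps0 : 0 < eps. Proof. by rewrite divr_gt0// mulr_gt0// (lt_le_trans ltr01). Qed.

Let bad (Z : nat -> Om -> R) :=
  [set w | eps <= `|2 * theta / T * scov Delta n (ar a (Z ^~ w)) (ar a (Z ^~ w)) - 1| ].

Let ratio w : ~ bad X w -> ~ bad Y w ->
  exists2 D, 1 - eps <= D <= 1 + eps & S w = F w / D.
Proof.
rewrite /bad/= => /negP; rewrite -ltNge => hX /negP; rewrite -ltNge => hY.
exists (Num.sqrt ((2 * theta / T * scov Delta n (xs w) (xs w)) *
                  (2 * theta / T * scov Delta n (ys w) (ys w)))).
  by apply: sqrt_prod_bounds => //; apply/andP.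
have c0 : 0 < 2 * theta / T by rewrite divr_gt0// mulr_gt0.
have sE u v : Num.sqrt ((2 * theta / T * u) * (2 * theta / T * v)) =
    2 * theta / T * Num.sqrt (u * v).
  by rewrite mulrACA -expr2 sqrtrM ?sqr_ge0// sqrtr_sqr gtr0_norm.
rewrite sE.
move: (Num.sqrt (_ * _)) (scov _ _ (xs w) (ys w)) (Num.sqrt theta) => r c st.
(* If the denominator vanishes, both quotients are 0, the inverse of 0 being 0. *)
have [->|r0] := eqVneq r 0; first by rewrite mulr0 invr0 !mulr0.
by rewrite -qT; field; rewrite r0 !gt_eqF.
Qed.

(** Off the exceptional events [S <= z] means [F <= D * z] with [D] within [eps] of 1. The random
    level is enclosed between two deterministic ones, at which [cond_cdf] applies and [Phi_scale]
    costs [4 * eps]. *)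
Lemma discrete_cdf z :
  (P [set w | S w <= z]%R <= (Phi z + err)%:E)%E /\
  ((Phi z - err)%:E <= P [set w | S w <= z]%R)%E.
Proof.
have mX := gX.1; have mY := gY.1.
have mx k : measurable_fun [set: Om] (fun w => ar a (X ^~ w) k).
  by apply: measurable_ar => i _; exact: mX.
have my k : measurable_fun [set: Om] (fun w => ar a (Y ^~ w) k).
  by apply: measurable_ar => i _; exact: mY.
have mxx := @measurable_scov R Delta n _ Om _ _ mx mx.
have mxy := @measurable_scov R Delta n _ Om _ _ mx my.
have myy := @measurable_scov R Delta n _ Om _ _ my my.
have mle (f : Om -> R) (c : R) : measurable_fun [set: Om] f -> measurable [set w | f w <= c].
  by move=> mf; rewrite -[X in measurable X]setTI;
     apply: (@measurable_fun_ler _ _ R setT f (cst c)).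
have mge (f : Om -> R) (c : R) : measurable_fun [set: Om] f -> measurable [set w | c <= f w].
  by move=> mf; rewrite -[X in measurable X]setTI;
     apply: (@measurable_fun_ler _ _ R setT (cst c) f).
have mbX : measurable (bad X).
  apply: mge; apply: measurableT_comp => //; apply: measurable_funB => //.
  exact: measurable_funM.
have mbY : measurable (bad Y).
  apply: mge; apply: measurableT_comp => //; apply: measurable_funB => //.
  exact: measurable_funM.
have mbad : measurable (bad X `|` bad Y) by exact: measurableU.
have mF c : measurable [set w | F w <= c] by apply: mle; exact: measurable_funM.
have mS c : measurable [set w | S w <= c].
  apply: mle; apply: measurable_funM => //; apply: measurable_div_sqrt => //.
  exact: measurable_funM.
have Pbad : (P (bad X `|` bad Y) <= (2 * (scov_tail_constant theta / q))%:E)%E.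
  apply: (le_trans (measureU2 _ mbX mbY)).
  rewrite mulr_natl mulr2n EFinD; apply: leeD.
    exact: scov_tail gX theta0 Delta0 a01 sl su TE q1 qT sigE qtheta lT1.
  exact: scov_tail gY theta0 Delta0 a01 sl su TE q1 qT sigE qtheta lT1.
have cdf c := cond_cdf gX gY YX theta0 Delta0 a01 sl su sd TE q1 qT sigE c.
have e1 : 0 <= 1 - eps by move: eps2; lra.
have e1' : 0 <= 1 + eps by move: eps0; lra.
have sc1 : `|Phi ((1 - eps) * z) - Phi z| <= 4 * eps.
  apply: (le_trans (Phi_scale z e1)).
  by rewrite (_ : 1 - eps - 1 = - eps) ?normrN ?gtr0_norm//; ring.
have sc2 : `|Phi ((1 + eps) * z) - Phi z| <= 4 * eps.
  apply: (le_trans (Phi_scale z e1')).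
  by rewrite (_ : 1 + eps - 1 = eps) ?gtr0_norm//; ring.
(* The minimum and maximum take care of the sign of [z]. *)
pose lo := Num.min ((1 - eps) * z) ((1 + eps) * z).
pose hi := Num.max ((1 - eps) * z) ((1 + eps) * z).
have Dz D : 1 - eps <= D <= 1 + eps -> lo <= D * z <= hi.
  move=> /andP[D1 D2]; rewrite /lo /hi ge_min le_max.
  have [z0|z0] := leP 0 z.
    by apply/andP; split; apply/orP; [left|right]; rewrite ler_wpM2r.
  by apply/andP; split; apply/orP; [right|left]; rewrite ler_wnM2r// ltW.
have Plo : Phi z - 4 * eps <= Phi lo.
  rewrite /lo; move: sc1 sc2; rewrite !ler_norml => /andP[? ?] /andP[? ?].
  by have [_|_] := leP ((1 - eps) * z) ((1 + eps) * z); lra.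
have Phi_hi : Phi hi <= Phi z + 4 * eps.
  rewrite /hi; move: sc1 sc2; rewrite !ler_norml => /andP[? ?] /andP[? ?].
  by have [_|_] := leP ((1 - eps) * z) ((1 + eps) * z); lra.
have D0 D : 1 - eps <= D <= 1 + eps -> 0 < D by move=> /andP[? ?]; move: eps2; lra.
split.
- apply: (@le_trans _ _ (P ([set w | F w <= hi] `|` (bad X `|` bad Y)))).
    apply: le_measure; rewrite ?inE; [exact: mS|exact: measurableU|].
    move=> w /= Sz; have [?|nX] := pselect (bad X w); first by right; left.
    have [?|nY] := pselect (bad Y w); first by right; right.
    left; have [D Dz' SE] := ratio nX nY.
    move: Sz; rewrite SE ler_pdivrMr ?D0// => FD.
    by apply: (le_trans FD); rewrite mulrC; case/andP: (Dz D Dz').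
  apply: (le_trans (measureU2 _ (mF hi) mbad)).
  have [H _] := cdf hi.
  apply: (le_trans (leeD H Pbad)); rewrite -EFinD lee_fin; move: Phi_hi.
  by move: (delta) (scov_tail_constant theta / q) (eps) => u v e; lra.
- have H : (P [set w | (F w <= lo)%R] <= P ([set w | (S w <= z)%R] `|` (bad X `|` bad Y)))%E.
    apply: le_measure; rewrite ?inE; [exact: mF|exact: measurableU|].
    move=> w /= Fl; have [?|nX] := pselect (bad X w); first by right; left.
    have [?|nY] := pselect (bad Y w); first by right; right.
    left; have [D Dz' SE] := ratio nX nY.
    rewrite SE ler_pdivrMr ?D0//.
    by apply: (le_trans Fl); rewrite mulrC; case/andP: (Dz D Dz').
  have [_ L] := cdf lo.
  have := le_trans L (le_trans H (le_trans (measureU2 _ (mS z) mbad) (leeD (lexx _) Pbad))).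
  rewrite -leeBlDr// => K; apply: le_trans K; rewrite -EFinB lee_fin; move: Plo.
  by move: (delta) (scov_tail_constant theta / q) (eps) => u v e; lra.
Qed.

End discrete_bound.

(** * Innovations of the Ornstein-Uhlenbeck process *)

Section half_lines.
Context {R : realType}.
Local Notation gam := (@gauss R).

Lemma Phi_lipschitz (x y : R) : `|Phi x - Phi y| <= `|x - y|.
Proof.
wlog yx : x y / y <= x.
  move=> H; have [?|/ltW ?] := leP y x; first exact: H.
  by rewrite distrC [leRHS]distrC; exact: H.
have /andP[h0 h1] : 0 <= Phi x - Phi y <= (x - y) * 1.
  apply: Phi_increment => // u _.
  apply: (le_trans (@normal_pdf01_le R u 0 _)); first by rewrite expr0n sqr_ge0.
  by rewrite expr0n/= oppr0 mul0r expR0.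
by rewrite !ger0_norm// ?subr_ge0//; lra.
Qed.

(** Absence of atoms, from the Lipschitz bound on [Phi]. *)
Lemma gauss_lt z : gam [set x | x < z] = (Phi z)%:E.
Proof.
have mlt : measurable [set x : R | x < z] by rewrite -set_itvNyo; exact: measurable_itv.
apply/eqP; rewrite eq_le; apply/andP; split.
  by rewrite -PhiE le_measure ?inE//; [exact: measurable_le_set|move=> x /= /ltW].
apply/lee_addgt0Pr => e e0; rewrite -leeBlDr// -EFinB.
apply: (@le_trans _ _ (gam [set x | x <= z - e])).
  rewrite PhiE lee_fin; have := Phi_lipschitz z (z - e).
  by rewrite ler_norml (_ : z - (z - e) = e) ?gtr0_norm//; lra.
by rewrite le_measure ?inE//; [exact: measurable_le_set|move=> x /= ?; lra].
Qed.

Lemma glaw_lt (s z : R) : 0 < s -> glaw s [set x | x < z] = (Phi (z / s))%:E.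
Proof.
move=> s0; rewrite -gauss_lt; congr (gam _); apply/seteqP.
by split => x /=; rewrite ltr_pdivlMr// mulrC.
Qed.

Lemma glaw_le (s z : R) : 0 < s -> glaw s [set x | x <= z] = (Phi (z / s))%:E.
Proof.
move=> s0; rewrite -PhiE; congr (gam _); apply/seteqP.
by split => x /=; rewrite ler_pdivlMr// mulrC.
Qed.

End half_lines.

Lemma ler_dist_prod (R : realType) n (u v : nat -> R) :
  (forall i, 0 <= u i <= 1) -> (forall i, 0 <= v i <= 1) ->
  `|\prod_(i < n) u i - \prod_(i < n) v i| <= \sum_(i < n) `|u i - v i|.
Proof.
move=> u01 v01; elim: n => [|n IH]; first by rewrite !big_ord0 subrr normr0.
rewrite !big_ord_recr/=.
have -> : \prod_(i < n) u i * u n - \prod_(i < n) v i * v n =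
  (\prod_(i < n) u i - \prod_(i < n) v i) * u n + \prod_(i < n) v i * (u n - v n) by ring.
apply: (le_trans (ler_normD _ _)); rewrite !normrM; apply: lerD.
  apply: le_trans IH; rewrite ler_piMr//.
  by have /andP[? ?] := u01 n; rewrite ger0_norm.
rewrite ler_piMl// ger0_norm.
  by apply: prodr_ile1 => i _; exact: v01.
by apply: prodr_ge0 => i _; case/andP: (v01 i).
Qed.

Lemma cvg_sum_ord0 (R : realType) n (u : nat -> nat -> R) :
  (forall i, (i < n)%N -> u i @ \oo --> 0) ->
  (fun m => \sum_(i < n) u i m) @ \oo --> 0.
Proof.
elim: n => [|n IH] H.
  by apply: cvg_near_cst; apply: nearW => m; rewrite big_ord0.
have h1 := IH (fun i ilt => H i (leqW ilt)).
rewrite (_ : (fun m => \sum_(i < n.+1) u i m) =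
    (fun m => \sum_(i < n) u i m) \+ u n); last first.
  by apply/funext => m; rewrite big_ord_recr.
by rewrite -[X in _ --> X](addr0 (0 : R)); exact: cvgD h1 (H n (ltnSn n)).
Qed.

(** * Almost sure limits of Gaussian sequences *)

Section limits.
Context d (Om : measurableType d) (R : realType) (P : probability Om R).

(** Half-lines are replaced by Borel sets one coordinate at a time: with the other sets fixed, both
    sides are finite measures in the remaining one and agree on open half-lines. *)
Lemma gauss_seq_lt n (s : R) (X : nat -> Om -> R) : 0 < s ->
  (forall i, measurable_fun [set: Om] (X i)) ->
  (forall z : nat -> R, P (\bigcap_(i in `I_n) [set w | X i w < z i]) =
     (\prod_(i < n) Phi (z i / s))%:E) ->
  gauss_seq P n s X.
Proof.
move=> s0 mX H; split => // A mA.
have mXi i B : measurable B -> measurable (X i @^-1` B).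
  by move=> mB; rewrite -[X in measurable X]setTI; exact: (mX i measurableT B mB).
suff {A mA} K j : forall A : nat -> set R, (forall i, measurable (A i)) ->
    (forall i, (j <= i)%N -> exists z, A i = [set x | x < z]) ->
    P (\bigcap_(i in `I_n) (X i @^-1` A i)) = (\prod_(i < n) glaw s (A i))%E.
  (* Indices from [n] on are filled with an arbitrary half-line, so that the induction can start
     with no constraint below [n]. *)
  pose A' i := if (i < n)%N then A i else [set x | x < 0].
  have mA' i : measurable (A' i).
    by rewrite /A'; case: ifP => // _; rewrite -set_itvNyo; exact: measurable_itv.
  have := K n A' mA' _; rewrite (_ : \bigcap_(i in `I_n) (X i @^-1` A' i) =
      \bigcap_(i in `I_n) (X i @^-1` A i)); last first.
    by apply: eq_bigcapr => i /= ilt; rewrite /A' ilt.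
  move=> ->; first by apply: eq_bigr => i _; rewrite /A' ltn_ord.
  by move=> i ni; exists 0; rewrite /A' ltnNge ni.
elim: j => [|j IH] A mA Alt.
  have /choice[z zA] : forall i, exists z, A i = [set x | x < z] by move=> i; exact: Alt.
  rewrite (eq_bigcapr (F := fun i => X i @^-1` A i)
    (G := fun i => [set w | X i w < z i])); last by move=> i _; rewrite zA.
  rewrite H (big_morph EFin (@EFinM R) erefl); apply: eq_bigr => i _.
  by rewrite zA glaw_lt.
have [nj|jn] := leqP n j.
  pose A' i := if i == j then [set x | x < 0] else A i.
  have EA (i : nat) : (i < n)%N -> A' i = A i.
    by move=> ilt; rewrite /A'; case: eqP => // ij; move: nj; rewrite -ij leqNgt ilt.
  have := IH A' _ _; rewrite (eq_bigcapr (F := fun i => X i @^-1` A' i)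
    (G := fun i => X i @^-1` A i)); last by move=> i /= ilt; rewrite EA.
  move=> ->.
  - by apply: eq_bigr => i _; rewrite EA.
  - by move=> i; rewrite /A'; case: eqP => // _; rewrite -set_itvNyo; exact: measurable_itv.
  - move=> i ji; rewrite /A'; case: eqP => [_|/eqP ij]; first by exists 0.
    by apply: Alt; rewrite ltn_neqAle eq_sym ij.
pose A' B i := if i == j then B else A i.
pose E := \bigcap_(i in `I_n) (X i @^-1` A' setT i).
have mE : measurable E.
  rewrite /E bigcap_mkord; apply: bigsetI_measurable => i _; apply: mXi.
  by rewrite /A'; case: eqP.
have EE B : \bigcap_(i in `I_n) (X i @^-1` A' B i) = X j @^-1` B `&` E.
  apply/seteqP; split => [w Hw|w [Bw Ew] i /= ilt].
    split; first by have := Hw j jn; rewrite /= /A' eqxx.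
    by move=> i /= ilt; have := Hw i ilt; rewrite /= /A'; case: eqP.
  by have := Ew i ilt; rewrite /= /A'; case: eqP => [->|].
pose c := (\prod_(i < n | (i : nat) != j) fine (glaw s (A i)))%R.
have c0 : 0 <= c by apply: prodr_ge0 => i _; exact: fine_ge0.
have ms : measurable_fun [set: R] (fun z : R => s * z) by exact: mulrl_measurable.
have fl B : measurable B -> glaw s B = (fine (glaw s B))%:E.
  move=> mB; rewrite fineK// fin_num_measure// -[X in measurable X]setTI.
  exact: ms.
pose m2 := mscale (NngNum c0) (image_measure (@gauss R) ms).
pose m1 := image_measure (mrestr P mE) (mX j).
have prodE B : measurable B -> (\prod_(i < n) glaw s (A' B i))%E = m2 B.
  move=> mB; rewrite (bigD1 (Ordinal jn))//= {1}/A' eqxx.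
  rewrite (eq_bigr (fun i : 'I_n => (fine (glaw s (A i)))%:E)); last first.
    move=> i; rewrite -val_eqE/= => ij; rewrite /A' (negbTE ij); exact: fl.
  rewrite -(big_morph EFin (@EFinM R) erefl) muleC.
  by rewrite /m2 /mscale/= /c.
have m12 B : measurable B -> m1 B = m2 B.
  apply: (measure_unique (@RGenInftyO.G R) (fun k => `]-oo, k%:R[%classic)).
  - exact: RGenInftyO.measurableE.
  - move=> _ _ [x ->] [y ->]; exists (Num.min x y).
    by apply/seteqP; split => u /=; rewrite !in_itv/= lt_min => /andP.
  - by move=> k; exists k%:R.
  - rewrite -subTset => x _; exists (Num.truncn `|x|).+1 => //=.
    rewrite in_itv/=; apply: (le_lt_trans (ler_norm x)).
    by have /andP[] := truncn_itv (normr_ge0 x).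
  - move=> _ [x ->].
    have mI : measurable (`]-oo, x[%classic : set R) by exact: measurable_itv.
    apply: (etrans _ (prodE _ mI)); rewrite -IH.
    + by rewrite EE.
    + by move=> i; rewrite /A'; case: eqP.
    + move=> i ji; rewrite /A'; case: eqP => [_|/eqP ij].
        by exists x; rewrite set_itvNyo.
      by apply: Alt; rewrite ltn_neqAle eq_sym ij.
  - move=> k; apply: (le_lt_trans (probability_le1 _ _)); last exact: ltry.
    by apply: measurableI => //; apply: mXi; exact: measurable_itv.
have AE : A' (A j) = A by apply/funext => i; rewrite /A'; case: eqP => [->|].
rewrite -AE EE; apply: (etrans (m12 _ (mA j))).
by apply/esym; exact: prodE.
Qed.

Lemma cvg_probability_ae (D : nat -> Om -> R) (e : R) : 0 < e ->
  (forall m, measurable_fun [set: Om] (D m)) ->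
  {ae P, forall w, D ^~ w @ \oo --> 0} ->
  (fun m => P [set w | e <= `|D m w|]) @ \oo --> 0%E.
Proof.
move=> e0 mD D0.
have mE m : measurable [set w | e <= `|D m w|].
  rewrite -[X in measurable X]setTI.
  apply: (@measurable_fun_ler _ _ R setT (cst e) (fun w => `|D m w|)) => //.
  exact: measurableT_comp.
have [] := @dominated_convergence _ Om R P setT measurableT
  (fun m w => (\1_[set w | e <= `|D m w|] w)%:E) (cst 0%E) (cst 1%E).
- by move=> m; exact/measurable_EFinP/measurable_indic.
- exact: measurable_cst.
- apply: filterS D0 => w Dw _; apply: cvg_near_cst.
  have /cvgrPdist_lt/(_ e e0) := Dw; apply: filterS => m.
  rewrite sub0r normrN => Dm; rewrite indicE memNset//= => /(lt_le_trans Dm).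
  by rewrite ltxx.
- exact: finite_measure_integrable_cst.
- by apply/aeW => w m _; rewrite gee0_abs ?lee_fin// indicE; case: (_ \in _).
move=> _ _; rewrite integral0 => h; apply: (cvg_trans _ h); apply: near_eq_cvg; apply: nearW => m /=.
by rewrite (probability_integral _ (mE m)).
Qed.

(** Convergence in probability encloses the event [X i < z i] between the events [Xm m i <= z i - e]
    and [Xm m i <= z i + e], up to probability [e]; their probabilities are products of values of
    the Lipschitz function [Phi]. *)
Lemma gauss_seq_cvg n (s : R) (sm : nat -> R) (Xm : nat -> nat -> Om -> R) (X : nat -> Om -> R) :
  0 < s -> (forall m, 0 < sm m) -> sm @ \oo --> s ->
  (forall m, gauss_seq P n (sm m) (Xm m)) ->
  (forall i, measurable_fun [set: Om] (X i)) ->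
  {ae P, forall w, forall i, (i < n)%N -> (fun m => Xm m i w) @ \oo --> X i w} ->
  gauss_seq P n s X.
Proof.
move=> s0 sm0 sms gXm mX cX; apply: gauss_seq_lt => // z.
have mXm m i : measurable_fun [set: Om] (Xm m i) := (gXm m).1 i.
set p := P _; set L := \prod_(i < n) _.
have mA : measurable (\bigcap_(i in `I_n) [set w | X i w < z i]).
  rewrite bigcap_mkord; apply: bigsetI_measurable => i _.
  rewrite -[X in measurable X]setTI.
  by apply: (@measurable_fun_ltr _ _ R setT (X i) (cst (z i))).
have pfin : p = (fine p)%:E by rewrite fineK// fin_num_measure.
rewrite pfin; congr EFin; apply/eqP; rewrite -subr_eq0 -normr_le0.
apply/ler_addgt0Pr => e0 e00; rewrite add0r.
(* Each factor moves by at most [e * (1 + s^-1)]; the last [1] pays for the exceptional event. *)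
pose K := n%:R * (1 + s^-1) + 1.
have si0 : 0 < s^-1 by rewrite invr_gt0.
have K0 : 0 < K by rewrite ltr_wpDl// mulr_ge0// addr_ge0// ltW.
pose e := e0 / K; have e_gt0 : 0 < e by rewrite divr_gt0.
suff H : `|fine p - L| <= K * e by move: H; rewrite /e mulrC divfK// gt_eqF.
pose D m w := \sum_(i < n) `|Xm m i w - X i w|.
have mD m : measurable_fun [set: Om] (D m).
  apply: measurable_sum => i; apply: measurableT_comp => //.
  exact: measurable_funB.
have D0 : {ae P, forall w, D ^~ w @ \oo --> 0}.
  apply: filterS cX => w cw.
  apply: (@cvg_sum_ord0 R n (fun i m => `|Xm m i w - X i w|)) => i ilt.
  rewrite -[X in _ --> X](@normr0 _ R) -(subrr (X i w)).
  by apply: cvg_norm; apply: cvgB; [exact: cw|exact: cvg_cst].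
(* A common bound for all shifted levels, so that an error [e / Z] in the inverse deviation costs at
   most [e]. *)
pose Z := \sum_(i < n) `|z i| + e.
have Z0 : 0 < Z by rewrite ltr_wpDl// sumr_ge0.
have zZ i : (i < n)%N -> `|z i| <= Z - e.
  by move=> ilt; rewrite addrK (bigD1 (Ordinal ilt))//= lerDl sumr_ge0.
have [m [PE sE]] : exists m, (P [set w | e <= `|D m w| ]%R <= e%:E)%E /\
    `|(sm m)^-1 - s^-1| <= e / Z.
  have h1 : \forall m \near \oo, (P [set w | e <= `|D m w| ]%R <= e%:E)%E.
    have := cvg_probability_ae e_gt0 mD D0.
    move=> /fine_cvgP[fP] /cvgrPdist_le/(_ e e_gt0).
    move: fP; apply: filterS2 => m fm; rewrite sub0r normrN ger0_norm ?fine_ge0//.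
    by rewrite -lee_fin fineK.
  have h2 : \forall m \near \oo, `|(sm m)^-1 - s^-1| <= e / Z.
    have /cvgrPdist_le/(_ (e / Z)) : (fun m => (sm m)^-1) @ \oo --> s^-1.
      by apply: cvgV => //; rewrite gt_eqF.
    by move=> /(_ (divr_gt0 e_gt0 Z0)); apply: filterS => m; rewrite distrC.
  by have [m] := filter_ex (filterI h1 h2); exists m.
have scale i (y : R) : (i < n)%N -> `|y - z i| <= e ->
    `|Phi (y / sm m) - Phi (z i / s)| <= e * (1 + s^-1).
  move=> ilt yz; apply: (le_trans (Phi_lipschitz _ _)).
  have -> : y / sm m - z i / s = y * ((sm m)^-1 - s^-1) + (y - z i) * s^-1 by ring.
  apply: (le_trans (ler_normD _ _)); rewrite [leRHS]mulrDr mulr1; apply: lerD.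
    have yZ : `|y| <= Z.
      have := ler_normD (y - z i) (z i); rewrite subrK.
      by have := zZ i ilt; lra.
    rewrite normrM; apply: (le_trans (ler_pM _ _ yZ sE)) => //.
    by rewrite mulrC divfK// gt_eqF.
  by rewrite normrM (gtr0_norm si0) ler_wpM2r// ltW.
have prodd (y : nat -> R) : (forall i, (i < n)%N -> `|y i - z i| <= e) ->
    `|\prod_(i < n) Phi (y i / sm m) - L| <= n%:R * (e * (1 + s^-1)).
  move=> yz; apply: (le_trans (ler_dist_prod n
    (u := fun i => Phi (y i / sm m)) (v := fun i => Phi (z i / s)) _ _)).
  - by move=> i; rewrite Phi_ge0 Phi_le1.
  - by move=> i; rewrite Phi_ge0 Phi_le1.
  have -> : n%:R * (e * (1 + s^-1)) = \sum_(i < n) e * (1 + s^-1).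
    by rewrite sumr_const card_ord mulr_natl.
  by apply: ler_sum => i _; apply: scale; [exact: ltn_ord|exact: yz].
have mEm : measurable [set w | e <= `|D m w|].
  rewrite -[X in measurable X]setTI.
  apply: (@measurable_fun_ler _ _ R setT (cst e) (fun w => `|D m w|)) => //.
  exact: measurableT_comp.
have law (y : nat -> R) : P (\bigcap_(i in `I_n) (Xm m i @^-1` [set x | x <= y i])) =
    (\prod_(i < n) Phi (y i / sm m))%:E.
  rewrite (gXm m).2; last by move=> i; exact: measurable_le_set.
  rewrite (big_morph EFin (@EFinM R) erefl); apply: eq_bigr => i _.
  by rewrite glaw_le.
have mle (y : nat -> R) : measurable (\bigcap_(i in `I_n) (Xm m i @^-1` [set x | x <= y i])).
  rewrite bigcap_mkord; apply: bigsetI_measurable => i _.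
  rewrite -[X in measurable X]setTI; exact: (mXm m i measurableT _ (measurable_le_set _)).
have close w i : ~ (e <= `|D m w|) -> (i < n)%N -> `|Xm m i w - X i w| < e.
  move=> /negP; rewrite -ltNge ger0_norm ?sumr_ge0// => De ilt; apply: le_lt_trans De.
  by rewrite /D (bigD1 (Ordinal ilt))//= lerDl sumr_ge0.
have up : fine p <= \prod_(i < n) Phi ((z i + e) / sm m) + e.
  rewrite -lee_fin -pfin EFinD -(law (fun i => z i + e)).
  apply: le_trans (leeD (lexx _) PE); apply: le_trans (measureU2 _ (mle _) mEm).
  apply: le_measure; rewrite ?inE//; first exact: measurableU.
  move=> w Hw; have [?|nE] := pselect (e <= `|D m w|); [by right|left].
  move=> i /= ilt; have := Hw i ilt; have := close w i nE ilt.
  by rewrite /= ltr_norml => /andP[? ?]; lra.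
have low : \prod_(i < n) Phi ((z i - e) / sm m) <= fine p + e.
  rewrite -lee_fin EFinD -pfin -(law (fun i => z i - e)).
  apply: le_trans (leeD (lexx _) PE); apply: le_trans (measureU2 _ mA mEm).
  apply: le_measure; rewrite ?inE//; first exact: measurableU.
  move=> w Hw; have [?|nE] := pselect (e <= `|D m w|); [by right|left].
  move=> i /= ilt; have := Hw i ilt; have := close w i nE ilt.
  by rewrite /= ltr_norml => /andP[? ?]; lra.
have e_norm : `|e| <= e by rewrite gtr0_norm.
have /ler_normlP[u1 u2] := prodd (fun i => z i + e)
  (fun i _ => ltac:(by rewrite addrAC subrr add0r)).
have /ler_normlP[l1 l2] := prodd (fun i => z i - e)
  (fun i _ => ltac:(by rewrite addrAC subrr add0r normrN)).
have -> : K * e = n%:R * (e * (1 + s^-1)) + e by rewrite /K; ring.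
by rewrite ler_norml; apply/andP; split; lra.
Qed.

End limits.

(** * Blocks, concatenation and splitting *)

Section blocks.
Context d (Om : measurableType d) (R : realType) (P : probability Om R).
Implicit Types X Y Z U : nat -> Om -> R.

Lemma cyl_sub_sigma m n U Z :
  (forall i, (i < m)%N ->
     measurable_fun [set: g_sigma_algebraType (cyl n U)] (Z i : g_sigma_algebraType (cyl n U) -> R)) ->
  forall A, cyl m Z A -> <<s cyl n U >> A.
Proof.
move=> mZ _ [A mA ->].
suff : measurable (\bigcap_(i in `I_m) (Z i @^-1` A i) : set (g_sigma_algebraType (cyl n U))).
  by [].
rewrite bigcap_mkord; apply: bigsetI_measurable => i _.
rewrite -[X in measurable X]setTI.
exact: (mZ i (ltn_ord i) measurableT _ (mA i)).
Qed.

Lemma gauss_seq_of_cyl N (s : R) U : (forall i, measurable_fun [set: Om] (U i)) ->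
  (forall k, (k < N)%N -> forall C B, cyl k U C -> measurable B ->
     P (C `&` U k @^-1` B) = (P C * glaw s B)%E) ->
  gauss_seq P N s U.
Proof.
move=> mU H; split => // A mA.
elim: N H => [|N IH] H.
  rewrite big_ord0 (_ : \bigcap_(_ in _) _ = setT) ?probability_setT//.
  by rewrite -subTset => w _ i.
rewrite big_ord_recr/= -IH; last by move=> k kN; apply: H; exact: leqW.
rewrite -(H N (ltnSn N))//; last by exists A.
congr (P _); apply/seteqP; split => [w Hw|w [Hw wN] i /=].
  by split; [move=> i /= iN; apply: Hw; exact: leqW|exact: Hw (ltnSn N)].
by rewrite ltnS leq_eqVlt => /predU1P[->//|]; exact: Hw.
Qed.

(** [gauss_seq_sum] makes each block sum independent of all variables of the earlier blocks, hence
    of the earlier block sums. *)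
Lemma gauss_seq_blocks N M (s : R) Z (c : nat -> R) : gauss_seq P (N * M) s Z ->
  gauss_seq P N (`|s| * Num.sqrt (\sum_(j < M) c j ^+ 2))
    (fun k w => \sum_(j < M) c j * Z (k * M + j)%N w).
Proof.
move=> gZ; have mZ := gZ.1.
apply: gauss_seq_of_cyl => [i|k kN C B CC mB].
  apply: (@measurable_sum_ord R _ Om (fun j w => c j * Z (i * M + j)%N w)) => j _.
  exact: measurable_funM.
have kM : (k * M + M <= N * M)%N by rewrite -mulSnr leq_mul2r kN orbT.
have H D := gauss_seq_sum c gZ kM (C := D) (B := B).
have PB : P ((fun w => \sum_(j < M) c j * Z (k * M + j)%N w) @^-1` B) =
    glaw (`|s| * Num.sqrt (\sum_(j < M) c j ^+ 2)) B.
  by have := H setT (cyl_setT _ _) mB; rewrite setTI probability_setT mul1e.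
rewrite -PB.
apply: (indep_sigma_algebra (@cyl_setI _ _ _ (k * M) Z) (cyl_setT _ _) (cyl_measurable mZ)).
- rewrite -[X in measurable X]setTI.
  apply: (@measurable_sum_ord R _ Om (fun j w => c j * Z (k * M + j)%N w)) => // j _.
  exact: measurable_funM.
- by move=> D CD; rewrite H// PB.
- apply: cyl_sub_sigma CC => i ik.
  apply: (@measurable_sum_ord R _ (g_sigma_algebraType (cyl (k * M) Z))
    (fun j w => c j * Z (i * M + j)%N w)) => j jM.
  apply: measurable_funM => //; apply: cyl_comp_measurable.
  by apply: (@leq_trans (i * M + M)%N); rewrite ?ltn_add2l// -mulSnr leq_mul2r ik orbT.
Qed.

(** Two independent noises become one sequence, whose limit is taken once; [gauss_seq_split] then
    recovers the two laws and the independence of the limits. *)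
Lemma gauss_seq_cat m n (s : R) X Y : gauss_seq P m s X -> gauss_seq P n s Y ->
  (forall A B, cyl m X A -> cyl n Y B -> (P (A `&` B) = P A * P B)%E) ->
  gauss_seq P (m + n) s (fun i => if (i < m)%N then X i else Y (i - m)%N).
Proof.
move=> [mX gX] [mY gY] XY; split => [i|A mA]; first by case: ifP.
rewrite big_split_ord/= -gX// -(gY (fun i => A (m + i)%N))// -XY.
- congr (P _); apply/seteqP; split => [w Hw|w [Xw Yw] i /= imn].
    split=> i /= ilt.
      by have := Hw i (ltn_addr n ilt); rewrite /= ilt.
    have := Hw (m + i)%N; rewrite /= ltn_add2l => /(_ ilt).
    by rewrite ltnNge leq_addr/= addKn.
  case: ifPn => im; first exact: Xw.
  have mi : (m <= i)%N by rewrite leqNgt.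
  by have := Yw (i - m)%N; rewrite /= subnKC//; apply; rewrite ltn_subLR.
- by exists A.
- by exists (fun i => A (m + i)%N).
Qed.

Lemma gauss_seq_split m n (s : R) U : gauss_seq P (m + n) s U ->
  gauss_seq P n s (fun i => U (m + i)%N) /\
  (forall A B, cyl m U A -> cyl n (fun i => U (m + i)%N) B -> (P (A `&` B) = P A * P B)%E).
Proof.
move=> gU; have [mU prodU] := gU.
have H (A B : nat -> set R) : (forall i, measurable (A i)) -> (forall i, measurable (B i)) ->
    P (\bigcap_(i in `I_m) (U i @^-1` A i) `&` \bigcap_(i in `I_n) (U (m + i)%N @^-1` B i)) =
    (\prod_(i < m) glaw s (A i) * \prod_(i < n) glaw s (B i))%E.
  move=> mA mB; pose C i := if (i < m)%N then A i else B (i - m)%N.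
  have mC i : measurable (C i) by rewrite /C; case: ifP.
  have := prodU C mC; rewrite big_split_ord/=.
  rewrite (eq_bigr (fun i : 'I_m => glaw s (A i))); last first.
    by move=> i _; rewrite /C ltn_ord.
  rewrite [X in (_ * X)%E](eq_bigr (fun i : 'I_n => glaw s (B i))); last first.
    by move=> i _; rewrite /C ltnNge leq_addr/= addKn.
  move=> <-; congr (P _); apply/seteqP; split => [w [Aw Bw] i /= imn|w Hw].
    rewrite /C; case: ifPn => im; first exact: Aw.
    have mi : (m <= i)%N by rewrite leqNgt.
    by have := Bw (i - m)%N; rewrite /= subnKC//; apply; rewrite ltn_subLR.
  split=> i /= ilt.
    by have := Hw i (ltn_addr n ilt); rewrite /= /C ilt.
  have := Hw (m + i)%N; rewrite /= ltn_add2l => /(_ ilt).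
  by rewrite /C ltnNge leq_addr/= addKn.
have gS : gauss_seq P n s (fun i => U (m + i)%N).
  split => // B mB; have := H (fun=> setT) B (fun=> measurableT) mB.
  rewrite big1 => [|i _]; last exact: glaw_setT.
  by rewrite mul1e => <-; congr (P _); apply/seteqP; split => [w //|w []].
split=> // _ _ [A mA ->] [B mB ->].
by rewrite H// (gauss_seq_widen (leq_addr n m) gU).2// gS.2.
Qed.

End blocks.

Section uniform_continuity.
Context {R : realType}.

(** The Heine-Cantor theorem, by the near-covering form of compactness along the filter of moduli
    [dl] tending to 0 from the right. *)
Lemma within_continuous_uniform (f : R -> R) (T : R) :
  {within [set t : R | 0 <= t], continuous f} ->
  forall e, 0 < e -> exists2 dl, 0 < dl &
    forall s t, 0 <= s <= T -> 0 <= t <= T -> `|s - t| < dl -> `|f s - f t| <= e.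
Proof.
move=> /subspace_continuousP cf e e0.
have cK : near_covering (`[0, T]%classic : set R).
  by apply/compact_near_coveringP; exact: segment_compact.
pose Q (dl x : R) := 0 <= x <= T -> forall y, 0 <= y <= T -> `|x - y| < dl -> `|f x - f y| <= e.
have := cK R (0^'+) Q _ _; case=> [x|dl /= dl0 H].
  rewrite /= in_itv/= => /andP[x0 xT].
  have /cvgrPdist_lt/(_ (e / 2)) := cf x x0; rewrite divr_gt0// => /(_ isT).
  rewrite near_withinE => -[eta /= eta0 Heta].
  exists (ball x (eta / 2), [set dl | dl < eta / 2]).
    split=> /=; first by apply: nbhsx_ballx; rewrite divr_gt0.
    by apply: nbhs_right_lt; rewrite divr_gt0.
  move=> [x' dl] /= [bxx' dleta] /andP[x'0 x'T] y /andP[y0 yT] x'y.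
  have xx' : `|x - x'| < eta / 2 := bxx'.
  have h1 : `|f x - f x'| < e / 2.
    by apply: Heta => //=; lra.
  have h2 : `|f x - f y| < e / 2.
    by apply: Heta => //=; have := ler_distD x' x y; lra.
  have := ler_distD (f x) (f x') (f y); rewrite (distrC (f x') (f x)); lra.
exists (dl / 2); first by rewrite divr_gt0.
move=> s t sK tK st; apply: (H (dl / 2) _ _ s) => //=.
- by rewrite sub0r normrN gtr0_norm ?divr_gt0//; lra.
- by rewrite divr_gt0.
Qed.

End uniform_continuity.

(** * The Euler scheme along a path *)

Section euler.
Context {R : realType}.

Lemma expR_first_order (u : R) : 0 <= u -> `|1 - u - expR (- u)| <= u ^+ 2.
Proof.
move=> u0.
have h1 : 1 - u <= expR (- u) by exact: expR_ge1Dx.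
have h2 : expR (- u) <= 1 - u + u ^+ 2.
  have u1 : 0 < 1 + u by lra.
  rewrite expRN -[leRHS]mul1r -ler_pdivrMr; last first.
    by have := sqr_ge0 (u - 2^-1); lra.
  rewrite -[leRHS]invr1 -invfM lef_pV2 ?posrE ?mulr_gt0 ?expR_gt0//; first last.
    by have := sqr_ge0 (u - 2^-1); lra.
  have := expR_ge1Dx u.
  have : 0 <= 1 - u + u ^+ 2 by have := sqr_ge0 (u - 2^-1); lra.
  by have := exprn_ge0 3 u0; nra.
by rewrite ler_norml; apply/andP; split; lra.
Qed.

(** Both terms are powers of numbers in [[0, 1]] that differ by at most [u ^+ 2], so telescoping the
    product costs [M.+1 * u ^+ 2]. *)
Lemma expR_euler_le (x : R) M : 0 <= x -> x <= M.+1%:R ->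
  `|(1 - x / M.+1%:R) ^+ M.+1 - expR (- x)| <= x ^+ 2 / M.+1%:R.
Proof.
move=> x0 xM; have M0 : 0 < M.+1%:R :> R by rewrite ltr0n.
set u := x / M.+1%:R.
have u0 : 0 <= u by rewrite divr_ge0// ltW.
have u1 : u <= 1 by rewrite ler_pdivrMr// mul1r.
have -> : expR (- x) = expR (- u) ^+ M.+1.
  by rewrite -expRM_natl; congr expR; rewrite /u; field; rewrite gt_eqF.
have H := @ler_dist_prod R M.+1 (fun=> 1 - u) (fun=> expR (- u)) _ _.
rewrite !prodr_const !card_ord sumr_const card_ord -mulr_natl in H.
apply: (le_trans (H _ _)).
- by move=> _; rewrite subr_ge0 u1 lerBlDr lerDl.
- by move=> _; rewrite expR_ge0/= -expR0 ler_expR oppr_le0.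
apply: (le_trans (ler_wpM2l (ltW M0) (expR_first_order u0))).
by rewrite le_eqVlt; apply/orP; left; apply/eqP; rewrite /u; field; rewrite gt_eqF.
Qed.

(** Discrete variation of constants; since [r <= 1], local errors add up without being amplified. *)
Lemma euler_recursion_error (r eta : R) (x z : nat -> R) M : 0 <= r <= 1 ->
  (forall j, (j < M)%N -> `|x j.+1 - r * x j - z j| <= eta) ->
  `|x M - r ^+ M * x 0%N - \sum_(j < M) r ^+ (M - j.+1) * z j| <= M%:R * eta.
Proof.
move=> /andP[r0 r1]; elim: M => [|M IH] H.
  by rewrite big_ord0 expr0 mul1r subrr subr0 normr0 mul0r.
have {}IH := IH (fun j jM => H j (leqW jM)).
rewrite big_ord_recr/= subnn expr0 mul1r.
have -> : \sum_(i < M) r ^+ (M.+1 - i.+1) * z i = r * \sum_(i < M) r ^+ (M - i.+1) * z i.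
  by rewrite mulr_sumr; apply: eq_bigr => i _; rewrite mulrA -exprS subnSK// subSS.
rewrite exprS; set S := \sum_(i < M) _ in IH *.
have -> : x M.+1 - r * r ^+ M * x 0%N - (r * S + z M) =
  (x M.+1 - r * x M - z M) + r * (x M - r ^+ M * x 0%N - S) by ring.
apply: (le_trans (ler_normD _ _)); rewrite -natr1 mulrDl mul1r addrC.
apply: lerD; last exact: H.
by apply: le_trans IH; rewrite normrM ger0_norm// ler_piMl.
Qed.

End euler.

Lemma near_div_succ_lt (R : realType) (c e : R) : 0 < e ->
  \forall m \near \oo, c / m.+1%:R < e.
Proof.
move=> e0; have := nbhs_infty_gtr (c / e); apply: filterS => m cm.
rewrite ltr_pdivrMr ?ltr0n// mulrC -ltr_pdivrMr//; apply: (lt_trans cm).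
by rewrite ltr_nat.
Qed.

Section ou_path.
Context {R : realType}.
Variables (theta : R) (f W : R -> R).
Hypotheses (theta0 : 0 < theta)
  (cf : {within [set t : R | 0 <= t], continuous f})
  (ou : forall t, 0 <= t -> f t =
     - theta * Rintegral lebesgue_measure [set s : R | 0 <= s <= t] f + W t).
Local Notation mu := (@lebesgue_measure R).

(** Freezing [f] at [s] in the drift integral over []s, t]] costs its oscillation times the
    length. *)
Lemma ou_increment (s t e : R) : 0 <= s -> s <= t ->
  (forall u, s <= u <= t -> `|f u - f s| <= e) ->
  `|f t - (1 - theta * (t - s)) * f s - (W t - W s)| <= theta * (t - s) * e.
Proof.
move=> s0 st osc; have t0 := le_trans s0 st.
have itvE u : [set v : R | 0 <= v <= u] = `[0, u]%classic by rewrite set_itvcc.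
have int0 : mu.-integrable `[0, t] (EFin \o f).
  apply: continuous_compact_integrable; first exact: segment_compact.
  by apply: continuous_subspaceW cf => u /=; rewrite in_itv/= => /andP[].
have sub : `]s, t] `<=` (`[0, t] : set R).
  move=> u /=; rewrite !in_itv/= => /andP[su ->]; rewrite andbT.
  exact: ltW (le_lt_trans s0 su).
have ints : mu.-integrable `]s, t] (EFin \o f) by exact: integrableS int0.
have mst : measurable (`]s, t]%classic : set (measurableTypeR R)) by exact: measurable_itv.
have muE : fine (mu `]s, t]%classic) = t - s.
  rewrite /= lebesgue_measure_itv/= lte_fin; case: ltgtP st => //= -> _.
  by rewrite subrr.
have intc (c : R) : mu.-integrable `]s, t] (EFin \o cst c).
  have : mu.-integrable `[0, t] (EFin \o cst c).
    apply: continuous_compact_integrable; first exact: segment_compact.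
    by apply: continuous_subspaceT => x; exact: cst_continuous.
  by apply: integrableS.
have B : Rintegral mu `[0, t]%classic f - Rintegral mu `[0, s]%classic f =
    Rintegral mu `]s, t]%classic f.
  by apply: Rintegral_itvB => //; rewrite bnd_simp.
have C : Rintegral mu `]s, t]%classic f =
    Rintegral mu `]s, t]%classic (fun u => f u - f s) + f s * (t - s).
  have H := RintegralB mst ints (intc (f s)).
  rewrite H /= Rintegral_cst// muE; ring.
have intB : mu.-integrable `]s, t] (EFin \o (fun u => f u - f s)).
  have := integrableB mst ints (intc (f s)); apply: eq_integrable => //.
have D : `|Rintegral mu `]s, t]%classic (fun u => f u - f s)| <= e * (t - s).
  apply: (le_trans (le_normr_Rintegral mst intB)).
  rewrite -muE -(Rintegral_cst mu mst e); apply: le_Rintegral => //.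
  - by have := integrable_norm intB; apply: eq_integrable.
  - exact: (intc e).
  move=> u /=; rewrite in_itv/= => /andP[su ut]; apply: osc; rewrite ut andbT.
  exact: ltW.
rewrite !ou// !itvE.
set I := Rintegral mu `[0, t]%classic f in B *.
set J := Rintegral mu `[0, s]%classic f in B *.
have -> : - theta * I + W t - (1 - theta * (t - s)) * (- theta * J + W s) - (W t - W s) =
  - theta * (Rintegral mu `]s, t]%classic (fun u => f u - f s)).
  have fs : f s = - theta * J + W s by rewrite ou// itvE.
  have -> : Rintegral mu `]s, t]%classic (fun u => f u - f s) = I - J - f s * (t - s).
    by rewrite B C addrK.
  by rewrite fs; ring.
rewrite normrM normrN (gtr0_norm theta0).
by rewrite -[leRHS]mulrA ler_pM2l// [(t - s) * e]mulrC.
Qed.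

(** The innovation over one sampling interval is the limit of Euler sums with [m.+1] steps, which
    are linear in the increments of [W]. Half of [e] pays for the local errors, by uniform
    continuity, half for the factor in front of the initial value. *)
Lemma euler_cvg (D : R) (k : nat) : 0 < D ->
  (fun m => \sum_(j < m.+1) (1 - theta * (D / m.+1%:R)) ^+ (m.+1 - j.+1) *
     (W ((k * m.+1 + j).+1%:R * (D / m.+1%:R)) - W ((k * m.+1 + j)%:R * (D / m.+1%:R))))
  @ \oo --> f (k.+1%:R * D) - expR (- (theta * D)) * f (k%:R * D).
Proof.
move=> D0; apply/cvgrPdist_le => e e0.
have tD0 : 0 < theta * D by exact: mulr_gt0.
(* The [m.+1] local errors [theta * h * e1] then sum to [e / 2]. *)
pose e1 := e / 2 / (theta * D).
have e10 : 0 < e1 by rewrite !divr_gt0.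
have [dl dl0 Hdl] := within_continuous_uniform (k.+1%:R * D) cf e10.
have h1 := near_div_succ_lt D dl0.
have h2 := near_div_succ_lt (theta * D) (@ltr01 R).
have h3 := near_div_succ_lt ((theta * D) ^+ 2 * `|f (k%:R * D)|) (divr_gt0 e0 (@ltr0Sn R 1)).
near=> m.
have hdl : D / m.+1%:R < dl by near: m.
have th1' : theta * D / m.+1%:R < 1 by near: m.
have h3' : (theta * D) ^+ 2 * `|f (k%:R * D)| / m.+1%:R < e / 2 by near: m.
have M0 : 0 < m.+1%:R :> R by rewrite ltr0n.
set h := D / m.+1%:R in hdl *.
have h0 : 0 < h by exact: divr_gt0.
have th1 : theta * h < 1 by rewrite /h mulrA.
pose x j := f ((k * m.+1 + j)%:R * h).
pose z j := W ((k * m.+1 + j).+1%:R * h) - W ((k * m.+1 + j)%:R * h).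
have hM : m.+1%:R * h = D by rewrite /h mulrC divfK// gt_eqF.
have xM : x m.+1 = f (k.+1%:R * D).
  by rewrite /x -mulSnr natrM -mulrA hM.
have x0 : x 0%N = f (k%:R * D) by rewrite /x addn0 natrM -mulrA hM.
have r01 : 0 <= 1 - theta * h <= 1.
  by have : 0 < theta * h; [exact: mulr_gt0|move=> ?; apply/andP; split; lra].
have step j : (j < m.+1)%N ->
    `|x j.+1 - (1 - theta * h) * x j - z j| <= theta * h * e1.
  move=> jm; have Sh : (k * m.+1 + j).+1%:R * h - (k * m.+1 + j)%:R * h = h.
    by rewrite -natr1 mulrDl mul1r addrAC subrr add0r.
  have s0 : 0 <= (k * m.+1 + j)%:R * h by rewrite mulr_ge0// ltW.
  have H := @ou_increment ((k * m.+1 + j)%:R * h) ((k * m.+1 + j).+1%:R * h) e1 s0 _ _.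
  rewrite Sh in H; rewrite /x addnS; apply: H; first by lra.
  have tT : (k * m.+1 + j).+1%:R * h <= k.+1%:R * D.
    by rewrite -hM mulrA -natrM ler_pM2r// ler_nat mulSnr -addnS leq_add2l.
  move=> u /andP[u1 u2]; apply: Hdl.
  - by apply/andP; split; lra.
  - by apply/andP; split; lra.
  - by rewrite ger0_norm; lra.
have := euler_recursion_error r01 step; rewrite xM x0 => E.
have E' : m.+1%:R * (theta * h * e1) = e / 2.
  have -> : m.+1%:R * (theta * h * e1) = theta * (m.+1%:R * h) * e1 by ring.
  by rewrite hM /e1 mulrC divfK// gt_eqF.
have Pw : `|((1 - theta * h) ^+ m.+1 - expR (- (theta * D))) * f (k%:R * D)| <= e / 2.
  rewrite normrM; have thE : theta * h = theta * D / m.+1%:R by rewrite /h mulrA.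
  have h2' : theta * D <= m.+1%:R.
    by move: th1; rewrite thE ltr_pdivrMr// mul1r => /ltW.
  have := expR_euler_le (ltW tD0) h2'; rewrite -thE => K.
  apply: (le_trans (ler_wpM2r (normr_ge0 _) K)).
  by rewrite mulrAC; exact: ltW.
set S := \sum_(j < m.+1) _.
have -> : f (k.+1%:R * D) - expR (- (theta * D)) * f (k%:R * D) - S =
  (f (k.+1%:R * D) - (1 - theta * h) ^+ m.+1 * f (k%:R * D) - S) +
  ((1 - theta * h) ^+ m.+1 - expR (- (theta * D))) * f (k%:R * D) by ring.
apply: (le_trans (ler_normD _ _)).
by rewrite E' in E; have := lerD E Pw; rewrite -splitr.
Unshelve. all: by end_near.
Qed.

End ou_path.

Section euler_variance.
Context {R : realType}.
Variables (theta D : R).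
Hypotheses (theta0 : 0 < theta) (D0 : 0 < D).
Local Notation h m := (D / m.+1%:R).
Local Notation r m := (1 - theta * (D / m.+1%:R)).
Local Notation a := (expR (- (theta * D))).

Lemma cvg_div_succ (c : R) : (fun m => c / m.+1%:R) @ \oo --> 0.
Proof.
rewrite -[X in _ --> X](mulr0 c); apply: cvgM; first exact: cvg_cst.
exact: cvg_harmonic.
Qed.

Lemma euler_factor_cvg : (fun m => r m ^+ m.+1) @ \oo --> a.
Proof.
have tD0 : 0 < theta * D by exact: mulr_gt0.
apply/cvgrPdist_le => e e0.
have h1 := near_div_succ_lt (theta * D) (@ltr01 R).
have h2 := near_div_succ_lt ((theta * D) ^+ 2) e0.
move: h1 h2; apply: filterS2 => m h1 h2.
rewrite distrC mulrA; apply: (le_trans (expR_euler_le (ltW tD0) _)); last exact: ltW.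
by move: h1; rewrite ltr_pdivrMr ?ltr0n// mul1r => /ltW.
Qed.

Lemma sum_geometric_sqr (q : R) M :
  (1 - q ^+ 2) * \sum_(j < M) (q ^+ (M - j.+1)) ^+ 2 = 1 - (q ^+ M) ^+ 2.
Proof.
elim: M => [|M IH]; first by rewrite big_ord0 mulr0 expr1n subrr.
rewrite big_ord_recr/= subnn expr0 expr1n.
have -> : \sum_(i < M) (q ^+ (M.+1 - i.+1)) ^+ 2 =
    q ^+ 2 * \sum_(i < M) (q ^+ (M - i.+1)) ^+ 2.
  rewrite mulr_sumr; apply: eq_bigr => i _.
  by rewrite -exprMn -exprS subnSK// subSS.
by rewrite mulrDr mulr1 mulrCA IH [q ^+ M.+1]exprS; ring.
Qed.

(** The geometric sum times [h] is [(1 - r ^+ (2 * m.+1)) / (theta * (2 - theta * h))], because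
    [1 - r ^+ 2 = theta * h * (2 - theta * h)]. *)
Lemma euler_variance_cvg :
  (fun m => `|Num.sqrt (h m)| *
     Num.sqrt (\sum_(j < m.+1) (r m ^+ (m.+1 - j.+1)) ^+ 2)) @ \oo -->
  Num.sqrt ((1 - a ^+ 2) / (2 * theta)).
Proof.
have h_cvg : (fun m => theta * (h m)) @ \oo --> 0.
  by rewrite -[X in _ --> X](mulr0 theta); apply: cvgM; [exact: cvg_cst|exact: cvg_div_succ].
have v_cvg : (fun m => (1 - (r m ^+ m.+1) ^+ 2) / (theta * (2 - theta * (h m)))) @ \oo -->
    (1 - a ^+ 2) / (2 * theta).
  rewrite [2 * theta]mulrC -[X in _ / (_ * X)](subr0 2); apply: cvgM.
    apply: cvgB; first exact: cvg_cst.
    by rewrite expr2; under eq_fun do rewrite expr2; apply: cvgM; exact: euler_factor_cvg.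
  apply: cvgV; first by rewrite subr0 gt_eqF// mulr_gt0.
  by apply: cvgM; [exact: cvg_cst|apply: cvgB; [exact: cvg_cst|]].
have s_cvg : (fun m => Num.sqrt ((1 - (r m ^+ m.+1) ^+ 2) / (theta * (2 - theta * (h m)))))
    @ \oo --> Num.sqrt ((1 - a ^+ 2) / (2 * theta)).
  by apply: continuous_cvg v_cvg; exact: sqrt_continuous.
apply: (cvg_trans _ s_cvg); apply: near_eq_cvg.
have := near_div_succ_lt (theta * D) (@ltr01 R); apply: filterS => m.
rewrite -mulrA => th1; have h0 : 0 < h m by rewrite divr_gt0 ?ltr0n.
rewrite ger0_norm ?sqrtr_ge0// -sqrtrM ?(ltW h0)//; congr Num.sqrt.
have := sum_geometric_sqr (r m) m.+1 => <-.
move: (h m) th1 (\sum_(j < m.+1) _) => u th1 S.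
by field; rewrite !gt_eqF//; lra.
Qed.

End euler_variance.

(** * Law of the innovations *)

Section innovations.
Context d (Om : measurableType d) (R : realType) (P : probability Om R).
Implicit Types W X : R -> Om -> R.

Lemma eq_cyl n (X Y : nat -> Om -> R) : (forall i, (i < n)%N -> X i = Y i) ->
  cyl n X = cyl n Y.
Proof.
move=> XY; have E A : \bigcap_(i in `I_n) (X i @^-1` A i) = \bigcap_(i in `I_n) (Y i @^-1` A i).
  by apply: eq_bigcapr => i /= ilt; rewrite XY.
by apply/seteqP; split => _ [A mA ->]; exists A => //; rewrite E.
Qed.

Lemma std_BM_increments W (h : R) N : is_std_BM P W -> 0 < h ->
  gauss_seq P N (Num.sqrt h) (fun i w => W (i.+1%:R * h) w - W (i%:R * h) w).
Proof.
move=> [mW _ _ lawW incW] h0; have ih i : 0 <= i%:R * h by rewrite mulr_ge0// ltW.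
split => [i|A mA]; first by apply: measurable_funB; exact: mW.
have := incW N (fun i => i%:R * h) A _ _ mA => -> //.
- apply: eq_bigr => i _; rewrite lawW//.
    rewrite -mulrBl -natrB ?leqnSn// subSnn mul1r normal_prob_gauss ?sqrtr_gt0//.
    by congr (@gauss R _); apply/seteqP; split => z; rewrite /= add0r.
  by rewrite ltr_pM2r// ltr_nat.
- by move=> i _; rewrite ler_pM2r// ler_nat.
Qed.

Lemma indep_increments W1 W2 (h : R) N : is_std_BM P W1 -> is_std_BM P W2 ->
  indep_processes P W1 W2 -> 0 < h ->
  forall A B, cyl N (fun i w => W1 (i.+1%:R * h) w - W1 (i%:R * h) w) A ->
    cyl N (fun i w => W2 (i.+1%:R * h) w - W2 (i%:R * h) w) B ->
  (P (A `&` B) = P A * P B)%E.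
Proof.
move=> [mW1 _ _ _ _] [mW2 _ _ _ _] ind h0 A B cA cB.
have ih i : 0 <= i%:R * h by rewrite mulr_ge0// ltW.
have sub W C : cyl N (fun i w => W (i.+1%:R * h) w - W (i%:R * h) w) C ->
    <<s cyl N.+1 (fun i w => W (i%:R * h) w) >> C.
  apply: cyl_sub_sigma => i iN; apply: measurable_funB.
    exact: (@cyl_comp_measurable _ _ _ N.+1 (fun i w => W (i%:R * h) w) i.+1).
  exact: (@cyl_comp_measurable _ _ _ N.+1 (fun i w => W (i%:R * h) w) i (leqW iN)).
apply: (@indep_cyl _ _ _ P N.+1 (fun i w => W1 (i%:R * h) w) (fun i w => W2 (i%:R * h) w)).
- by move=> i; exact: mW1.
- by move=> i; exact: mW2.
- move=> _ _ [C mC ->] [E mE ->].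
  exact: (ind N.+1 N.+1 (fun i => i%:R * h) (fun i => i%:R * h) C E).
- exact: sub.
- exact: sub.
Qed.

Definition innovation (a D : R) X k w := X (k.+1%:R * D) w - a * X (k%:R * D) w.

(** The innovations of both processes form one sequence [U] of length [n + n], the almost sure limit
    of weighted block sums of the joined Brownian increments. *)
Lemma ou_innovations (theta D : R) n W1 W2 X1 X2 :
  let a := expR (- (theta * D)) in
  let sig := Num.sqrt ((1 - a ^+ 2) / (2 * theta)) in
  0 < theta -> 0 < D ->
  is_std_BM P W1 -> is_std_BM P W2 -> indep_processes P W1 W2 ->
  OU_solution P theta W1 X1 -> OU_solution P theta W2 X2 ->
  [/\ gauss_seq P n sig (innovation a D X1), gauss_seq P n sig (innovation a D X2) &
   forall A B, cyl n (innovation a D X2) A -> cyl n (innovation a D X1) B ->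
     (P (A `&` B) = P A * P B)%E].
Proof.
move=> a sig theta0 D0 BM1 BM2 indW [mX1 ou1] [mX2 ou2].
have tD0 : 0 < theta * D by exact: mulr_gt0.
have kD k : 0 <= k%:R * D by rewrite mulr_ge0// ltW.
have mI X : (forall t, 0 <= t -> measurable_fun [set: Om] (X t)) ->
    forall k, measurable_fun [set: Om] (innovation a D X k).
  by move=> mX k; apply: measurable_funB; [exact: mX|apply: measurable_funM => //; exact: mX].
pose U k := if (k < n)%N then innovation a D X1 k else innovation a D X2 (k - n)%N.
have mU k : measurable_fun [set: Om] (U k) by rewrite /U; case: ifP => _; exact: mI.
have sig0 : 0 < sig.
  rewrite sqrtr_gt0 divr_gt0 ?mulr_gt0// subr_gt0 expr_lt1 ?expR_ge0//.
  by rewrite -expR0 ltr_expR oppr_lt0.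
pose h m := D / m.+1%:R.
have h0 m : 0 < h m by rewrite divr_gt0 ?ltr0n.
pose Z m (W : R -> Om -> R) i w := W (i.+1%:R * h m) w - W (i%:R * h m) w.
(* With blocks of length [m.+1], the first [n] come from [W1] and the next [n] from [W2], matching
   [U]. *)
pose V m i := if (i < n * m.+1)%N then Z m W1 i else Z m W2 (i - n * m.+1)%N.
pose c m j := (1 - theta * h m) ^+ (m.+1 - j.+1).
pose Um m k w := \sum_(j < m.+1) c m j * V m (k * m.+1 + j)%N w.
pose sm m := `|Num.sqrt (h m)| * Num.sqrt (\sum_(j < m.+1) c m j ^+ 2).
have gV m : gauss_seq P ((n + n) * m.+1) (Num.sqrt (h m)) (V m).
  rewrite mulnDl; apply: gauss_seq_cat; [exact: std_BM_increments..|].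
  exact: indep_increments.
have gU m : gauss_seq P (n + n) (sm m) (Um m) by exact: gauss_seq_blocks (gV m).
have sm0 m : 0 < sm m.
  rewrite mulr_gt0 ?normr_gt0 ?gt_eqF ?sqrtr_gt0//.
  rewrite big_ord_recr/= /c subnn expr0 expr1n ltr_wpDl// sumr_ge0// => j _.
  exact: sqr_ge0.
have Ucvg : {ae P, forall w, forall k, (k < n + n)%N -> (fun m => Um m k w) @ \oo --> U k w}.
  pose es (W : R -> Om -> R) k w m :=
    \sum_(j < m.+1) c m j * Z m W (k * m.+1 + j)%N w.
  move: ou1 ou2; apply: filterS2 => w [_ c1 e1] [_ c2 e2] k kn.
  have [klt|nk] := ltnP k n.
    rewrite /U klt.
    rewrite (_ : (fun m => Um m k w) = es W1 k w); first exact: (euler_cvg theta0 c1 e1 (k := k) D0).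
    apply/funext => m; apply: eq_bigr => j _; congr (_ * _); rewrite /V.
    by rewrite (_ : (_ < _)%N)// (@leq_trans (k * m.+1 + m.+1)%N) ?ltn_add2l// -mulSnr leq_mul2r klt orbT.
  rewrite /U ltnNge nk /=.
  rewrite (_ : (fun m => Um m k w) = es W2 (k - n)%N w); first exact: (euler_cvg theta0 c2 e2 (k := (k - n)%N) D0).
  apply/funext => m; apply: eq_bigr => j _; congr (_ * _); rewrite /V.
  have nkM : (n * m.+1 <= k * m.+1)%N by rewrite leq_mul2r nk orbT.
  rewrite (_ : (_ < _)%N = false); last by rewrite ltnNge (leq_trans nkM)// leq_addr.
  by rewrite /Z -addnBAC// -mulnBl.
have gall : gauss_seq P (n + n) sig U.
  apply: (gauss_seq_cvg sig0 sm0 _ gU mU Ucvg); exact: euler_variance_cvg.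
have [g2 ind] := gauss_seq_split gall.
have E1 i : (i < n)%N -> U i = innovation a D X1 i by move=> ilt; rewrite /U ilt.
have E2 : (fun i => U (n + i)%N) = innovation a D X2.
  by apply/funext => i; rewrite /U ltnNge leq_addr/= addKn.
rewrite E2 in g2 ind; rewrite (eq_cyl E1) in ind; split=> //.
- split; first exact: mI.
  move=> A mA; rewrite -((gauss_seq_widen (leq_addr n n) gall).2 A mA).
  by congr (P _); apply: eq_bigcapr => i /= ilt; rewrite E1.
- by move=> A B cA cB; rewrite setIC ind// muleC.
Qed.

End innovations.

(** * Rate of convergence *)

Section real_bounds.
Context {R : realType}.

Lemma expR_ge_quadratic (x : R) : 0 <= x -> 1 + x + x ^+ 2 / 2 <= expR x.
Proof.
move=> x0; have -> : 1 + x + x ^+ 2 / 2 = series (exp_coeff x) 3.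
  rewrite /series/= !big_nat_recr//= big_nil /exp_coeff/= expr0 expr1 !factS fact0.
  by rewrite divr1 add0r divr1.
apply: nondecreasing_cvgn_le; last exact: is_cvg_series_exp_coeff.
by apply: nondecreasing_series => i _ _; exact: exp_coeff_ge0.
Qed.

(** The upper bound [expR (- x) <= 1 - x + x ^+ 2 / 2] at [x = 2 u] follows from the quadratic lower
    bound on [expR x], as the product of the two polynomials is [1 + x ^+ 4 / 4]. *)
Lemma ou_coefficient_bounds (u : R) : 0 < u -> 2 * u <= 1 ->
  [/\ u <= 1 - expR (- u) ^+ 2, 1 - expR (- u) ^+ 2 <= 2 * u &
      2 * u - (1 - expR (- u) ^+ 2) <= 2 * u ^+ 2].
Proof.
move=> u0 u1; have -> : expR (- u) ^+ 2 = expR (- (2 * u)).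
  by rewrite -expRM_natl mulrN.
have h1 := expR_ge1Dx (- (2 * u)).
have h2 : expR (- (2 * u)) <= 1 - 2 * u + 2 * u ^+ 2.
  have u20 : 0 <= 2 * u by lra.
  have := expR_ge_quadratic u20 => Q.
  have p0 : 0 < 1 - 2 * u + 2 * u ^+ 2 by have := sqr_ge0 (u - 2^-1); lra.
  rewrite expRN -[leLHS]mul1r ler_pdivrMr ?expR_gt0//.
  apply: (@le_trans _ _ ((1 - 2 * u + 2 * u ^+ 2) * (1 + 2 * u + (2 * u) ^+ 2 / 2))).
    have -> : (1 - 2 * u + 2 * u ^+ 2) * (1 + 2 * u + (2 * u) ^+ 2 / 2) = 1 + 4 * (u ^+ 2) ^+ 2.
      by field.
    by rewrite lerDl; apply: mulr_ge0 => //; exact: sqr_ge0.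
  by rewrite ler_pM2l.
have h3 : 2 * u ^+ 2 <= u by rewrite expr2 mulrA ler_piMl// ltW.
by split; lra.
Qed.

(** With [p = T^(1/4)], [ln T = 4 ln p <= 4 p] while [sqrt T = p ^+ 2]. *)
Lemma ln_div_sqrt_le (e T : R) : 0 < e -> (4 / e) ^+ 4 <= T -> ln T / Num.sqrt T <= e.
Proof.
move=> e0 eT; have e40 : 0 < 4 / e by exact: divr_gt0.
have T0 : 0 < T by apply: lt_le_trans eT; rewrite exprn_gt0.
set q := Num.sqrt T; set p := Num.sqrt q.
have q0 : 0 < q by rewrite sqrtr_gt0.
have p0 : 0 < p by rewrite sqrtr_gt0.
have pq : p ^+ 2 = q by rewrite sqr_sqrtr// ltW.
have qT : q ^+ 2 = T by rewrite sqr_sqrtr// ltW.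
have ep : 4 / e <= p.
  by rewrite -(@ler_pXn2r _ 4)// ?nnegrE ?(ltW e40) ?(ltW p0)// (exprM p 2 2) pq qT.
have lnT : ln T <= 4 * p.
  have -> : T = p ^+ 4 by rewrite (exprM p 2 2) pq qT.
  by rewrite lnXn// -[leLHS]mulr_natl ler_pM2l//; exact: ltW (ln_sublinear p0).
rewrite ler_pdivrMr// (le_trans lnT)// -pq expr2 mulrA ler_pM2r//.
by move: ep; rewrite ler_pdivrMr// mulrC.
Qed.

Lemma rate_le_max (T D : R) n : T = n%:R * D -> 0 < D -> D <= 1 -> 1 <= T -> 1 <= ln T ->
  ln T / Num.sqrt T + D <=
  2 * (ln T * Num.max (powR T (- 2^-1)) (powR (n%:R * D ^+ 2) (3^-1))).
Proof.
move=> TE D0 D1 T1 lT1; set M := Num.max _ _.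
have T0 : 0 < T by exact: lt_le_trans T1.
have h1 : (Num.sqrt T)^-1 <= M.
  by rewrite /M le_max powRN powR12_sqrt ?lexx// ltW.
have h2 : D <= M.
  rewrite /M le_max; apply/orP; right.
  have DE : D = powR (D ^+ 3) (3^-1).
    by rewrite -powR_mulrn ?(ltW D0)// -powRrM mulfV ?powRr1 ?(ltW D0).
  rewrite [leLHS]DE; apply: ge0_ler_powR; rewrite ?nnegrE ?invr_ge0 ?ler0n//.
  - by rewrite exprn_ge0// ltW.
  - by rewrite mulr_ge0 ?ler0n ?sqr_ge0.
  - rewrite expr2 mulrA -TE exprS [T * D]mulrC ler_pM2l//.
    by apply: le_trans T1; rewrite exprn_ile1// ltW.
have M0 : 0 <= M := le_trans (ltW D0) h2.
rewrite mulr_natl mulr2n; apply: lerD; first by rewrite ler_wpM2l// (le_trans _ lT1).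
by rewrite (le_trans h2)// ler_peMl.
Qed.

End real_bounds.

(** * From autoregressive sequences to the sampled processes *)

Section correlation.
Context d (Om : measurableType d) (R : realType) (P : probability Om R).
Implicit Types X W : R -> Om -> R.

Lemma probability_ae_eq (A B : set Om) : measurable A -> measurable B ->
  {ae P, forall w, A w <-> B w} -> P A = P B.
Proof.
move=> mA mB [N [mN N0 sN]].
have sub (C E : set Om) : measurable C -> measurable E ->
    (forall w, ~ N w -> C w -> E w) -> (P C <= P E)%E.
  move=> mC mE CE; apply: (@le_trans _ _ (P (E `|` N))).
    apply: le_measure; rewrite ?inE//; first exact: measurableU.
    by move=> w Cw; have [Nw|Nw] := pselect (N w); [right|left; exact: CE].
  apply: (le_trans (measureU2 _ mE mN)); rewrite -[leRHS]adde0; apply: leeD => //.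
  by rewrite le_eqVlt; apply/orP; left; apply/eqP; exact: N0.
have AB w : ~ N w -> A w <-> B w by move=> Nw; apply: contrapT => nAB; exact/Nw/sN.
by apply/eqP; rewrite eq_le; apply/andP; split; apply: sub => // w /AB[].
Qed.

Lemma ou_ar (theta D : R) W X : 0 < D -> OU_solution P theta W X ->
  let a := expR (- (theta * D)) in
  {ae P, forall w, forall k, X (k%:R * D) w = ar a ((innovation a D X) ^~ w) k}.
Proof.
move=> D0 [mX ou] a; apply: filterS ou => w [X0 _ _] k.
elim: k => [|k IH]; first by rewrite mul0r.
by rewrite [RHS]/= -IH /innovation; ring.
Qed.

Lemma measurable_rhotilde (D : R) n X1 X2 : 0 <= D ->
  (forall t, 0 <= t -> measurable_fun [set: Om] (X1 t)) ->
  (forall t, 0 <= t -> measurable_fun [set: Om] (X2 t)) ->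
  measurable_fun [set: Om] (rhotilde D n X1 X2).
Proof.
move=> D0 mX1 mX2; have kD k : 0 <= k%:R * D by rewrite mulr_ge0.
have mY Xi Xj : (forall t, 0 <= t -> measurable_fun [set: Om] (Xi t)) ->
    (forall t, 0 <= t -> measurable_fun [set: Om] (Xj t)) ->
    measurable_fun [set: Om] (Ytilde D n Xi Xj).
  move=> mXi mXj; apply: (@measurable_scov R D n _ Om (fun k => Xi (k%:R * D)) (fun k => Xj (k%:R * D))).
    by move=> k; exact: mXi.
  by move=> k; exact: mXj.
apply: measurable_div_sqrt; first exact: mY.
by apply: measurable_funM; exact: mY.
Qed.

(** Weights of the errors in [discrete_cdf]: conditional variance, denominators with [12 = 4 * 3],
    and the two exceptional events. *)
Definition rate_constant (theta : R) : R :=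
  8 * variance_constant theta + 12 + 2 * scov_tail_constant theta.

Lemma correlation_cdf (theta D : R) n W1 W2 X1 X2 z :
  let T := n%:R * D in
  0 < theta -> 0 < D -> 2 * (theta * D) <= 1 -> 1 <= Num.sqrt T -> 4 / theta <= Num.sqrt T ->
  1 <= ln T -> ln T / Num.sqrt T <= 6^-1 ->
  is_std_BM P W1 -> is_std_BM P W2 -> indep_processes P W1 W2 ->
  OU_solution P theta W1 X1 -> OU_solution P theta W2 X2 ->
  exists2 p, P [set w | Num.sqrt theta * Num.sqrt T * rhotilde D n X1 X2 w <= z] = p%:E &
    `|p - Phi z| <= rate_constant theta * (ln T / Num.sqrt T + D).
Proof.
move=> T theta0 D0 thD q1 qtheta lT1 lTq BM1 BM2 ind ou1 ou2.
set q := Num.sqrt T in q1 qtheta lTq *.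
pose a := expR (- (theta * D)).
pose sig := Num.sqrt ((1 - a ^+ 2) / (2 * theta)).
have [sl su sd] := ou_coefficient_bounds (mulr_gt0 theta0 D0) thD.
have q0 : 0 < q by exact: lt_le_trans q1.
have T0 : 0 < T by rewrite -sqrtr_gt0.
have a01 : 0 < a < 1 by rewrite expR_gt0 -expR0 ltr_expR oppr_lt0 mulr_gt0.
have [gX gY XY] := ou_innovations n theta0 D0 BM1 BM2 ind ou1 ou2.
have sE : sig ^+ 2 = (1 - a ^+ 2) / (2 * theta).
  rewrite sqr_sqrtr// divr_ge0 ?mulr_ge0 ?(ltW theta0)//.
  by apply: le_trans sl; rewrite mulr_ge0 ?ltW.
have qT : q ^+ 2 = T by rewrite sqr_sqrtr// ltW.
have eps2 : 3 * ln T / q <= 2^-1 by rewrite -mulrA; lra.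
have su' : 1 - a ^+ 2 <= 2 * theta * D by rewrite -mulrA.
have sd' : 2 * theta * D - (1 - a ^+ 2) <= 2 * theta ^+ 2 * D ^+ 2.
  by move: sd; rewrite exprMn !mulrA.
have [up low] := discrete_cdf gX gY XY theta0 D0 a01 sl su' sd' (erefl T) q1 qT sE
  qtheta lT1 eps2 z.
set A := [set w | _]; set B := [set w | _] in up low.
have [mX1 _] := ou1; have [mX2 _] := ou2.
have mI X : (forall t, 0 <= t -> measurable_fun [set: Om] (X t)) ->
    forall k, measurable_fun [set: Om] (fun w => ar a (innovation a D X ^~ w) k).
  move=> mX k; apply: measurable_ar => i _; apply: measurable_funB.
    by apply: mX; rewrite mulr_ge0// ltW.
  by apply: measurable_funM => //; apply: mX; rewrite mulr_ge0// ltW.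
have mle (f : Om -> R) (c : R) : measurable_fun [set: Om] f -> measurable [set w | f w <= c].
  by move=> mf; rewrite -[X in measurable X]setTI;
     apply: (@measurable_fun_ler _ _ R setT f (cst c)).
have mA : measurable A.
  apply: mle; apply: measurable_funM => //; apply: measurable_rhotilde => //.
  exact: ltW.
have mB : measurable B.
  apply: mle; apply: measurable_funM => //; apply: measurable_div_sqrt.
    exact: (@measurable_scov R D n _ Om _ _ (mI X1 mX1) (mI X2 mX2)).
  apply: measurable_funM.
    exact: (@measurable_scov R D n _ Om _ _ (mI X1 mX1) (mI X1 mX1)).
  exact: (@measurable_scov R D n _ Om _ _ (mI X2 mX2) (mI X2 mX2)).
(* The sampled processes satisfy the recursion only almost surely, so the events are compared up to
   a null set. *)
have AB : P A = P B.
  apply: probability_ae_eq => //.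
  move: (ou_ar D0 ou1) (ou_ar D0 ou2); apply: filterS2 => w x1 x2.
  have YE Xi Xj : (forall k, Xi (k%:R * D) w = ar a (innovation a D Xi ^~ w) k) ->
      (forall k, Xj (k%:R * D) w = ar a (innovation a D Xj ^~ w) k) ->
      Ytilde D n Xi Xj w = scov D n (ar a (innovation a D Xi ^~ w)) (ar a (innovation a D Xj ^~ w)).
    move=> xi xj; rewrite /Ytilde /Xtilde /scov.
    by congr (_ * _ - _ * (_ * _) * (_ * _)); apply: eq_bigr => k _; rewrite ?xi ?xj.
  by rewrite /A /B/= /rhotilde !YE.
have pfin : P A = (fine (P A))%:E by rewrite fineK// fin_num_measure.
exists (fine (P A)) => //.
move: up low; rewrite -AB pfin !lee_fin => up low.
set err := 8 * _ + _ + _ in up low.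
have K : err <= rate_constant theta * (ln T / q + D).
  have k0 : 0 <= (2 * theta)^-1 by rewrite invr_ge0 mulr_ge0// ltW.
  have v0 : 0 <= variance_constant theta.
    rewrite /variance_constant; move: (_^-1) k0 => k k0.
    apply: addr_ge0; [apply: addr_ge0; [apply: addr_ge0|]|].
    - by rewrite mulr_ge0// ltW.
    - exact: ler0n.
    - by apply: mulr_ge0 k0; exact: ler0n.
    - by apply: divr_ge0 (ltW theta0); apply: mulr_ge0; [exact: ler0n|exact: addr_ge0].
  have t0 : 0 <= scov_tail_constant theta.
    rewrite /scov_tail_constant /tail_constant; move: (2 * theta)^-1 k0 => k k0.
    apply: addr_ge0; first by rewrite addr_ge0// mulr_ge0// expR_ge0.
    by apply: divr_ge0 (ltW theta0); apply: mulr_ge0; [exact: ler0n|exact: addr_ge0].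
  (* This absorbs every error of order [q^-1] into the logarithmic one. *)
  have lq : q^-1 <= ln T / q by rewrite ler_peMl// invr_ge0 ltW.
  have q10 : 0 < q^-1 by rewrite invr_gt0.
  rewrite /err /rate_constant -[3 * ln T / q]mulrA.
  move: (q^-1) lq q10 => r; move: (ln T * r) => l lq q10.
  move: (variance_constant theta) (scov_tail_constant theta) v0 t0 => v t v0 t0.
  have e1 : 0 <= v * (l - r) by apply: mulr_ge0 => //; rewrite subr_ge0.
  have e2 : 0 <= t * (l - r) by apply: mulr_ge0 => //; rewrite subr_ge0.
  have e3 : 0 <= t * D by apply: mulr_ge0 (ltW D0).
  by move: D0; lra.
by apply: le_trans K; rewrite ler_norml; apply/andP; split; lra.
Qed.

End correlation.

(** What [sufficiently large n] has to provide. The bound [6^-1] keeps [eps = 3 ln T / sqrt T] below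
    1/2, and [4 / theta <= sqrt T] is the condition of the Riccati recursion. *)
Definition sampling_regime (R : realType) (theta D T : R) : Prop :=
  [/\ 2 * (theta * D) <= 1, D <= 1,
      [/\ 1 <= T, 1 <= Num.sqrt T & 4 / theta <= Num.sqrt T],
      1 <= ln T & ln T / Num.sqrt T <= 6^-1].

Lemma sampling_regime_near (R : realType) (theta : R) (Delta : nat -> R) : 0 < theta ->
  (forall n, 0 < Delta n) -> Delta @ \oo --> 0 ->
  (fun n : nat => n%:R * Delta n) @ \oo --> +oo ->
  \forall n \near \oo, sampling_regime theta (Delta n) (n%:R * Delta n).
Proof.
move=> theta0 D0 Dcvg Tcvg.
have Dle e : 0 < e -> \forall n \near \oo, Delta n <= e.
  move=> e0; have /cvgrPdist_le/(_ e e0) := Dcvg; apply: filterS => n.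
  by rewrite sub0r normrN gtr0_norm.
have Tge (B : R) : \forall n \near \oo, B <= n%:R * Delta n.
  by move/cvgryPge : Tcvg; exact.
have t2 : 0 < (2 * theta)^-1 by rewrite invr_gt0 mulr_gt0.
near=> n.
have T1 : 1 <= n%:R * Delta n by near: n; exact: Tge.
have T0 : 0 <= n%:R * Delta n by exact: le_trans T1.
split.
- rewrite mulrA mulrC -ler_pdivlMr ?mulr_gt0// div1r.
  by near: n; exact: Dle.
- by near: n; exact: Dle.
- split => //; first by rewrite -[leLHS]sqrtr1 ler_sqrt.
  rewrite -[leLHS]ger0_norm ?divr_ge0 ?(ltW theta0)// -sqrtr_sqr ler_wsqrtr//.
  by near: n; exact: Tge.
- have eT : expR 1 <= n%:R * Delta n by near: n; exact: Tge.
  by rewrite -[leLHS]expRK ler_ln ?posrE ?expR_gt0// (lt_le_trans (expR_gt0 1)).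
- apply: ln_div_sqrt_le; first by rewrite invr_gt0.
  by near: n; exact: Tge.
Unshelve. all: by end_near.
Qed.

Theorem theorem4p7 (R : realType) (theta : R) :
  0 < theta ->
  exists c : R,
  forall (d : measure_display) (Omega : measurableType d) (P : probability Omega R)
         (W1 W2 X1 X2 : R -> Omega -> R) (Delta : nat -> R),
    is_std_BM P W1 -> is_std_BM P W2 -> indep_processes P W1 W2 ->
    OU_solution P theta W1 X1 -> OU_solution P theta W2 X2 ->
    (forall n, 0 < Delta n) ->
    Delta @ \oo --> 0 ->
    (fun n : nat => n%:R * Delta n) @ \oo --> +oo ->
    (\forall n \near \oo,
        (dKol_std_normal P
           (fun w => (Num.sqrt theta * Num.sqrt (n%:R * Delta n)
                      * rhotilde (Delta n) n X1 X2 w)%R)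
         <= (c * ln (n%:R * Delta n)
             * Num.max (powR (n%:R * Delta n) (- 2^-1))
                       (powR (n%:R * Delta n ^+ 2) (3^-1)))%R%:E)%E)
    /\
    ((fun n : nat => n%:R * Delta n ^+ 2) @ \oo --> 0 ->
     cvg_in_law_normal P
       (fun n w => Num.sqrt (n%:R * Delta n) * rhotilde (Delta n) n X1 X2 w)
       0 (Num.sqrt theta^-1)).
Proof.
move=> theta0; exists (2 * rate_constant theta).
move=> d Om P W1 W2 X1 X2 Delta BM1 BM2 ind ou1 ou2 D0 Dcvg Tcvg.
have regime := sampling_regime_near theta0 D0 Dcvg Tcvg.
have cdf n z : let T := n%:R * Delta n in
    sampling_regime theta (Delta n) T ->
    exists2 p, P [set w | Num.sqrt theta * Num.sqrt T * rhotilde (Delta n) n X1 X2 w <= z] = p%:E &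
      `|p - Phi z| <= rate_constant theta * (ln T / Num.sqrt T + Delta n).
  by move=> T [h1 _ [_ h2 h3] h4 h5]; apply: (correlation_cdf z) BM1 BM2 ind ou1 ou2.
have stdE z : std_normal_cdf z = (Phi z)%:E.
  by rewrite /std_normal_cdf -PhiE gaussE//; exact: measurable_le_set.
(* Read off from the bound itself: at any [n] in the regime a nonnegative number is at most the
   constant times a positive one. *)
have c0 : 0 <= rate_constant theta.
  have [n rn] := filter_ex regime; have [p _ H] := cdf n 0 rn.
  case: rn => _ _ [T1 q1 _] lT1 _.
  have T0 : 0 < ln (n%:R * Delta n) / Num.sqrt (n%:R * Delta n) + Delta n.
    by rewrite addr_gt0// divr_gt0// (lt_le_trans ltr01).
  by rewrite -(pmulr_lge0 _ T0); exact: le_trans H.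
split=> [|_ z].
  apply: filterS regime => n rn; apply: ge_ereal_sup => _ [z _ <-].
  have [p -> H] := cdf n z rn; rewrite stdE -EFinB/= lee_fin.
  case: rn => _ D1 [T1 _ _] lT1 _.
  apply: (le_trans H).
  have := ler_wpM2l c0 (rate_le_max erefl (D0 n) D1 T1 lT1).
  by move=> /le_trans; apply; rewrite le_eqVlt; apply/orP; left; apply/eqP; ring.
have st0 : 0 < Num.sqrt theta by rewrite sqrtr_gt0.
(* Multiplication by [sqrt theta] reduces convergence to the variance [theta^-1] to the standard
   normal bound at the level [sqrt theta * z]. *)
have eventE n : P [set w | Num.sqrt (n%:R * Delta n) * rhotilde (Delta n) n X1 X2 w <= z] =
    P [set w | Num.sqrt theta * Num.sqrt (n%:R * Delta n) * rhotilde (Delta n) n X1 X2 w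
               <= Num.sqrt theta * z].
  by congr (P _); apply/seteqP; split => w /=; rewrite -mulrA ler_pM2l.
have -> : normal_prob 0 (Num.sqrt theta^-1) [set x : R | x <= z] = (Phi (Num.sqrt theta * z))%:E.
  rewrite normal_prob_gauss ?sqrtr_gt0 ?invr_gt0//; last exact: measurable_le_set.
  rewrite -PhiE; congr (@gauss R _); apply/seteqP.
  have E x : (0 + Num.sqrt theta^-1 * x <= z) = (x <= Num.sqrt theta * z).
    by rewrite add0r sqrtrV ?(ltW theta0)// ler_pdivrMl.
  by split => x /=; rewrite E.
apply/fine_cvgP; split.
  by apply: filterS regime => n rn; rewrite eventE; have [p ->] := cdf n (Num.sqrt theta * z) rn.
apply/cvgrPdist_le => e e0.
(* Both terms of the bound are made at most [b]; the [+ 1] keeps the divisor positive. *)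
pose b := e / (2 * (rate_constant theta + 1)).
have b0 : 0 < b by rewrite divr_gt0// mulr_gt0// ltr_wpDl.
have Dle : \forall n \near \oo, Delta n <= b.
  have /cvgrPdist_le/(_ b b0) := Dcvg; apply: filterS => n.
  by rewrite sub0r normrN gtr0_norm.
have Tge : \forall n \near \oo, (4 / b) ^+ 4 <= n%:R * Delta n.
  by move/cvgryPge : Tcvg; exact.
near=> n; rewrite /= eventE.
have [|p -> H] := cdf n (Num.sqrt theta * z); first by near: n.
rewrite distrC (le_trans H)//.
have Db : Delta n <= b by near: n.
have lb : ln (n%:R * Delta n) / Num.sqrt (n%:R * Delta n) <= b.
  by apply: ln_div_sqrt_le => //; near: n.
apply: (le_trans (ler_wpM2l c0 (lerD lb Db))).
have -> : e = (rate_constant theta + 1) * (b + b).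
  by rewrite /b; field; rewrite gt_eqF// ltr_wpDl.
by rewrite ler_wpM2r// ?addr_ge0 ?(ltW b0)// lerDl.
Unshelve. all: by end_near.
Qed.
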